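(* Let $\mathcal{B}$ be a Banach space of analytic functions on $\mathbb{D}$ such that (1) $\mathcal{B}$ has the Fatou property; (2) subsets (i.e. subsequences) of zero sets for $\mathcal{B}$ are zero sets for $\mathcal{B}$; (3) finite unions of zero sets for $\mathcal{B}$ are zero sets for $\mathcal{B}$; (4) finite sets are zero sets for $\mathcal{B}$. If $S$ is a sequence in $\mathbb{D}$ without accumulation points in $\mathbb{D}$ that is a set of uniqueness for $\mathcal{B}$, then there exist $w\in\mathbb{T}$ and a subsequence $\{z_n\}$ of $S$ such that $z_n\to w$ and $\{z_n\}$ is a set of uniqueness for $\mathcal{B}$.
   Context: $\mathbb{D}$ is the open unit disc in $\mathbb{C}$ and $\mathbb{T}$ is the unit circle. A Banach space of analytic functions on $\mathbb{D}$ is a Banach space $\mathcal{B}$ that is injectively embedded in $\mathrm{Hol}(\mathbb{D})$ (the space of holomorphic functions on $\mathbb{D}$) such that for every $z\in\mathbb{D}$ evaluation at $z$ is a continuous functional on $\mathcal{B}$. $\mathcal{B}$ has the Fatou property if for every bounded sequence $\{f_n\}$ in $\mathcal{B}$ that converges locally uniformly on $\mathbb{D}$ to a holomorphic function $f$, one has $f\in\mathcal{B}$ and $\|f\|_{\mathcal{B}}\le\liminf_{n\to\infty}\|f_n\|_{\mathcal{B}}$. Here ''sets'' are sequences of points in $\mathbb{D}$ (possibly finite), in which each point may be repeated finitely many times; repetitions encode multiplicities, and unions are formed counting multiplicities. A holomorphic function $f$ vanishes on a sequence $S$ if $f$ has a zero of multiplicity $\ge k$ at $z$ for each $z$ that is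 repeated $k$ times in $S$. It vanishes exactly on $S$ if it has a zero of multiplicity exactly $k$ at $z$ for each $z$ repeated $k$ times in $S$, and $f(z)\ne0$ for every $z\in\mathbb{D}\setminus S$. $S$ is a zero set for $\mathcal{B}$ if there is $f\in\mathcal{B}$ that vanishes exactly on $S$. $S$ is a set of uniqueness for $\mathcal{B}$ if $f=0$ is the only function in $\mathcal{B}$ that vanishes on $S$. *)

(* Defs.v *)
From Stdlib Require Import Reals List.
From Coquelicot Require Import Coquelicot.

Open Scope R_scope.

Definition in_disc (z : C) : Prop := Cmod z < 1.

Definition unit_circle (z : C) : Prop := Cmod z = 1.

(** [ex_derive] over [C_AbsRing] is complex differentiability. *)
Definition holo_disc (f : C -> C) : Prop :=
  forall z : C, in_disc z -> @ex_derive C_AbsRing C_NormedModule f z.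

(** Near [z], [f w = (w - z)^k * g w] with [g] holomorphic. *)
Definition zero_factor (f : C -> C) (z : C) (k : nat) (g : C -> C) : Prop :=
  locally z (fun w : C =>
    @ex_derive C_AbsRing C_NormedModule g w /\
    f w = ((w - z) ^ k * g w)%C).

Definition zero_mult_ge (f : C -> C) (z : C) (k : nat) : Prop :=
  exists g : C -> C, zero_factor f z k g.

Definition zero_mult_eq (f : C -> C) (z : C) (k : nat) : Prop :=
  exists g : C -> C, zero_factor f z k g /\ g z <> RtoC 0.

(** [len = Some n] encodes a sequence with [n] terms and [len = None] an
    infinite one; the values of the point function at indices beyond the
    length are junk. *)
Definition in_dom (len : option nat) (i : nat) : Prop :=
  match len with
  | Some n => (i < n)%nat
  | None => True
  end.

Record disc_seq : Type := {
  len : option nat;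
  pt : nat -> C;
  pt_disc : forall i : nat, in_dom len i -> in_disc (pt i);
  pt_finite_rep : forall z : C, exists l : list nat,
    forall i : nat, in_dom len i -> pt i = z -> In i l
}.

Definition finite_seq (S : disc_seq) : Prop :=
  exists n : nat, len S = Some n.

Definition occurs (z : C) (S : disc_seq) : Prop :=
  exists i : nat, in_dom (len S) i /\ pt S i = z.

(** [z] is repeated exactly [k] times in [S]; [k = 0] when [z] does not occur. *)
Definition repeated (S : disc_seq) (z : C) (k : nat) : Prop :=
  exists l : list nat,
    NoDup l /\ length l = k /\
    forall i : nat, In i l <-> in_dom (len S) i /\ pt S i = z.

Definition subseq (T S : disc_seq) : Prop :=
  exists phi : nat -> nat,
    (forall i j : nat, in_dom (len T) i -> in_dom (len T) j ->
       (i < j)%nat -> (phi i < phi j)%nat) /\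
    (forall i : nat, in_dom (len T) i ->
       in_dom (len S) (phi i) /\ pt T i = pt S (phi i)).

(** [U] is a union, counting multiplicities, of the sequences in [Ts]
    (in any order: only the multiplicities are prescribed). *)
Definition is_union (Ts : list disc_seq) (U : disc_seq) : Prop :=
  forall (z : C) (ks : list nat),
    List.Forall2 (fun (T : disc_seq) (k : nat) => repeated T z k) Ts ks ->
    repeated U z (list_sum ks).

Definition accumulation_point (S : disc_seq) (z : C) : Prop :=
  forall (eps : posreal) (N : nat), exists i : nat,
    (N <= i)%nat /\ in_dom (len S) i /\ Cmod (pt S i - z) < eps.

Definition vanishes_on (f : C -> C) (S : disc_seq) : Prop :=
  forall (z : C) (k : nat),
    occurs z S -> repeated S z k -> zero_mult_ge f z k.

Definition vanishes_exactly_on (f : C -> C) (S : disc_seq) : Prop :=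
  (forall (z : C) (k : nat),
     occurs z S -> repeated S z k -> zero_mult_eq f z k) /\
  (forall z : C, in_disc z -> ~ occurs z S -> f z <> RtoC 0).

(** [ev b] is the function on the disc attached to [b : B]; its values outside
    the disc are junk. [is_linear] includes boundedness, so each point
    evaluation is a continuous linear functional. *)
Record analytic_embedding (B : CompleteNormedModule C_AbsRing)
    (ev : B -> C -> C) : Prop := {
  ev_holo : forall b : B, holo_disc (ev b);
  ev_inj : forall b c : B,
    (forall z : C, in_disc z -> ev b z = ev c z) -> b = c;
  ev_cont : forall z : C, in_disc z ->
    @is_linear C_AbsRing B C_NormedModule (fun b : B => ev b z)
}.

Definition cvg_locally_uniformly (fs : nat -> C -> C) (f : C -> C) : Prop :=
  forall z : C, in_disc z ->
    exists delta : posreal, forall eps : posreal,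
      eventually (fun n : nat => forall w : C,
        in_disc w -> Cmod (w - z) < delta -> Cmod (fs n w - f w) < eps).

Definition fatou_property (B : CompleteNormedModule C_AbsRing)
    (ev : B -> C -> C) : Prop :=
  forall (b : nat -> B) (f : C -> C),
    (exists M : R, forall n : nat, norm (b n) <= M) ->
    holo_disc f ->
    cvg_locally_uniformly (fun n : nat => ev (b n)) f ->
    exists c : B,
      (forall z : C, in_disc z -> ev c z = f z) /\
      Rbar_le (Finite (norm c)) (LimInf_seq (fun n : nat => norm (b n))).

Definition zero_set (B : CompleteNormedModule C_AbsRing)
    (ev : B -> C -> C) (S : disc_seq) : Prop :=
  exists b : B, vanishes_exactly_on (ev b) S.

Definition uniqueness_set (B : CompleteNormedModule C_AbsRing)
    (ev : B -> C -> C) (S : disc_seq) : Prop :=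
  forall b : B, vanishes_on (ev b) S -> b = zero.

(* Main.v *)
(** A restriction of [S] to a region that is not a set of uniqueness is contained in the zero
    sequence of some nonzero element, hence is a zero set by (2); by (3) a finite union of
    such restrictions is again one. As [S] itself is a set of uniqueness, bisecting the square
    [[-1,1]^2] produces a point [w] such that [S] restricted to any disc around [w] is a set of
    uniqueness; [w] lies on the circle, since near any other point [S] is finite and (4) applies.

    It remains to thin these restrictions out to a sequence converging to [w]. By the uniform
    boundedness principle bounded subsets of [B] are normal families, so by the Fatou property
    bounded elements vanishing on longer and longer finite parts of a set of uniqueness tend to
    [0]. Hence for each [n] and each point [a] of a countable dense set there is a finite part of
    the restriction to the disc of radius [1/n] around [w] such that every element of norm at
    most [N] vanishing on it is at most [1/(N+1)] at [a]. The union of these finite parts is the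
    required sequence.

    Multiplicities are handled through Taylor expansions, which are derived from Goursat's lemma
    (no continuity of the derivative is assumed) applied to a homotopy contracting a circle to a
    point of the disc it bounds. *)
Require Import Defs.
From Stdlib Require Import Reals List.
From Coquelicot Require Import Coquelicot.
From Stdlib Require Import Lra Lia Psatz Classical ClassicalEpsilon Cantor.

(** * Complex differentiability and bisection *)

(** Condition (2) concerns sequences on which some element vanishes exactly. To use it for an
    element that merely vanishes on a part of [S], the complete zero sequence of that element has to
    be produced: its zeros are isolated, hence countable, and each is listed as often as its order.
    This listing need not follow the order of [S], but being a zero set depends only on
    multiplicities. Subsequences and unions are therefore handled through sets of indices. Vanishing
    to order [N] is expressed by a bound [K * Cmod h ^ N]. The constants can be taken to depend only
    on a bound for the function, so the order passes to pointwise limits. In the thinning, a single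
    number codes both a point of the dense set and a norm bound, and it also fixes the radius of the
    disc around the boundary point. Each code contributes finitely many terms, so all but finitely
    many terms of the union are as close to that point as desired. A given element satisfies all
    large norm bounds, hence is 0 at each point of the dense set. *)

Lemma locally_C_Cmod (z : C) (P : C -> Prop) :
  locally z P <->
  exists d : R, 0 < d /\ forall w : C, Cmod (w - z) < d -> P w.
Proof.
  transitivity (@locally (AbsRing_UniformSpace C_AbsRing) z P);
    [apply locally_C|]. split.
  - intros [d Hd]. exists d. split; [apply cond_pos|exact Hd].
  - intros [d [Hd H]]. exists (mkposreal d Hd). exact H.
Qed.

(** Multiplied-out form of the difference quotient: the case [w = z] needs no exception, and error
    terms can be added and multiplied directly. *)
Definition Cdiff (f : C -> C) (z l : C) : Prop :=
  forall eps : R, 0 < eps -> exists d : R, 0 < d /\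
  forall w : C, Cmod (w - z) < d ->
    Cmod (f w - f z - l * (w - z)) <= eps * Cmod (w - z).

Lemma is_derive_Cdiff (f : C -> C) (z l : C) :
  @is_derive C_AbsRing C_NormedModule f z l <-> Cdiff f z l.
Proof.
  split.
  - intros [_ H] eps Heps.
    specialize (H z (fun P HP => HP) (mkposreal eps Heps)).
    destruct H as [d Hd]. exists d. split; [apply cond_pos|].
    intros w Hw. specialize (Hd w Hw).
    replace (l * (w - z))%C with ((w - z) * l)%C by ring. exact Hd.
  - intros H. split; [apply is_linear_scal_l|].
    intros x Hx eps.
    assert (E : z = x).
    { apply is_filter_lim_locally_unique with (x := z) (y := x) (1 := Hx). }
    subst x.
    destruct (H eps (cond_pos eps)) as [d [Hd Hw]].
    exists (mkposreal d Hd). intros w Hwd. specialize (Hw w Hwd).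
    replace (l * (w - z))%C with ((w - z) * l)%C in Hw by ring. exact Hw.
Qed.

Lemma ex_derive_Cdiff (f : C -> C) (z : C) :
  @ex_derive C_AbsRing C_NormedModule f z <-> exists l : C, Cdiff f z l.
Proof.
  split; intros [l H]; exists l; apply is_derive_Cdiff; exact H.
Qed.

Lemma Cdiff_cont (f : C -> C) (z l : C) : Cdiff f z l ->
  forall eps : R, 0 < eps -> exists d : R, 0 < d /\
  forall w : C, Cmod (w - z) < d -> Cmod (f w - f z) < eps.
Proof.
  intros H eps Heps.
  destruct (H 1 Rlt_0_1) as [d [Hd Hw]].
  pose proof (Cmod_ge_0 l) as Hl.
  exists (Rmin d (eps / (Cmod l + 2))). split.
  - apply Rmin_pos; [exact Hd|apply Rdiv_lt_0_compat; lra].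
  - intros w Hw1.
    assert (H1 : Cmod (w - z) < d) by (eapply Rlt_le_trans; [exact Hw1|apply Rmin_l]).
    assert (H2 : Cmod (w - z) < eps / (Cmod l + 2)) by (eapply Rlt_le_trans; [exact Hw1|apply Rmin_r]).
    specialize (Hw w H1).
    replace (f w - f z)%C with ((f w - f z - l * (w - z)) + l * (w - z))%C by ring.
    eapply Rle_lt_trans; [apply Cmod_triangle|].
    rewrite Cmod_mult.
    apply (Rmult_lt_compat_r (Cmod l + 2)) in H2; [|lra].
    unfold Rdiv in H2. rewrite Rmult_assoc, Rinv_l, Rmult_1_r in H2 by lra.
    pose proof (Cmod_ge_0 (w - z)). nra.
Qed.

Lemma Cdiff_continuous (f : C -> C) (z l : C) : Cdiff f z l ->
  @continuous C_UniformSpace C_UniformSpace f z.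
Proof.
  intros H P HP. apply locally_C_Cmod in HP. destruct HP as [e [He HP]].
  apply locally_C_Cmod. destruct (Cdiff_cont f z l H e He) as [d [Hd Hw]].
  exists d. split; [exact Hd|]. intros w Hwd. apply HP, Hw, Hwd.
Qed.

Lemma Cdiff_ext_loc (f g : C -> C) (z l : C) (r : R) : 0 < r ->
  (forall w, Cmod (w - z) < r -> f w = g w) -> Cdiff f z l -> Cdiff g z l.
Proof.
  intros Hr E H eps Heps. destruct (H eps Heps) as [d [Hd Hw]].
  exists (Rmin d r). split; [apply Rmin_pos; assumption|].
  intros w Hwd.
  rewrite <- E by (eapply Rlt_le_trans; [exact Hwd|apply Rmin_r]).
  rewrite <- E.
  - apply Hw. eapply Rlt_le_trans; [exact Hwd|apply Rmin_l].
  - replace (z - z)%C with (RtoC 0) by ring. rewrite Cmod_0. exact Hr.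
Qed.

Lemma Cdiff_const (c z : C) : Cdiff (fun _ => c) z 0.
Proof.
  intros eps Heps. exists 1. split; [lra|]. intros w _.
  replace (c - c - 0 * (w - z))%C with (RtoC 0) by ring. rewrite Cmod_0.
  apply Rmult_le_pos; [lra|apply Cmod_ge_0].
Qed.

Lemma Cdiff_sub_const (f : C -> C) (c z l : C) :
  Cdiff f z l -> Cdiff (fun w => f w - c)%C z l.
Proof.
  intros H eps Heps. destruct (H eps Heps) as [d [Hd Hw]].
  exists d. split; [exact Hd|]. intros w Hwd. specialize (Hw w Hwd).
  replace (f w - c - (f z - c) - l * (w - z))%C
    with (f w - f z - l * (w - z))%C by ring. exact Hw.
Qed.

Lemma Cdiff_mult (f g : C -> C) (z l m : C) : Cdiff f z l -> Cdiff g z m ->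
  Cdiff (fun w => f w * g w)%C z (l * g z + f z * m)%C.
Proof.
  intros Hf Hg eps Heps.
  pose proof (Cmod_ge_0 l) as Pl. pose proof (Cmod_ge_0 (f z)) as Pf.
  pose proof (Cmod_ge_0 (g z)) as Pg.
  (* The three error terms are at most [eps / A] times [Cmod (w - z)] times [Cmod (g z) + 1],
     [Cmod l] and [Cmod (f z)]; [A] is the sum of these factors. *)
  set (A := Cmod (g z) + 1 + Cmod l + Cmod (f z)).
  assert (PA : 0 < A) by (unfold A; lra).
  assert (Pe : 0 < eps / A) by (apply Rdiv_lt_0_compat; assumption).
  destruct (Hf _ Pe) as [d1 [Hd1 H1]].
  destruct (Hg _ Pe) as [d2 [Hd2 H2]].
  destruct (Cdiff_cont g z m Hg (Rmin 1 (eps / A))) as [d3 [Hd3 H3]].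
  { apply Rmin_pos; [lra|exact Pe]. }
  exists (Rmin d1 (Rmin d2 d3)). split; [repeat apply Rmin_pos; assumption|].
  intros w Hw.
  pose proof (Rmin_l d1 (Rmin d2 d3)). pose proof (Rmin_r d1 (Rmin d2 d3)).
  pose proof (Rmin_l d2 d3). pose proof (Rmin_r d2 d3).
  specialize (H1 w ltac:(lra)). specialize (H2 w ltac:(lra)).
  specialize (H3 w ltac:(lra)).
  pose proof (Rmin_l 1 (eps / A)). pose proof (Rmin_r 1 (eps / A)).
  assert (Gw : Cmod (g w) <= Cmod (g z) + 1).
  { replace (g w) with (g z + (g w - g z))%C by ring.
    eapply Rle_trans; [apply Cmod_triangle|]. lra. }
  replace (f w * g w - f z * g z - (l * g z + f z * m) * (w - z))%C
    with ((f w - f z - l * (w - z)) * g w +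
          (l * (w - z) * (g w - g z) + f z * (g w - g z - m * (w - z))))%C by ring.
  eapply Rle_trans; [apply Cmod_triangle|].
  assert (T := Cmod_triangle (l * (w - z) * (g w - g z)) (f z * (g w - g z - m * (w - z)))).
  rewrite !Cmod_mult in T. rewrite Cmod_mult.
  pose proof (Cmod_ge_0 (w - z)) as Pd. pose proof (Cmod_ge_0 (g w)) as Pgw.
  pose proof (Cmod_ge_0 (f w - f z - l * (w - z))).
  set (e := eps / A) in *. set (D := Cmod (w - z)) in *.
  assert (He : eps = e * A) by (unfold e; field; lra).
  clearbody e.
  assert (X1 : Cmod (f w - f z - l * (w - z)) * Cmod (g w) <= e * D * (Cmod (g z) + 1)).
  { apply Rmult_le_compat; assumption. }
  assert (X2 : Cmod l * D * Cmod (g w - g z) <= Cmod l * D * e).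
  { apply Rmult_le_compat_l; [apply Rmult_le_pos; assumption|lra]. }
  assert (X3 : Cmod (f z) * Cmod (g w - g z - m * (w - z)) <= Cmod (f z) * (e * D)).
  { apply Rmult_le_compat_l; assumption. }
  subst eps. unfold A in *. nra.
Qed.

Lemma Cdiff_inv_sub (a z : C) : z <> a ->
  exists l, Cdiff (fun w => / (w - a))%C z l.
Proof.
  intros Hza. exists (- / ((z - a) * (z - a)))%C.
  intros eps Heps.
  assert (N : (z - a)%C <> 0).
  { intros E. apply Hza. replace z with ((z - a) + a)%C by ring. rewrite E. ring. }
  set (r := Cmod (z - a)).
  assert (Hr : 0 < r) by (apply Cmod_gt_0; exact N).
  (* The error is (w - z)^2 / ((w - a) (z - a)^2). The first bound keeps [Cmod (w - a)] at least
     [r / 2], so the error is at most 2 |w - z|^2 / r^3; the second makes this at most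
     [eps * Cmod (w - z)]. *)
  exists (Rmin (r / 2) (eps * (r * r * r) / 2)). split.
  { apply Rmin_pos; [lra|]. apply Rdiv_lt_0_compat; [|lra].
    repeat apply Rmult_lt_0_compat; assumption. }
  intros w Hw.
  pose proof (Rmin_l (r / 2) (eps * (r * r * r) / 2)).
  pose proof (Rmin_r (r / 2) (eps * (r * r * r) / 2)).
  assert (Hwa : r / 2 <= Cmod (w - a)).
  { assert (T := Cmod_triangle (w - a) (- (w - z))).
    rewrite Cmod_opp in T.
    replace ((w - a) + - (w - z))%C with (z - a)%C in T by ring. fold r in T. lra. }
  assert (N2 : (w - a)%C <> 0) by (apply Cmod_gt_0; lra).
  replace (/ (w - a) - / (z - a) - - / ((z - a) * (z - a)) * (w - z))%C
    with ((w - z) * ((w - z) * (/ (w - a) * (/ (z - a) * / (z - a)))))%C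
    by (field; split; assumption).
  rewrite Cmod_mult, Rmult_comm. apply Rmult_le_compat_r; [apply Cmod_ge_0|].
  rewrite !Cmod_mult, !Cmod_inv by assumption. fold r.
  assert (I : / Cmod (w - a) <= 2 / r).
  { apply Rle_trans with (/ (r / 2)); [apply Rinv_le_contravar; lra|right; field; lra]. }
  assert (Q : 0 < / r * / r) by (apply Rmult_lt_0_compat; apply Rinv_0_lt_compat; lra).
  assert (Pd := Cmod_ge_0 (w - z)).
  apply Rle_trans with ((eps * (r * r * r) / 2) * (2 / r * (/ r * / r))).
  - apply Rmult_le_compat; try lra.
    + apply Rmult_le_pos; [|lra]. left. apply Rinv_0_lt_compat. lra.
    + apply Rmult_le_compat_r; lra.
  - right. field. lra.
Qed.

Lemma choice {A B : Type} (R : A -> B -> Prop) :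
  (forall x, exists y, R x y) -> exists f : A -> B, forall x, R x (f x).
Proof.
  intros H. exists (fun x => proj1_sig (constructive_indefinite_description _ (H x))).
  intros x. apply proj2_sig.
Qed.

(** If [P] fails for a square, it fails for one of its quarters; nested failing squares shrink to a
    point and contradict the local hypothesis there. This is the compactness principle behind
    Goursat's lemma, bounds on closed discs and the choice of the concentration point. *)
Lemma square_bisection (P : R -> R -> R -> Prop) (x0 y0 h0 : R) :
  0 < h0 ->
  (forall x y h, 0 < h ->
    P x y (h / 2) -> P (x + h / 2) y (h / 2) ->
    P x (y + h / 2) (h / 2) -> P (x + h / 2) (y + h / 2) (h / 2) -> P x y h) ->
  (forall p q, x0 <= p <= x0 + h0 -> y0 <= q <= y0 + h0 ->
    exists d, 0 < d /\ forall x y h, 0 < h < d ->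
      x <= p <= x + h -> y <= q <= y + h -> P x y h) ->
  P x0 y0 h0.
Proof.
  intros Hh0 Hsplit Hloc. apply NNPP. intros HN.
  set (good := fun (s : R * R * R) (t : R * R * R) =>
    snd t = snd s / 2 /\
    fst (fst s) <= fst (fst t) /\ fst (fst t) + snd t <= fst (fst s) + snd s /\
    snd (fst s) <= snd (fst t) /\ snd (fst t) + snd t <= snd (fst s) + snd s /\
    ~ P (fst (fst t)) (snd (fst t)) (snd t)).
  assert (Hstep : forall s : R * R * R, exists t,
    0 < snd s -> ~ P (fst (fst s)) (snd (fst s)) (snd s) -> good s t).
  { intros [[x y] h]. simpl.
    destruct (classic (0 < h /\ ~ P x y h)) as [[Hh Hn]|Hn];
      [|exists (x, y, h); intros; tauto].
    destruct (classic (P x y (h / 2))) as [H1|H1];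
      [|exists (x, y, h / 2); intros; unfold good; simpl; repeat split; try lra; exact H1].
    destruct (classic (P (x + h / 2) y (h / 2))) as [H2|H2];
      [|exists (x + h / 2, y, h / 2); intros; unfold good; simpl; repeat split; try lra; exact H2].
    destruct (classic (P x (y + h / 2) (h / 2))) as [H3|H3];
      [|exists (x, y + h / 2, h / 2); intros; unfold good; simpl; repeat split; try lra; exact H3].
    exists (x + h / 2, y + h / 2, h / 2). intros; unfold good; simpl; repeat split; try lra.
    intros H4. apply Hn. apply Hsplit; assumption. }
  destruct (choice _ Hstep) as [next Hnxt].
  set (u := fix u (n : nat) : R * R * R :=
    match n with O => (x0, y0, h0) | S m => next (u m) end).
  assert (Hinv : forall n, 0 < snd (u n) /\
    ~ P (fst (fst (u n))) (snd (fst (u n))) (snd (u n))).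
  { induction n as [|n [I1 I2]]; [split; assumption|]. simpl.
    destruct (Hnxt (u n) I1 I2) as [G1 [_ [_ [_ [_ G2]]]]]. split; [lra|exact G2]. }
  assert (Hnext : forall n, good (u n) (u (S n))).
  { intros n. simpl. apply Hnxt; apply Hinv. }
  set (X := fun n => fst (fst (u n))). set (Y := fun n => snd (fst (u n))).
  set (H := fun n => snd (u n)).
  assert (Hmono : forall n k, X n <= X (n + k)%nat /\ X (n + k)%nat + H (n + k)%nat <= X n + H n /\
    Y n <= Y (n + k)%nat /\ Y (n + k)%nat + H (n + k)%nat <= Y n + H n).
  { intros n k. induction k as [|k IH]; [rewrite Nat.add_0_r; lra|].
    rewrite Nat.add_succ_r. destruct (Hnext (n + k)%nat) as [_ [G1 [G2 [G3 [G4 _]]]]].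
    unfold X, Y, H in *. lra. }
  assert (Hpos : forall n, 0 < H n) by (intros n; apply Hinv).
  (* For either coordinate every left end lies below every right end; [p] is the supremum of the
     left ends. *)
  assert (Hcross : forall Z : nat -> R,
    (forall n k, Z n <= Z (n + k)%nat /\ Z (n + k)%nat + H (n + k)%nat <= Z n + H n) ->
    exists p, forall n, Z n <= p <= Z n + H n).
  { intros Z HZ.
    assert (Hc : forall n m, Z n <= Z m + H m).
    { intros n m. destruct (Nat.le_ge_cases n m) as [L|L].
      - replace m with (n + (m - n))%nat by lia.
        destruct (HZ n (m - n)%nat). pose proof (Hpos (n + (m - n))%nat). lra.
      - replace n with (m + (n - m))%nat by lia.
        destruct (HZ m (n - m)%nat). pose proof (Hpos (m + (n - m))%nat). lra. }
    destruct (completeness (fun r => exists n, r = Z n)) as [p [Hp1 Hp2]].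
    - exists (Z 0%nat + H 0%nat). intros r [n ->]. apply Hc.
    - exists (Z 0%nat). exists 0%nat. reflexivity.
    - exists p. intros n. split; [apply Hp1; exists n; reflexivity|].
      apply Hp2. intros r [m ->]. apply Hc. }
  destruct (Hcross X) as [p Hp]; [intros n k; destruct (Hmono n k) as [? [? _]]; split; assumption|].
  destruct (Hcross Y) as [q Hq]; [intros n k; destruct (Hmono n k) as [_ [_ [? ?]]]; split; assumption|].
  destruct (Hloc p q (Hp 0%nat) (Hq 0%nat)) as [d [Hd HP]].
  assert (HH : forall n, H n = h0 * (/ 2) ^ n).
  { induction n as [|n IH]; [unfold H; simpl; lra|].
    destruct (Hnext n) as [G _]. unfold H in *. rewrite G, IH. simpl. lra. }
  destruct (pow_lt_1_zero (/ 2) ltac:(rewrite Rabs_pos_eq; lra) (d / h0)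
    ltac:(apply Rdiv_lt_0_compat; assumption)) as [N HNN].
  specialize (HNN N (le_n N)).
  destruct (Hinv N) as [_ HnP]. apply HnP. apply (HP (X N) (Y N) (H N)); [|apply Hp|apply Hq].
  split; [apply Hpos|]. rewrite HH.
  rewrite Rabs_pos_eq in HNN by (apply pow_le; lra).
  apply (Rmult_lt_compat_l h0) in HNN; [|exact Hh0].
  replace (h0 * (d / h0)) with d in HNN by (field; lra). exact HNN.
Qed.

(** * Integrals of complex-valued functions and Goursat's lemma *)

(** Continuity, derivative and integral of curves in the plane are taken componentwise, which
    reduces them to real calculus. *)
Definition ccont (g : R -> C) (x : R) : Prop :=
  continuous (fun t => Re (g t)) x /\ continuous (fun t => Im (g t)) x.

Definition cder (g : R -> C) (x : R) (l : C) : Prop :=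
  is_derive (fun t => Re (g t)) x (Re l) /\ is_derive (fun t => Im (g t)) x (Im l).

Definition is_CInt (g : R -> C) (a b : R) (l : C) : Prop :=
  is_RInt (fun t => Re (g t)) a b (Re l) /\ is_RInt (fun t => Im (g t)) a b (Im l).

Definition CInt (g : R -> C) (a b : R) : C :=
  (RInt (fun t => Re (g t)) a b, RInt (fun t => Im (g t)) a b).

Lemma C_eq_Re_Im (z w : C) : Re z = Re w -> Im z = Im w -> z = w.
Proof. destruct z, w. simpl. intros -> ->. reflexivity. Qed.

Lemma ccont_const (c : C) (x : R) : ccont (fun _ => c) x.
Proof. split; apply continuous_const. Qed.

Lemma ccont_ext (f g : R -> C) (x : R) : (forall t, f t = g t) -> ccont f x -> ccont g x.
Proof.
  intros E [H1 H2]. split; eapply continuous_ext; [|exact H1| |exact H2];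
    intros t; simpl; rewrite E; reflexivity.
Qed.

Lemma ccont_mult (f g : R -> C) (x : R) :
  ccont f x -> ccont g x -> ccont (fun t => f t * g t)%C x.
Proof.
  intros [F1 F2] [G1 G2]. split; simpl.
  - apply (continuous_minus (fun t => Re (f t) * Re (g t)) (fun t => Im (f t) * Im (g t)));
    apply (continuous_mult (K := R_AbsRing)); assumption.
  - apply (continuous_plus (fun t => Re (f t) * Im (g t)) (fun t => Im (f t) * Re (g t)));
    apply (continuous_mult (K := R_AbsRing)); assumption.
Qed.

Lemma ccont_minus (f g : R -> C) (x : R) :
  ccont f x -> ccont g x -> ccont (fun t => f t - g t)%C x.
Proof.
  intros [F1 F2] [G1 G2]. split; simpl;
  apply (continuous_minus (V := R_NormedModule)); assumption.
Qed.

Lemma ccont_plus (f g : R -> C) (x : R) :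
  ccont f x -> ccont g x -> ccont (fun t => f t + g t)%C x.
Proof.
  intros [F1 F2] [G1 G2]. split; simpl;
  apply (continuous_plus (V := R_NormedModule)); assumption.
Qed.

Lemma ccont_pow (f : R -> C) (x : R) (n : nat) :
  ccont f x -> ccont (fun t => (f t) ^ n)%C x.
Proof.
  intros H. induction n as [|n IH].
  - apply (ccont_ext (fun _ => RtoC 1)); [reflexivity|apply ccont_const].
  - apply (ccont_ext (fun t => f t * (f t) ^ n)%C).
    + intros t. symmetry. apply Cpow_S.
    + apply ccont_mult; assumption.
Qed.

Lemma cder_ccont (f : R -> C) (x : R) (l : C) : cder f x l -> ccont f x.
Proof.
  intros [H1 H2]. split; apply (@ex_derive_continuous R_AbsRing R_NormedModule);
  eexists; eassumption.
Qed.

Lemma ccont_comp (F : C -> C) (g : R -> C) (x : R) (l : C) :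
  ccont g x -> Cdiff F (g x) l -> ccont (fun t => F (g t)) x.
Proof.
  intros [G1 G2] HF. apply Cdiff_continuous in HF.
  assert (H : @continuous R_UniformSpace C_UniformSpace (fun t => F (g t)) x).
  { apply (continuous_comp g F); [|exact HF].
    apply filterlim_locally. intros eps.
    apply (proj1 (filterlim_locally _ _)) with (eps := eps) in G1.
    apply (proj1 (filterlim_locally _ _)) with (eps := eps) in G2.
    generalize (filter_and _ _ G1 G2). apply filter_imp.
    intros t [T1 T2]. split; assumption. }
  split.
  - apply (continuous_comp (fun t => F (g t)) (fst : C -> R)); [exact H|].
    destruct (F (g x)). apply (continuous_fst (U := R_UniformSpace) (V := R_UniformSpace)).
  - apply (continuous_comp (fun t => F (g t)) (snd : C -> R)); [exact H|].
    destruct (F (g x)). apply (continuous_snd (U := R_UniformSpace) (V := R_UniformSpace)).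
Qed.

Lemma is_derive_Rmult (f g : R -> R) (x l m : R) :
  is_derive f x l -> is_derive g x m ->
  is_derive (fun t => f t * g t) x (l * g x + f x * m).
Proof.
  intros Hf Hg. exact (is_derive_mult f g x l m Hf Hg Rmult_comm).
Qed.

Lemma cder_mult (f g : R -> C) (x : R) (l m : C) :
  cder f x l -> cder g x m -> cder (fun t => f t * g t)%C x (l * g x + f x * m)%C.
Proof.
  intros [F1 F2] [G1 G2]. split.
  - pose proof (is_derive_minus (V := R_NormedModule) _ _ _ _ _
      (is_derive_Rmult _ _ _ _ _ F1 G1) (is_derive_Rmult _ _ _ _ _ F2 G2)) as D.
    replace (Re (l * g x + f x * m)) with
      (minus (Re l * Re (g x) + Re (f x) * Re m) (Im l * Im (g x) + Im (f x) * Im m));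
      [exact D|].
    unfold minus, plus, opp; simpl. unfold Re, Im. ring.
  - pose proof (is_derive_plus (V := R_NormedModule) _ _ _ _ _
      (is_derive_Rmult _ _ _ _ _ F1 G2) (is_derive_Rmult _ _ _ _ _ F2 G1)) as D.
    replace (Im (l * g x + f x * m)) with
      (plus (Re l * Im (g x) + Re (f x) * Im m) (Im l * Re (g x) + Im (f x) * Re m));
      [exact D|].
    unfold plus; simpl. unfold Re, Im. ring.
Qed.

Lemma cder_plus (f g : R -> C) (x : R) (l m : C) :
  cder f x l -> cder g x m -> cder (fun t => f t + g t)%C x (l + m)%C.
Proof.
  intros [F1 F2] [G1 G2]. split; simpl;
  apply (is_derive_plus (V := R_NormedModule)); assumption.
Qed.

Lemma cder_const (c : C) (x : R) : cder (fun _ => c) x 0.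
Proof. split; apply (is_derive_const (V := R_NormedModule)). Qed.

Lemma cder_eq (f : R -> C) (x : R) (l m : C) : l = m -> cder f x l -> cder f x m.
Proof. intros ->. exact (fun H => H). Qed.

Lemma is_CInt_unique (g : R -> C) (a b : R) (l : C) : is_CInt g a b l -> CInt g a b = l.
Proof.
  intros [H1 H2]. apply C_eq_Re_Im; simpl; apply is_RInt_unique; assumption.
Qed.

Lemma CInt_correct (g : R -> C) (a b : R) : a <= b ->
  (forall t, a <= t <= b -> ccont g t) -> is_CInt g a b (CInt g a b).
Proof.
  intros Hab H.
  assert (X : forall f : R -> R, (forall t, a <= t <= b -> continuous f t) ->
    is_RInt f a b (RInt f a b)).
  { intros f Hf. apply (RInt_correct (V := R_CompleteNormedModule) f).
    apply (ex_RInt_continuous (V := R_CompleteNormedModule) f). intros z Hz.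
    rewrite Rmin_left, Rmax_right in Hz by assumption. apply Hf, Hz. }
  split; [exact (X _ (fun t Ht => proj1 (H t Ht)))|exact (X _ (fun t Ht => proj2 (H t Ht)))].
Qed.

Lemma is_CInt_ext (f g : R -> C) (a b : R) (l : C) : a <= b ->
  (forall t, a <= t <= b -> f t = g t) -> is_CInt f a b l -> is_CInt g a b l.
Proof.
  intros Hab E [H1 H2]. split; eapply is_RInt_ext; try eassumption;
  intros t Ht; rewrite Rmin_left, Rmax_right in Ht by assumption; simpl;
  rewrite E by lra; reflexivity.
Qed.

Lemma is_CInt_minus (f g : R -> C) (a b : R) (l m : C) :
  is_CInt f a b l -> is_CInt g a b m -> is_CInt (fun t => f t - g t)%C a b (l - m)%C.
Proof.
  intros [F1 F2] [G1 G2]. split; simpl;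
  apply (is_RInt_minus (V := R_NormedModule)); assumption.
Qed.

Lemma is_CInt_plus (f g : R -> C) (a b : R) (l m : C) :
  is_CInt f a b l -> is_CInt g a b m -> is_CInt (fun t => f t + g t)%C a b (l + m)%C.
Proof.
  intros [F1 F2] [G1 G2]. split; simpl;
  apply (is_RInt_plus (V := R_NormedModule)); assumption.
Qed.

Lemma is_CInt_scal (c : C) (f : R -> C) (a b : R) (l : C) :
  is_CInt f a b l -> is_CInt (fun t => c * f t)%C a b (c * l)%C.
Proof.
  intros [F1 F2]. split; simpl.
  - apply (is_RInt_minus (V := R_NormedModule));
    apply (is_RInt_scal (V := R_NormedModule)); assumption.
  - apply (is_RInt_plus (V := R_NormedModule));
    apply (is_RInt_scal (V := R_NormedModule)); assumption.
Qed.

Lemma is_CInt_Chasles (f : R -> C) (a b c : R) (l m : C) :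
  is_CInt f a b l -> is_CInt f b c m -> is_CInt f a c (l + m)%C.
Proof.
  intros [F1 F2] [G1 G2]. split; simpl;
  eapply (is_RInt_Chasles (V := R_NormedModule)); eassumption.
Qed.

(** The bound is that of the vector-valued integral in [C_R_NormedModule], whose norm is [Cmod];
    treating the two components separately would cost a constant factor. *)
Lemma is_CInt_bound (g : R -> C) (a b M : R) (l : C) : a <= b ->
  (forall t, a <= t <= b -> Cmod (g t) <= M) -> is_CInt g a b l ->
  Cmod l <= (b - a) * M.
Proof.
  intros Hab HM [H1 H2]. rewrite Cmod_norm.
  apply (norm_RInt_le (V := C_R_NormedModule) g (fun _ => M) a b); [exact Hab| | |].
  - intros t Ht. eapply Rle_trans; [right; symmetry; exact (Cmod_norm (g t))|apply HM, Ht].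
  - destruct l. apply (is_RInt_fct_extend_pair (U := R_NormedModule) (V := R_NormedModule)); assumption.
  - apply (is_RInt_const (V := R_NormedModule)).
Qed.

Lemma is_CInt_derive (g dg : R -> C) (a b : R) : a <= b ->
  (forall t, a <= t <= b -> cder g t (dg t)) ->
  (forall t, a <= t <= b -> ccont dg t) ->
  is_CInt dg a b (g b - g a)%C.
Proof.
  intros Hab H1 H2.
  assert (X : forall f df : R -> R, (forall t, a <= t <= b -> is_derive f t (df t)) ->
    (forall t, a <= t <= b -> continuous df t) -> is_RInt df a b (f b - f a)).
  { intros f df Hf Hdf. apply (is_RInt_derive (V := R_CompleteNormedModule) f df);
    intros t Ht; rewrite Rmin_left, Rmax_right in Ht by assumption;
    [apply Hf, Ht|apply Hdf, Ht]. }
  split.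
  - exact (X _ _ (fun t Ht => proj1 (H1 t Ht)) (fun t Ht => proj1 (H2 t Ht))).
  - exact (X _ _ (fun t Ht => proj2 (H1 t Ht)) (fun t Ht => proj2 (H2 t Ht))).
Qed.

(** Along a short path the first-order part of [F] at [z0] has the primitive
    [F z0 * z + l * (z - z0)^2 / 2], so only the remainder contributes. *)
Lemma path_integral_estimate (F : C -> C) (g dg : R -> C) (z0 l : C) (a h L e : R) :
  0 < h -> 0 <= L -> 0 <= e ->
  (forall t, a <= t <= a + h -> cder g t (dg t)) ->
  (forall t, a <= t <= a + h -> ccont dg t) ->
  (forall t, a <= t <= a + h -> ccont (fun t => F (g t)) t) ->
  (forall t, a <= t <= a + h -> Cmod (dg t) <= L) ->
  (forall t, a <= t <= a + h -> Cmod (g t - z0) <= 2 * L * h) ->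
  (forall t, a <= t <= a + h ->
    Cmod (F (g t) - F z0 - l * (g t - z0)) <= e * Cmod (g t - z0)) ->
  let G z := (F z0 * z + l * ((z - z0) * (z - z0) / 2))%C in
  Cmod (CInt (fun t => F (g t) * dg t)%C a (a + h) - (G (g (a + h)%R) - G (g a)))
    <= 2 * e * L * L * h * h.
Proof.
  intros Hh HL He Hd Hc HF Hb Hr HE G.
  assert (Hah : a <= a + h) by lra.
  assert (C1 : forall t, a <= t <= a + h -> ccont g t)
    by (intros t Ht; eapply cder_ccont, Hd, Ht).
  assert (Hlin : is_CInt (fun t => (F z0 + l * (g t - z0)) * dg t)%C a (a + h)
     (G (g (a + h)%R) - G (g a))%C).
  { apply (is_CInt_derive (fun t => G (g t))); [exact Hah| |].
    - intros t Ht. unfold G.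
      assert (D1 : cder (fun s => g s - z0)%C t (dg t)).
      { apply (cder_eq _ _ (dg t + 0)%C); [ring|].
        apply (cder_plus g (fun _ => - z0)%C); [apply Hd, Ht|apply cder_const]. }
      eapply cder_eq; [|apply (cder_plus (fun s => F z0 * g s)%C
         (fun s => l * ((g s - z0) * (g s - z0) * / 2))%C);
        [apply (cder_mult (fun _ => F z0)); [apply cder_const|apply Hd, Ht]|
         apply (cder_mult (fun _ => l)); [apply cder_const|
         apply (cder_mult _ (fun _ => / 2)%C); [apply (cder_mult _ _ _ _ _ D1 D1)|apply cder_const]]]].
      field.
    - intros t Ht. apply ccont_mult; [|apply Hc, Ht].
      apply ccont_plus; [apply ccont_const|].
      apply ccont_mult; [apply ccont_const|].
      apply ccont_minus; [apply C1, Ht|apply ccont_const]. }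
  assert (Hint : is_CInt (fun t => F (g t) * dg t)%C a (a + h)
     (CInt (fun t => F (g t) * dg t)%C a (a + h))).
  { apply CInt_correct; [exact Hah|]. intros t Ht. apply ccont_mult; [apply HF, Ht|apply Hc, Ht]. }
  (* Interval length [h], remainder at most [e * (2 * L * h)], speed at most [L]. *)
  replace (2 * e * L * L * h * h) with ((a + h - a) * (e * (2 * L * h) * L)) by ring.
  eapply is_CInt_bound; [exact Hah| |exact (is_CInt_minus _ _ _ _ _ _ Hint Hlin)].
  intros t Ht. simpl.
  replace (F (g t) * dg t - (F z0 + l * (g t - z0)) * dg t)%C
    with ((F (g t) - F z0 - l * (g t - z0)) * dg t)%C by ring.
  rewrite Cmod_mult. apply Rmult_le_compat; [apply Cmod_ge_0|apply Cmod_ge_0| |apply Hb, Ht].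
  eapply Rle_trans; [apply HE, Ht|]. apply Rmult_le_compat_l; [exact He|apply Hr, Ht].
Qed.

Lemma Cmod_triangle4 (a b c d : C) :
  Cmod (a + b - c - d) <= Cmod a + Cmod b + Cmod c + Cmod d.
Proof.
  replace (a + b - c - d)%C with (((a + b) + - c) + - d)%C by ring.
  eapply Rle_trans; [apply Cmod_triangle|]. rewrite Cmod_opp.
  apply Rplus_le_compat_r.
  eapply Rle_trans; [apply Cmod_triangle|]. rewrite Cmod_opp.
  apply Rplus_le_compat_r. apply Cmod_triangle.
Qed.

(** The parameter square is bisected, not the region in the plane. The integral around a subsquare
    of side [h] is the sum over its quarters, so the bound [eps * h * h] is inherited. On a small
    subsquare the first-order part of [F] has a primitive, whose increments cancel around the
    boundary, and the remainder is small compared with h^2. *)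
Lemma goursat_square (F : C -> C) (K K1 K2 : R -> R -> C) (L : R) :
  0 <= L ->
  (forall x y, cder (fun s => K s y) x (K1 x y)) ->
  (forall x y, cder (fun t => K x t) y (K2 x y)) ->
  (forall x y, ccont (fun s => K1 s y) x) ->
  (forall x y, ccont (fun t => K2 x t) y) ->
  (forall x y, 0 <= x <= 1 -> 0 <= y <= 1 -> Cmod (K1 x y) <= L) ->
  (forall x y, 0 <= x <= 1 -> 0 <= y <= 1 -> Cmod (K2 x y) <= L) ->
  (forall x y p q, 0 <= x <= 1 -> 0 <= y <= 1 -> 0 <= p <= 1 -> 0 <= q <= 1 ->
    Cmod (K x y - K p q) <= L * (Rabs (x - p) + Rabs (y - q))) ->
  (forall x y, 0 <= x <= 1 -> 0 <= y <= 1 -> exists l, Cdiff F (K x y) l) ->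
  (CInt (fun s => F (K s 0) * K1 s 0) 0 1 + CInt (fun t => F (K 1 t) * K2 1 t) 0 1
   - CInt (fun s => F (K s 1) * K1 s 1) 0 1 - CInt (fun t => F (K 0 t) * K2 0 t) 0 1)%C
  = RtoC 0.
Proof.
  intros HL D1 D2 C1 C2 B1 B2 Lip HF.
  (* Integrals over a horizontal and a vertical edge of length [h]; [I] is the integral around the
     subsquare. *)
  set (H := fun x y h => CInt (fun s => F (K s y) * K1 s y)%C x (x + h)).
  set (V := fun x y h => CInt (fun t => F (K x t) * K2 x t)%C y (y + h)).
  set (I := fun x y h => (H x y h + V (x + h)%R y h - H x (y + h)%R h - V x y h)%C).
  assert (CF1 : forall x y, 0 <= x <= 1 -> 0 <= y <= 1 -> ccont (fun s => F (K s y)) x).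
  { intros x y Hx Hy. destruct (HF x y Hx Hy) as [l Hl].
    apply (ccont_comp F (fun s => K s y) x l); [eapply cder_ccont, D1|exact Hl]. }
  assert (CF2 : forall x y, 0 <= x <= 1 -> 0 <= y <= 1 -> ccont (fun t => F (K x t)) y).
  { intros x y Hx Hy. destruct (HF x y Hx Hy) as [l Hl].
    apply (ccont_comp F (fun t => K x t) y l); [eapply cder_ccont, D2|exact Hl]. }
  assert (HsplitH : forall x y h, 0 < h -> 0 <= x -> x + h <= 1 -> 0 <= y <= 1 ->
     H x y h = (H x y (h / 2)%R + H (x + h / 2)%R y (h / 2)%R)%C).
  { intros x y h Hh Hx Hxh Hy. unfold H. apply is_CInt_unique.
    apply is_CInt_Chasles with (x + h / 2).
    - apply CInt_correct; [lra|]. intros t Ht. apply ccont_mult; [apply CF1; lra|apply C1].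
    - replace (x + h) with (x + h / 2 + h / 2) by lra.
      apply CInt_correct; [lra|]. intros t Ht. apply ccont_mult; [apply CF1; lra|apply C1]. }
  assert (HsplitV : forall x y h, 0 < h -> 0 <= x <= 1 -> 0 <= y -> y + h <= 1 ->
     V x y h = (V x y (h / 2)%R + V x (y + h / 2)%R (h / 2)%R)%C).
  { intros x y h Hh Hx Hy Hyh. unfold V. apply is_CInt_unique.
    apply is_CInt_Chasles with (y + h / 2).
    - apply CInt_correct; [lra|]. intros t Ht. apply ccont_mult; [apply CF2; lra|apply C2].
    - replace (y + h) with (y + h / 2 + h / 2) by lra.
      apply CInt_correct; [lra|]. intros t Ht. apply ccont_mult; [apply CF2; lra|apply C2]. }
  assert (Main : forall eps, 0 < eps -> Cmod (I 0 0 1) <= eps).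
  { intros eps Heps.
    cut (0 <= 0 -> 0 + 1 <= 1 -> 0 <= 0 -> 0 + 1 <= 1 -> Cmod (I 0 0 1) <= eps * 1 * 1).
    { intros X. rewrite !Rmult_1_r in X. apply X; lra. }
    (* The guards keep the subsquares inside the unit square, where the bound [L] and the
       differentiability of [F] are available. *)
    apply (square_bisection (fun x y h => 0 <= x -> x + h <= 1 -> 0 <= y -> y + h <= 1 ->
      Cmod (I x y h) <= eps * h * h)); [lra| |].
    - intros x y h Hh P1 P2 P3 P4 Hx Hxh Hy Hyh.
      specialize (P1 ltac:(lra) ltac:(lra) ltac:(lra) ltac:(lra)).
      specialize (P2 ltac:(lra) ltac:(lra) ltac:(lra) ltac:(lra)).
      specialize (P3 ltac:(lra) ltac:(lra) ltac:(lra) ltac:(lra)).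
      specialize (P4 ltac:(lra) ltac:(lra) ltac:(lra) ltac:(lra)).
      assert (E : I x y h = (I x y (h / 2)%R + I (x + h / 2)%R y (h / 2)%R +
         (I x (y + h / 2)%R (h / 2)%R + I (x + h / 2)%R (y + h / 2)%R (h / 2)%R))%C).
      { unfold I. rewrite (HsplitH x y h), (HsplitH x (y + h) h),
          (HsplitV x y h), (HsplitV (x + h) y h) by lra.
        replace (x + h / 2 + h / 2) with (x + h) by lra.
        replace (y + h / 2 + h / 2) with (y + h) by lra. ring. }
      rewrite E.
      eapply Rle_trans; [apply Cmod_triangle|].
      assert (T1 := Cmod_triangle (I x y (h / 2)) (I (x + h / 2)%R y (h / 2))).
      assert (T2 := Cmod_triangle (I x (y + h / 2)%R (h / 2)) (I (x + h / 2)%R (y + h / 2)%R (h / 2))).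
      nra.
    - intros p q Hp Hq. rewrite Rplus_0_l in Hp, Hq.
      destruct (HF p q Hp Hq) as [l Hl].
      (* Each of the four edges contributes at most [2 * e * L * L * h * h]; adding 1 keeps the
         divisor positive when [L = 0]. *)
      set (e := eps / (8 * L * L + 1)).
      assert (PL : 0 < 8 * L * L + 1) by nra.
      assert (Pe : 0 < e) by (apply Rdiv_lt_0_compat; lra).
      destruct (Hl e Pe) as [d [Hd Hdw]].
      (* By the Lipschitz bound the image of a square of side [h] lies within [2 * L * h < d] of
         [K p q]. *)
      exists (d / (2 * L + 1)). split; [apply Rdiv_lt_0_compat; lra|].
      intros x y h [Hh Hhd] Hpx Hqy Hx Hxh Hy Hyh.
      assert (HLh : 2 * L * h < d).
      { apply (Rmult_lt_compat_r (2 * L + 1)) in Hhd; [|lra].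
        unfold Rdiv in Hhd. rewrite Rmult_assoc, Rinv_l, Rmult_1_r in Hhd by lra. nra. }
      assert (Near : forall s t, x <= s <= x + h -> y <= t <= y + h ->
         Cmod (K s t - K p q) <= 2 * L * h).
      { intros s t Hs Ht. eapply Rle_trans; [apply Lip; lra|].
        assert (Rabs (s - p) <= h) by (apply Rabs_le; lra).
        assert (Rabs (t - q) <= h) by (apply Rabs_le; lra). nra. }
      set (G := fun z => (F (K p q) * z + l * ((z - K p q) * (z - K p q) / 2))%C).
      assert (EH : forall b, y <= b <= y + h ->
        Cmod (H x b h - (G (K (x + h)%R b) - G (K x b))) <= 2 * e * L * L * h * h).
      { intros b Hb. unfold H.
        apply (path_integral_estimate F (fun s => K s b) (fun s => K1 s b) (K p q) l x h L e);
          try lra; intros t Ht.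
        - apply D1.
        - apply C1.
        - apply CF1; lra.
        - apply B1; lra.
        - apply Near; lra.
        - apply Hdw. eapply Rle_lt_trans; [apply Near; lra|exact HLh]. }
      assert (EV : forall b, x <= b <= x + h ->
        Cmod (V b y h - (G (K b (y + h)%R) - G (K b y))) <= 2 * e * L * L * h * h).
      { intros b Hb. unfold V.
        apply (path_integral_estimate F (fun s => K b s) (fun s => K2 b s) (K p q) l y h L e);
          try lra; intros t Ht.
        - apply D2.
        - apply C2.
        - apply CF2; lra.
        - apply B2; lra.
        - apply Near; lra.
        - apply Hdw. eapply Rle_lt_trans; [apply Near; lra|exact HLh]. }
      assert (X1 := EH y ltac:(lra)). assert (X2 := EH (y + h) ltac:(lra)).
      assert (X3 := EV x ltac:(lra)). assert (X4 := EV (x + h) ltac:(lra)).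
      (* The increments of the primitive [G] along the four edges cancel. *)
      assert (E : I x y h =
        ((H x y h - (G (K (x + h)%R y) - G (K x y)))
         + (V (x + h)%R y h - (G (K (x + h)%R (y + h)%R) - G (K (x + h)%R y)))
         - (H x (y + h)%R h - (G (K (x + h)%R (y + h)%R) - G (K x (y + h)%R)))
         - (V x y h - (G (K x (y + h)%R) - G (K x y))))%C) by (unfold I; ring).
      rewrite E. eapply Rle_trans; [apply Cmod_triangle4|].
      assert (Ee : eps = e * (8 * L * L + 1)) by (unfold e; field; lra).
      rewrite Ee. assert (0 <= e * h * h) by nra. nra. }
  assert (Z : I 0 0 1 = RtoC 0).
  { apply Cmod_eq_0. apply Rle_antisym; [|apply Cmod_ge_0].
    apply Rnot_lt_le. intros Hlt. specialize (Main (Cmod (I 0 0 1) / 2)). lra. }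
  unfold I, H, V in Z. rewrite !Rplus_0_l in Z. exact Z.
Qed.

(** * Cauchy's formula and Taylor expansions *)

Definition cis (t : R) : C := (cos t, sin t).

Lemma Cmod_cis (t : R) : Cmod (cis t) = 1.
Proof.
  unfold Cmod, cis. simpl. rewrite !Rmult_1_r.
  rewrite Rplus_comm. fold (Rsqr (sin t)). fold (Rsqr (cos t)).
  rewrite sin2_cos2. apply sqrt_1.
Qed.

(** The number 2 pi i, by which differentiation along [circ] multiplies. *)
Definition turn : C := (0, 2 * PI).

Lemma Cmod_turn : Cmod turn = 2 * PI.
Proof.
  unfold turn, Cmod. simpl. pose proof PI_RGT_0.
  replace (0 * (0 * 1) + 2 * PI * (2 * PI * 1)) with (Rsqr (2 * PI)) by (unfold Rsqr; ring).
  apply sqrt_Rsqr. lra.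
Qed.

Lemma cder_cis (a t : R) :
  cder (fun s => cis (a * s)) t (RtoC a * (0, 1) * cis (a * t))%C.
Proof.
  split; simpl; auto_derive; trivial; ring.
Qed.

Lemma Cmod_increment (g dg : R -> C) (M a b : R) :
  (forall t, cder g t (dg t)) -> (forall t, ccont dg t) -> (forall t, Cmod (dg t) <= M) ->
  Cmod (g a - g b) <= M * Rabs (a - b).
Proof.
  intros H1 H2 H3.
  assert (X : forall a b, a <= b -> Cmod (g b - g a) <= M * (b - a)).
  { intros x y Hxy. rewrite Rmult_comm.
    apply (is_CInt_bound dg); [exact Hxy|intros t _; apply H3|].
    apply is_CInt_derive; [exact Hxy|intros t _; apply H1|intros t _; apply H2]. }
  destruct (Rle_dec b a) as [L|L].
  - rewrite Rabs_pos_eq by lra. apply X, L.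
  - rewrite Rabs_left1 by lra. replace (g a - g b)%C with (- (g b - g a))%C by ring.
    rewrite Cmod_opp. replace (- (a - b)) with (b - a) by ring. apply X. lra.
Qed.

(** Parametrised over the unit interval, like the sides of the square in [goursat_square]. *)
Definition circ (r y : R) : C := (RtoC r * cis (2 * PI * y))%C.

Lemma Cmod_circ (r y : R) : 0 <= r -> Cmod (circ r y) = r.
Proof.
  intros H. unfold circ. rewrite Cmod_mult, Cmod_cis, Cmod_R, Rabs_pos_eq; lra.
Qed.

Lemma cder_circ (r y : R) : cder (circ r) y (turn * circ r y)%C.
Proof.
  unfold circ. eapply cder_eq; [|apply (cder_mult (fun _ => RtoC r));
    [apply cder_const|apply cder_cis]].
  unfold turn, cis. apply C_eq_Re_Im; simpl; ring.
Qed.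

Lemma ccont_circ (r y : R) : ccont (circ r) y.
Proof. eapply cder_ccont, cder_circ. Qed.

Lemma circ_periodic (r : R) : circ r 1 = circ r 0.
Proof.
  unfold circ, cis. rewrite Rmult_1_r, Rmult_0_r, cos_2PI, sin_2PI, cos_0, sin_0.
  reflexivity.
Qed.

Lemma circ_lipschitz (r a b : R) : 0 <= r ->
  Cmod (circ r a - circ r b) <= 2 * PI * r * Rabs (a - b).
Proof.
  intros Hr. apply (Cmod_increment (circ r) (fun y => turn * circ r y)%C).
  - intros t. apply cder_circ.
  - intros t. apply ccont_mult; [apply ccont_const|apply ccont_circ].
  - intros t. rewrite Cmod_mult, Cmod_turn, Cmod_circ by exact Hr. lra.
Qed.

Definition holo_ball (f : C -> C) (z0 : C) (r : R) : Prop :=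
  forall z : C, Cmod (z - z0) < r -> exists l, Cdiff f z l.

(** Goursat on the homotopy [w + (tau + (1 - tau) s) (zeta - w)] shows that the
    integral of the difference quotient of [f] over the circle [zeta] equals the one over
    its contraction towards [w] by [tau], which is [O(tau)]. *)
Lemma cauchy_quotient (f : C -> C) (rho r : R) (w : C) :
  holo_ball f 0 r -> 0 < rho < r -> Cmod w < rho ->
  CInt (fun t => (f (circ rho t) - f w) * / (circ rho t - w) * (turn * circ rho t))%C 0 1 = 0.
Proof.
  intros Hf [Hrho Hr] Hw.
  pose proof PI_RGT_0 as PIp. pose proof (Cmod_ge_0 w) as Pw.
  assert (Hwr : Cmod (w - 0) < r) by (replace (w - 0)%C with w by ring; lra).
  destruct (Hf w Hwr) as [l Hl].
  (* With tolerance 1, the difference quotient is bounded by [Cmod l + 1] within [d] of [w]. *)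
  destruct (Hl 1 Rlt_0_1) as [d [Hd Hdw]].
  set (F := fun z => ((f z - f w) * / (z - w))%C).
  set (A := CInt (fun t => F (circ rho t) * (turn * circ rho t))%C 0 1).
  change (A = 0).
  assert (Hne : forall t, (circ rho t - w)%C <> 0).
  { intros t E. assert (circ rho t = w) by (replace w with (circ rho t - (circ rho t - w))%C by ring;
      rewrite E; ring).
    pose proof (Cmod_circ rho t ltac:(lra)). rewrite H in H0. lra. }
  assert (Key : forall tau, 0 < tau < 1 -> 2 * rho * tau < d ->
     Cmod A <= (Cmod l + 1) * (tau * (2 * PI * rho))).
  { intros tau Htau Htd.
    (* [c] runs from [tau] to 1, so [K 1] is the circle itself and [K 0] its contraction by [tau]
       towards [w]. *)
    set (c := fun s => RtoC (tau + (1 - tau) * s)).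
    set (K := fun s y => (w + c s * (circ rho y - w))%C).
    set (K1 := fun (s y : R) => (RtoC (1 - tau) * (circ rho y - w))%C).
    set (K2 := fun s y => (c s * (turn * circ rho y))%C).
    assert (Bc : forall s, 0 <= s <= 1 -> 0 < tau + (1 - tau) * s <= 1) by (intros s Hs; nra).
    assert (Bcw : forall y, Cmod (circ rho y - w) <= 2 * rho).
    { intros y. unfold Cminus. eapply Rle_trans; [apply Cmod_triangle|].
      rewrite Cmod_opp, Cmod_circ by lra. lra. }
    assert (G : (CInt (fun s => F (K s 0) * K1 s 0) 0 1 + CInt (fun t => F (K 1 t) * K2 1 t) 0 1
      - CInt (fun s => F (K s 1) * K1 s 1) 0 1 - CInt (fun t => F (K 0 t) * K2 0 t) 0 1)%C = RtoC 0).
    (* The partial derivatives are bounded by [2 * rho] and [2 * PI * rho]; the sum of these also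
       serves as Lipschitz constant. *)
    { apply (goursat_square F K K1 K2 (2 * rho + 2 * PI * rho)).
      - nra.
      - intros x y. unfold K, K1.
        eapply cder_eq; [|apply (cder_plus (fun _ => w)); [apply cder_const|
          apply (cder_mult c (fun _ => circ rho y - w)%C); [|apply cder_const]]].
        2:{ instantiate (1 := RtoC (1 - tau)). split; simpl; auto_derive; trivial; ring. }
        ring.
      - intros x y. unfold K, K2.
        eapply cder_eq; [|apply (cder_plus (fun _ => w)); [apply cder_const|
          apply (cder_mult (fun _ => c x)); [apply cder_const|
          apply (cder_plus (circ rho) (fun _ => - w)%C); [apply cder_circ|apply cder_const]]]].
        ring.
      - intros x y. apply ccont_const.
      - intros x y. unfold K2. apply ccont_mult; [apply ccont_const|].
        apply ccont_mult; [apply ccont_const|apply ccont_circ].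
      - intros x y _ _. unfold K1. rewrite Cmod_mult, Cmod_R, Rabs_pos_eq by lra.
        specialize (Bcw y). pose proof (Cmod_ge_0 (circ rho y - w)). nra.
      - intros x y Hx _. unfold K2, c. rewrite !Cmod_mult, Cmod_R, Cmod_turn, Cmod_circ by lra.
        specialize (Bc x Hx). rewrite Rabs_pos_eq by lra.
        assert (0 < PI * rho) by nra. nra.
      - intros x y p q Hx Hy Hp Hq. unfold K, c.
        replace (w + RtoC (tau + (1 - tau) * x) * (circ rho y - w) -
          (w + RtoC (tau + (1 - tau) * p) * (circ rho q - w)))%C with
          (RtoC (tau + (1 - tau) * x) * (circ rho y - circ rho q) +
           RtoC ((1 - tau) * (x - p)) * (circ rho q - w))%C.
        2:{ rewrite !RtoC_plus, !RtoC_mult, !RtoC_minus. ring. }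
        eapply Rle_trans; [apply Cmod_triangle|].
        rewrite !Cmod_mult, !Cmod_R, Rabs_mult.
        specialize (Bc x Hx). rewrite (Rabs_pos_eq (tau + (1 - tau) * x)) by lra.
        rewrite (Rabs_pos_eq (1 - tau)) by lra.
        pose proof (circ_lipschitz rho y q ltac:(lra)) as Lc.
        pose proof (Rabs_pos (x - p)). pose proof (Rabs_pos (y - q)).
        specialize (Bcw q). pose proof (Cmod_ge_0 (circ rho q - w)).
        pose proof (Cmod_ge_0 (circ rho y - circ rho q)).
        assert ((tau + (1 - tau) * x) * Cmod (circ rho y - circ rho q) <= 2 * PI * rho * Rabs (y - q)) by nra.
        assert ((1 - tau) * Rabs (x - p) * Cmod (circ rho q - w) <= Rabs (x - p) * (2 * rho)).
        { apply Rmult_le_compat; try lra; nra. }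
        assert (0 < PI * rho) by nra. nra.
      - intros x y Hx Hy. specialize (Bc x Hx).
        (* As [c x] is nonzero and the circle avoids [w], so does [K x y]; being a convex
           combination of [w] and a point of the circle, it stays inside the ball. *)
        assert (KN : K x y <> w).
        { intros E. assert (E2 : (c x * (circ rho y - w))%C = 0).
          { replace (c x * (circ rho y - w))%C with (K x y - w)%C by (unfold K; ring).
            rewrite E. ring. }
          apply (f_equal Cmod) in E2. rewrite Cmod_mult, Cmod_0 in E2.
          unfold c in E2. rewrite Cmod_R, Rabs_pos_eq in E2 by lra.
          pose proof (proj1 (Cmod_gt_0 _) (Hne y)). nra. }
        assert (KB : Cmod (K x y - 0) < r).
        { unfold K, c. replace (w + RtoC (tau + (1 - tau) * x) * (circ rho y - w) - 0)%C
            with (RtoC (1 - (tau + (1 - tau) * x)) * w + RtoC (tau + (1 - tau) * x) * circ rho y)%C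
            by (rewrite RtoC_minus; ring).
          eapply Rle_lt_trans; [apply Cmod_triangle|].
          rewrite !Cmod_mult, !Cmod_R, Cmod_circ, !Rabs_pos_eq by lra. nra. }
        destruct (Hf _ KB) as [m Hm]. destruct (Cdiff_inv_sub w (K x y) KN) as [m' Hm'].
        eexists. unfold F.
        apply (Cdiff_mult (fun z => f z - f w)%C (fun z => / (z - w))%C); [|exact Hm'].
        apply Cdiff_sub_const, Hm. }
    (* The circle closes up, so the sides [y = 0] and [y = 1] carry the same integral and cancel. *)
    assert (P : forall s, K s 1 = K s 0) by (intros s; unfold K; rewrite circ_periodic; reflexivity).
    assert (P1 : forall s, K1 s 1 = K1 s 0) by (intros s; unfold K1; rewrite circ_periodic; reflexivity).
    assert (E1 : CInt (fun s => F (K s 1) * K1 s 1)%C 0 1 = CInt (fun s => F (K s 0) * K1 s 0)%C 0 1).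
    { unfold CInt. f_equal; apply RInt_ext; intros s _; rewrite P, P1; reflexivity. }
    assert (E2 : CInt (fun t => F (K 1 t) * K2 1 t)%C 0 1 = A).
    { assert (X : forall t, K 1 t = circ rho t /\ K2 1 t = (turn * circ rho t)%C).
      { intros t. unfold K, K2, c. replace (tau + (1 - tau) * 1) with 1 by ring. split; ring. }
      unfold A, CInt. f_equal; apply RInt_ext; intros t _; destruct (X t) as [-> ->]; reflexivity. }
    assert (EA : A = CInt (fun t => F (K 0 t) * K2 0 t)%C 0 1).
    { rewrite E1, E2 in G.
      set (B := CInt (fun t => F (K 0 t) * K2 0 t)%C 0 1) in *.
      set (D := CInt (fun s => F (K s 0) * K1 s 0)%C 0 1) in *.
      replace A with ((D + A - D - B) + B)%C by ring. rewrite G. ring. }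
    assert (KD : forall t, (K 0 t - w)%C = (RtoC tau * (circ rho t - w))%C).
    { intros t. unfold K, c. rewrite Rmult_0_r, Rplus_0_r. ring. }
    assert (KM : forall t, Cmod (K 0 t - w) = tau * Cmod (circ rho t - w)).
    { intros t. rewrite KD, Cmod_mult, Cmod_R, Rabs_pos_eq by lra. reflexivity. }
    assert (KP : forall t, 0 < Cmod (K 0 t - w)).
    { intros t. rewrite KM. pose proof (proj1 (Cmod_gt_0 _) (Hne t)). nra. }
    assert (KF : forall t, Cmod (F (K 0 t)) <= Cmod l + 1).
    { intros t. unfold F. specialize (KP t).
      rewrite Cmod_mult, Cmod_inv by (apply Cmod_gt_0, KP).
      apply (Rmult_le_reg_r (Cmod (K 0 t - w))); [exact KP|].
      rewrite Rmult_assoc, Rinv_l, Rmult_1_r by lra.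
      assert (X : Cmod (K 0 t - w) < d) by (rewrite KM; specialize (Bcw t); nra).
      specialize (Hdw _ X).
      replace (f (K 0 t) - f w)%C with ((f (K 0 t) - f w - l * (K 0 t - w)) + l * (K 0 t - w))%C by ring.
      eapply Rle_trans; [apply Cmod_triangle|]. rewrite Cmod_mult. lra. }
    rewrite EA.
    replace ((Cmod l + 1) * (tau * (2 * PI * rho))) with
      ((1 - 0) * ((Cmod l + 1) * (tau * (2 * PI * rho)))) by ring.
    apply (is_CInt_bound (fun t => F (K 0 t) * K2 0 t)%C); [lra| |].
    + intros t _. rewrite Cmod_mult.
      apply Rmult_le_compat; [apply Cmod_ge_0|apply Cmod_ge_0|apply KF|].
      unfold K2, c. rewrite !Cmod_mult, Cmod_turn, Cmod_circ, Cmod_R by lra.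
      rewrite Rmult_0_r, Rplus_0_r, Rabs_pos_eq; lra.
    + apply CInt_correct; [lra|]. intros t _. apply ccont_mult.
      * assert (KN : K 0 t <> w).
        { intros E. specialize (KP t). rewrite E in KP.
          replace (w - w)%C with (RtoC 0) in KP by ring. rewrite Cmod_0 in KP. lra. }
        assert (KB : Cmod (K 0 t - 0) < r).
        { unfold K, c. replace (w + RtoC (tau + (1 - tau) * 0) * (circ rho t - w) - 0)%C
            with (RtoC (1 - tau) * w + RtoC tau * circ rho t)%C
            by (rewrite Rmult_0_r, Rplus_0_r, RtoC_minus; ring).
          eapply Rle_lt_trans; [apply Cmod_triangle|].
          rewrite !Cmod_mult, !Cmod_R, Cmod_circ, !Rabs_pos_eq by lra. nra. }
        destruct (Hf _ KB) as [m Hm]. destruct (Cdiff_inv_sub w (K 0 t) KN) as [m' Hm'].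
        eapply (ccont_comp F (K 0)).
        -- unfold K. apply ccont_plus; [apply ccont_const|].
           apply ccont_mult; [apply ccont_const|].
           apply ccont_minus; [apply ccont_circ|apply ccont_const].
        -- unfold F. apply (Cdiff_mult (fun z => f z - f w)%C (fun z => / (z - w))%C); [|exact Hm'].
           apply Cdiff_sub_const, Hm.
      * unfold K2. apply ccont_mult; [apply ccont_const|].
        apply ccont_mult; [apply ccont_const|apply ccont_circ]. }
  apply Cmod_eq_0. apply Rle_antisym; [|apply Cmod_ge_0].
  apply Rnot_lt_le. intros HA.
  pose proof (Cmod_ge_0 l) as Pl.
  set (B := (Cmod l + 1) * (2 * PI * rho)).
  assert (PB : 0 < B) by (unfold B; assert (0 < PI * rho) by nra; nra).
  (* The three bounds keep [tau] below 1, put the contracted circle within [d] of [w], and make the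
     estimate for [A] at most half of [Cmod A]. *)
  set (tau := Rmin (1 / 2) (Rmin (d / (4 * rho)) (Cmod A / (2 * B)))).
  assert (0 < d / (4 * rho)) by (apply Rdiv_lt_0_compat; lra).
  assert (0 < Cmod A / (2 * B)) by (apply Rdiv_lt_0_compat; lra).
  assert (Ht : 0 < tau) by (unfold tau; repeat apply Rmin_pos; lra).
  assert (T1 : tau <= 1 / 2) by apply Rmin_l.
  assert (T2 : tau <= d / (4 * rho)) by (unfold tau; eapply Rle_trans; [apply Rmin_r|apply Rmin_l]).
  assert (T3 : tau <= Cmod A / (2 * B)) by (unfold tau; eapply Rle_trans; [apply Rmin_r|apply Rmin_r]).
  assert (X : 2 * rho * tau < d).
  { apply (Rmult_le_compat_l (2 * rho)) in T2; [|lra].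
    replace (2 * rho * (d / (4 * rho))) with (d / 2) in T2 by (field; lra). lra. }
  specialize (Key tau ltac:(lra) X).
  apply (Rmult_le_compat_l B) in T3; [|lra].
  replace (B * (Cmod A / (2 * B))) with (Cmod A / 2) in T3 by (field; lra).
  unfold B in T3. nra.
Qed.

(** * Taylor expansion from the expansion of the Cauchy kernel *)

Fixpoint tpoly (a : nat -> C) (N : nat) (h : C) : C :=
  match N with
  | O => 0
  | S n => tpoly a n h + a n * h ^ n
  end%C.

(** Cauchy's estimates together with the remainder of a geometric series. Both bounds involve [f]
    only through [M], so they are uniform over a bounded family. *)
Definition taylor_bounds (f : C -> C) (z0 : C) (rho M : R) (a : nat -> C) : Prop :=
  (forall n, Cmod (a n) * rho ^ n <= M) /\
  (forall h N, Cmod h < rho ->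
    Cmod (f (z0 + h)%C - tpoly a N h) <= M * (Cmod h / rho) ^ N * (rho / (rho - Cmod h))).

Definition ucirc (r t : R) : C := (/ circ r t)%C.

Lemma circ_neq0 (r t : R) : 0 < r -> circ r t <> 0.
Proof. intros H. apply Cmod_gt_0. rewrite Cmod_circ; lra. Qed.

Lemma Cmod_ucirc (r t : R) : 0 < r -> Cmod (ucirc r t) = / r.
Proof.
  intros H. unfold ucirc. rewrite Cmod_inv by (apply circ_neq0, H).
  rewrite Cmod_circ; lra.
Qed.

(** The reciprocal of the circle is a circle run backwards, so its derivative comes from
    [cder_cis]. *)
Lemma ucirc_alt (r t : R) : 0 < r -> ucirc r t = (RtoC (/ r) * cis (- (2 * PI) * t))%C.
Proof.
  intros H.
  assert (E : (RtoC (/ r) * cis (- (2 * PI) * t) * circ r t)%C = 1).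
  { unfold circ, cis.
    replace (- (2 * PI) * t) with (- (2 * PI * t)) by ring. rewrite cos_neg, sin_neg.
    pose proof (sin2_cos2 (2 * PI * t)) as Q. unfold Rsqr in Q.
    apply C_eq_Re_Im; simpl; field_simplify; lra. }
  unfold ucirc. replace (/ circ r t)%C with
    (RtoC (/ r) * cis (- (2 * PI) * t) * circ r t * / circ r t)%C by (rewrite E; ring).
  field. apply circ_neq0, H.
Qed.

Lemma cder_ext (f g : R -> C) (x : R) (l : C) : (forall t, f t = g t) -> cder f x l -> cder g x l.
Proof.
  intros E [H1 H2]. split; eapply is_derive_ext; [|exact H1| |exact H2];
    intros t; simpl; rewrite E; reflexivity.
Qed.

Lemma cder_ucirc (r t : R) : 0 < r -> cder (ucirc r) t (- turn * ucirc r t)%C.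
Proof.
  intros H. apply (cder_ext (fun t => RtoC (/ r) * cis (- (2 * PI) * t))%C).
  { intros s. symmetry. apply ucirc_alt, H. }
  rewrite ucirc_alt by exact H.
  eapply cder_eq; [|apply (cder_mult (fun _ => RtoC (/ r))); [apply cder_const|apply cder_cis]].
  unfold turn, cis. apply C_eq_Re_Im; simpl; ring.
Qed.

Lemma ccont_ucirc (r t : R) : 0 < r -> ccont (ucirc r) t.
Proof. intros H. eapply cder_ccont, cder_ucirc, H. Qed.

Lemma cder_ucirc_pow (r t : R) (n : nat) : 0 < r ->
  cder (fun s => ucirc r s ^ n)%C t (- INR n * turn * ucirc r t ^ n)%C.
Proof.
  intros H. induction n as [|n IH].
  - apply (cder_ext (fun _ => RtoC 1)); [reflexivity|].
    eapply cder_eq; [|apply cder_const]. simpl. ring.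
  - apply (cder_ext (fun s => ucirc r s * ucirc r s ^ n)%C).
    { intros s. symmetry. apply Cpow_S. }
    eapply cder_eq; [|apply cder_mult; [apply cder_ucirc, H|exact IH]].
    rewrite Cpow_S, S_INR, RtoC_plus. ring.
Qed.

(** A positive power of [ucirc] is a nonzero constant times its own derivative, and it takes the
    same value at both ends of the interval. *)
Lemma CInt_ucirc_pow (r : R) (n : nat) : 0 < r ->
  is_CInt (fun t => ucirc r t ^ S n)%C 0 1 0.
Proof.
  intros H.
  assert (Nz : (- INR (S n) * turn)%C <> 0).
  { apply Cmod_gt_0. rewrite Cmod_mult, Cmod_opp, Cmod_R, Cmod_turn.
    pose proof PI_RGT_0. pose proof (lt_0_INR (S n) ltac:(lia)).
    rewrite Rabs_pos_eq by lra. nra. }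
  assert (X : is_CInt (fun t => - INR (S n) * turn * ucirc r t ^ S n)%C 0 1
     (ucirc r 1 ^ S n - ucirc r 0 ^ S n)%C).
  { apply (is_CInt_derive (fun t => ucirc r t ^ S n)%C); [lra| |].
    - intros t _. apply cder_ucirc_pow, H.
    - intros t _. apply ccont_mult; [apply ccont_const|apply ccont_pow, ccont_ucirc, H]. }
  apply (is_CInt_scal (/ (- INR (S n) * turn))%C) in X.
  replace (RtoC 0) with (/ (- INR (S n) * turn) * (ucirc r 1 ^ S n - ucirc r 0 ^ S n))%C.
  - eapply is_CInt_ext; [lra| |exact X]. intros t _. cbv beta.
    set (c := (- INR (S n) * turn)%C) in *. set (u := (ucirc r t ^ S n)%C). field. exact Nz.
  - unfold ucirc. rewrite circ_periodic. unfold Cminus. rewrite Cplus_opp_r. ring.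
Qed.

(** Integrated form of [z / (z - w) = sum_(n < N) (w / z)^n + (w / z)^N z / (z - w)]. *)
Lemma cauchy_kernel_expansion (g : R -> C) (rho M : R) (w : C) :
  0 < rho -> Cmod w < rho ->
  (forall t, 0 <= t <= 1 -> ccont g t) ->
  (forall t, 0 <= t <= 1 -> Cmod (g t) <= M) ->
  forall N, Cmod (CInt (fun t => g t * (circ rho t * / (circ rho t - w)))%C 0 1
    - tpoly (fun n => CInt (fun t => g t * ucirc rho t ^ n)%C 0 1) N w)
  <= M * (Cmod w / rho) ^ N * (rho / (rho - Cmod w)).
Proof.
  intros Hrho Hw Hg HM N.
  assert (Hlow : forall t, rho - Cmod w <= Cmod (circ rho t - w)).
  { intros t. pose proof (Cmod_triangle (circ rho t - w) w) as T.
    replace (circ rho t - w + w)%C with (circ rho t) in T by ring.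
    rewrite Cmod_circ in T; lra. }
  assert (Hne : forall t, (circ rho t - w)%C <> 0).
  { intros t. apply Cmod_gt_0. specialize (Hlow t). lra. }
  assert (Ck : forall t, ccont (fun s => circ rho s * / (circ rho s - w))%C t).
  { intros t. apply ccont_mult; [apply ccont_circ|].
    destruct (Cdiff_inv_sub w (circ rho t)) as [l Hl].
    { intros E. apply (Hne t). rewrite E. ring. }
    apply (ccont_comp (fun z => / (z - w))%C (circ rho) t l); [apply ccont_circ|exact Hl]. }
  assert (Cr : forall n t, 0 <= t <= 1 ->
    ccont (fun s => g s * ((w * ucirc rho s) ^ n * (circ rho s * / (circ rho s - w))))%C t).
  { intros n t Ht. apply ccont_mult; [apply Hg, Ht|]. apply ccont_mult; [|apply Ck].
    apply ccont_pow. apply ccont_mult; [apply ccont_const|apply ccont_ucirc, Hrho]. }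
  assert (Main : forall N, is_CInt (fun t => g t * (circ rho t * / (circ rho t - w)))%C 0 1
     (tpoly (fun n => CInt (fun t => g t * ucirc rho t ^ n)%C 0 1) N w
      + CInt (fun t => g t * ((w * ucirc rho t) ^ N * (circ rho t * / (circ rho t - w))))%C 0 1)%C).
  { clear N. induction N as [|N IH].
    - simpl tpoly. rewrite Cplus_0_l.
      eapply is_CInt_ext; [lra| |apply CInt_correct; [lra|apply (Cr 0%nat)]].
      intros t _. simpl. ring.
    - eapply is_CInt_ext; [lra|intros t _; reflexivity|].
      (* One more geometric term is split off the remainder by z / (z - w) = 1 + (w / z) z / (z -
         w). *)
      assert (E : CInt (fun t => g t * ((w * ucirc rho t) ^ N * (circ rho t * / (circ rho t - w))))%C 0 1
        = (w ^ N * CInt (fun t => g t * ucirc rho t ^ N)%C 0 1 +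
           CInt (fun t => g t * ((w * ucirc rho t) ^ S N * (circ rho t * / (circ rho t - w))))%C 0 1)%C).
      { apply is_CInt_unique.
        eapply is_CInt_ext; [lra| |apply is_CInt_plus;
          [apply is_CInt_scal, CInt_correct|apply CInt_correct; [lra|apply (Cr (S N))]]].
        - intros t _. cbv beta. rewrite Cpow_S, Cpow_mult_l.
          set (P := (ucirc rho t ^ N)%C). set (W := (w ^ N)%C). unfold ucirc.
          field. split; [apply Hne|apply circ_neq0, Hrho].
        - lra.
        - intros t Ht. apply ccont_mult; [apply Hg, Ht|apply ccont_pow, ccont_ucirc, Hrho]. }
      simpl tpoly. rewrite E in IH.
      match goal with |- is_CInt _ _ _ ?l => match type of IH with is_CInt _ _ _ ?m =>
        replace l with m; [exact IH|] end end.
      cbv beta. rewrite (Cmult_comm (w ^ N)). rewrite Cplus_assoc. reflexivity. }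
  rewrite (is_CInt_unique _ _ _ _ (Main N)).
  set (T := tpoly _ N w). match goal with |- Cmod (_ + ?J - _) <= _ => set (J0 := J) end.
  replace (T + J0 - T)%C with J0 by ring.
  replace (M * (Cmod w / rho) ^ N * (rho / (rho - Cmod w))) with
    ((1 - 0) * (M * ((Cmod w / rho) ^ N * (rho / (rho - Cmod w))))) by ring.
  eapply is_CInt_bound; [lra| |apply CInt_correct; [lra|apply (Cr N)]].
  intros t Ht. cbv beta. rewrite Cmod_mult.
  apply Rmult_le_compat; [apply Cmod_ge_0|apply Cmod_ge_0|apply HM, Ht|].
  rewrite Cmod_mult, Cmod_pow, Cmod_mult, Cmod_ucirc by exact Hrho.
  rewrite Cmod_mult, Cmod_circ, Cmod_inv by (lra || apply Hne).
  apply Rmult_le_compat_l.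
  - apply pow_le. apply Rmult_le_pos; [apply Cmod_ge_0|]. left. apply Rinv_0_lt_compat, Hrho.
  - apply Rmult_le_compat_l; [lra|]. apply Rinv_le_contravar; [lra|apply Hlow].
Qed.

Lemma geometric_small (q c eps : R) : 0 <= q < 1 -> 0 < eps ->
  exists N, forall n, (N <= n)%nat -> c * q ^ n < eps.
Proof.
  intros Hq He.
  assert (Hc : 0 < Rabs c + 1) by (pose proof (Rabs_pos c); lra).
  destruct (pow_lt_1_zero q ltac:(rewrite Rabs_pos_eq; lra) (eps / (Rabs c + 1))
    ltac:(apply Rdiv_lt_0_compat; assumption)) as [N HN].
  exists N. intros n Hn. specialize (HN n Hn).
  assert (P : 0 <= q ^ n) by (apply pow_le; lra).
  rewrite Rabs_pos_eq in HN by exact P.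
  apply (Rmult_lt_compat_l (Rabs c + 1)) in HN; [|exact Hc].
  replace ((Rabs c + 1) * (eps / (Rabs c + 1))) with eps in HN by (field; lra).
  pose proof (Rle_abs c). nra.
Qed.

(** The coefficients are the means of f(z) z^(-n) over the circle. They result from expanding the
    kernel z / (z - w), once [f w] is known to be the mean of f(z) z / (z - w); this follows from
    [cauchy_quotient] and the fact that the kernel itself has mean 1. *)
Lemma taylor_exists_0 (f : C -> C) (rho r M : R) :
  holo_ball f 0 r -> 0 < rho < r ->
  (forall z, Cmod z = rho -> Cmod (f z) <= M) ->
  exists a, taylor_bounds f 0 rho M a.
Proof.
  intros Hf Hrho HM.
  assert (Cf : forall t, ccont (fun s => f (circ rho s)) t).
  { intros t. destruct (Hf (circ rho t)) as [l Hl].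
    - replace (circ rho t - 0)%C with (circ rho t) by ring. rewrite Cmod_circ; lra.
    - eapply ccont_comp; [apply ccont_circ|exact Hl]. }
  assert (Mf : forall t, Cmod (f (circ rho t)) <= M).
  { intros t. apply HM. apply Cmod_circ. lra. }
  exists (fun n => CInt (fun t => f (circ rho t) * ucirc rho t ^ n)%C 0 1). split.
  - intros n.
    assert (P : 0 < rho ^ n) by (apply pow_lt; lra).
    apply Rle_trans with ((1 - 0) * (M * (/ rho) ^ n) * rho ^ n).
    + apply Rmult_le_compat_r; [lra|].
      eapply is_CInt_bound; [lra| |apply CInt_correct; [lra|]].
      * intros t _. cbv beta. rewrite Cmod_mult, Cmod_pow, Cmod_ucirc by lra.
        apply Rmult_le_compat_r; [|apply Mf]. apply pow_le. left. apply Rinv_0_lt_compat. lra.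
      * intros t _. apply ccont_mult; [apply Cf|apply ccont_pow, ccont_ucirc; lra].
    + right. rewrite pow_inv. field. lra.
  - intros w N Hw. rewrite Cplus_0_l.
    pose proof (Cmod_ge_0 w) as Pw.
    assert (Hlow : forall t, rho - Cmod w <= Cmod (circ rho t - w)).
    { intros t. pose proof (Cmod_triangle (circ rho t - w) w) as T.
      replace (circ rho t - w + w)%C with (circ rho t) in T by ring.
      rewrite Cmod_circ in T; lra. }
    assert (Hne : forall t, (circ rho t - w)%C <> 0).
    { intros t. apply Cmod_gt_0. specialize (Hlow t). lra. }
    assert (Ck : forall t, ccont (fun s => circ rho s * / (circ rho s - w))%C t).
    { intros t. apply ccont_mult; [apply ccont_circ|].
      destruct (Cdiff_inv_sub w (circ rho t)) as [l Hl].
      { intros E. apply (Hne t). rewrite E. ring. }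
      apply (ccont_comp (fun z => / (z - w))%C (circ rho) t l); [apply ccont_circ|exact Hl]. }
    set (I1 := CInt (fun t => 1 * (circ rho t * / (circ rho t - w)))%C 0 1).
    (* The kernel expansion of the constant function 1: every nonempty partial sum is 1, as only the
       zeroth coefficient survives, and the remainder tends to 0. *)
    assert (E1 : I1 = 1).
    { assert (X : forall n, tpoly (fun n => CInt (fun t => 1 * ucirc rho t ^ n)%C 0 1) (S n) w = 1).
      { induction n as [|n IH].
        - simpl. rewrite (is_CInt_unique _ _ _ (1 - 0)%C); [ring|].
          apply (is_CInt_derive RtoC); [lra| |intros t _;
            apply (ccont_ext (fun _ => RtoC 1)); [intros; ring|apply ccont_const]].
          intros t _. split; simpl; auto_derive; trivial; ring.
        - change (tpoly ?b (S (S n)) w) with (tpoly b (S n) w + b (S n) * w ^ S n)%C.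
          rewrite IH, (is_CInt_unique _ _ _ 0); [ring|].
          eapply is_CInt_ext; [lra| |apply (CInt_ucirc_pow rho n); lra].
          intros t _. cbv beta. symmetry. apply Cmult_1_l. }
      assert (Y : forall n, Cmod (I1 - 1) <= rho / (rho - Cmod w) * (Cmod w / rho) ^ S n).
      { intros n. rewrite <- (X n).
        eapply Rle_trans; [apply (cauchy_kernel_expansion (fun _ => RtoC 1) rho 1 w); try lra|right; ring].
        - intros t _. apply ccont_const.
        - intros t _. rewrite Cmod_1. lra. }
      assert (Z : Cmod (I1 - 1) = 0).
      { apply Rle_antisym; [|apply Cmod_ge_0]. apply Rnot_lt_le. intros HA.
        destruct (geometric_small (Cmod w / rho) (rho / (rho - Cmod w)) (Cmod (I1 - 1))) as [n Hn].
        - split; [apply Rmult_le_pos; [lra|left; apply Rinv_0_lt_compat; lra]|].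
          apply (Rmult_lt_reg_r rho); [lra|]. unfold Rdiv. rewrite Rmult_assoc, Rinv_l; lra.
        - exact HA.
        - specialize (Hn (S n) ltac:(lia)). specialize (Y n). lra. }
      apply Cmod_eq_0 in Z. replace I1 with ((I1 - 1) + 1)%C by ring. rewrite Z. ring. }
    (* Write f(z) = (f(z) - f(w)) + f(w): the first part contributes 0 by [cauchy_quotient], the
       second [f w * I1]. *)
    assert (E2 : CInt (fun t => f (circ rho t) * (circ rho t * / (circ rho t - w)))%C 0 1 = f w).
    { apply is_CInt_unique.
      assert (Q := cauchy_quotient f rho r w Hf Hrho Hw).
      assert (Q1 : is_CInt (fun t => (f (circ rho t) - f w) * / (circ rho t - w) * (turn * circ rho t))%C 0 1 0).
      { rewrite <- Q. apply CInt_correct; [lra|]. intros t _.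
        apply (ccont_ext (fun t => (f (circ rho t) - f w) * turn * (circ rho t * / (circ rho t - w)))%C).
        - intros s. ring.
        - apply ccont_mult; [|apply Ck]. apply ccont_mult; [|apply ccont_const].
          apply ccont_minus; [apply Cf|apply ccont_const]. }
      assert (Nt : turn <> 0).
      { apply Cmod_gt_0. rewrite Cmod_turn. pose proof PI_RGT_0. lra. }
      apply (is_CInt_scal (/ turn)%C) in Q1.
      assert (Q2 : is_CInt (fun t => 1 * (circ rho t * / (circ rho t - w)))%C 0 1 I1).
      { apply CInt_correct; [lra|]. intros t _. apply ccont_mult; [apply ccont_const|apply Ck]. }
      rewrite E1 in Q2.
      apply (is_CInt_scal (f w)) in Q2.
      pose proof (is_CInt_plus _ _ _ _ _ _ Q1 Q2) as Q3.
      replace (f w) with (/ turn * 0 + f w * 1)%C by ring.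
      eapply is_CInt_ext; [lra| |exact Q3].
      intros t _. cbv beta. set (v := f (circ rho t)). set (u := f w). field. split; [apply Hne|exact Nt]. }
    rewrite <- E2.
    apply (cauchy_kernel_expansion (fun t => f (circ rho t))); [lra|lra| |].
    + intros t _. apply Cf.
    + intros t _. apply Mf.
Qed.

Lemma taylor_exists (f : C -> C) (z0 : C) (rho r M : R) :
  holo_ball f z0 r -> 0 < rho < r ->
  (forall z, Cmod (z - z0) = rho -> Cmod (f z) <= M) ->
  exists a, taylor_bounds f z0 rho M a.
Proof.
  intros Hf Hrho HM.
  destruct (taylor_exists_0 (fun h => f (z0 + h)%C) rho r M) as [a [Ha1 Ha2]].
  - intros h Hh. destruct (Hf (z0 + h)%C) as [l Hl].
    { replace (z0 + h - z0)%C with (h - 0)%C by ring. exact Hh. }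
    exists l. intros eps Heps. destruct (Hl eps Heps) as [d [Hd Hw]].
    exists d. split; [exact Hd|]. intros w Hwd. specialize (Hw (z0 + w)%C).
    replace (z0 + w - (z0 + h))%C with (w - h)%C in Hw by ring. apply Hw, Hwd.
  - exact Hrho.
  - intros z Hz. apply HM. replace (z0 + z - z0)%C with z by ring. exact Hz.
  - exists a. split; [exact Ha1|]. intros h N Hh. specialize (Ha2 h N Hh).
    rewrite Cplus_0_l in Ha2. exact Ha2.
Qed.

(** * Orders of zeros *)

(** No radius is fixed, so that coefficients obtained on circles of different radii can be
    compared. *)
Definition expands (f : C -> C) (z0 : C) (a : nat -> C) : Prop :=
  forall N, exists K d, 0 < d /\
    forall h, Cmod h < d -> Cmod (f (z0 + h)%C - tpoly a N h) <= K * Cmod h ^ N.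

(** For holomorphic [f] this is [zero_mult_ge f z0 N], in a form that passes to limits. *)
Definition order_ge (f : C -> C) (z0 : C) (N : nat) : Prop :=
  exists K d, 0 < d /\ forall h, Cmod h < d -> Cmod (f (z0 + h)%C) <= K * Cmod h ^ N.

Lemma tpoly_zero (a : nat -> C) (N : nat) (h : C) :
  (forall n, (n < N)%nat -> a n = 0) -> tpoly a N h = 0.
Proof.
  induction N as [|N IH]; intros H; [reflexivity|]. simpl.
  rewrite IH, (H N) by (intros; try apply H; lia). ring.
Qed.

Lemma tpoly_minus (a b : nat -> C) (N : nat) (h : C) :
  tpoly (fun n => a n - b n)%C N h = (tpoly a N h - tpoly b N h)%C.
Proof. induction N as [|N IH]; simpl; [|rewrite IH]; ring. Qed.

(** Without its top term the sum satisfies the bound of one order less, since that term is bounded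
    by its own power of [h]; so the lower coefficients vanish by induction. The top coefficient is
    then at most [K * t] for small real [t]. *)
Lemma tpoly_small (c : nat -> C) (N : nat) (K d : R) : 0 < d ->
  (forall h, Cmod h < d -> Cmod (tpoly c N h) <= K * Cmod h ^ N) ->
  forall n, (n < N)%nat -> c n = 0.
Proof.
  revert K d. induction N as [|N IH]; intros K d Hd H n Hn; [lia|].
  assert (IH' : forall j, (j < N)%nat -> c j = 0).
  { apply (IH (Rabs K + Cmod (c N)) (Rmin d 1)); [apply Rmin_pos; lra|].
    intros h Hh. pose proof (Rmin_l d 1). pose proof (Rmin_r d 1).
    specialize (H h ltac:(lra)). simpl in H.
    replace (tpoly c N h) with ((tpoly c N h + c N * h ^ N) + - (c N * h ^ N))%C by ring.
    eapply Rle_trans; [apply Cmod_triangle|]. rewrite Cmod_opp, Cmod_mult, Cmod_pow.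
    pose proof (Cmod_ge_0 h) as Ph. pose proof (pow_le _ N Ph) as Pn.
    rewrite Rmult_plus_distr_r. apply Rplus_le_compat_r.
    eapply Rle_trans; [exact H|].
    pose proof (Rle_abs K). pose proof (Rabs_pos K).
    rewrite <- Rmult_assoc. apply Rmult_le_compat_r; [exact Pn|]. nra. }
  destruct (Nat.eq_dec n N) as [->|Hne]; [|apply IH'; lia].
  apply Cmod_eq_0. apply Rle_antisym; [|apply Cmod_ge_0]. apply Rnot_lt_le. intros HA.
  set (A := Cmod (c N)) in *.
  (* At [t] the bound reads [A <= K * t], while the second entry forces [K * t <= A / 2]. *)
  set (t := Rmin (d / 2) (A / (2 * (Rabs K + 1)))).
  pose proof (Rabs_pos K) as PK. pose proof (Rle_abs K) as LK.
  assert (Ht : 0 < t).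
  { apply Rmin_pos; [lra|]. apply Rdiv_lt_0_compat; lra. }
  assert (T1 : t <= d / 2) by apply Rmin_l.
  assert (T2 : t <= A / (2 * (Rabs K + 1))) by apply Rmin_r.
  specialize (H (RtoC t)). rewrite Cmod_R, Rabs_pos_eq in H by lra.
  specialize (H ltac:(lra)). simpl in H. rewrite tpoly_zero in H by exact IH'.
  rewrite Cplus_0_l, Cmod_mult, Cmod_pow, Cmod_R, Rabs_pos_eq in H by lra. fold A in H.
  pose proof (pow_lt t N Ht) as Pt.
  apply (Rmult_le_compat_l (2 * (Rabs K + 1))) in T2; [|lra].
  replace (2 * (Rabs K + 1) * (A / (2 * (Rabs K + 1)))) with A in T2 by (field; lra).
  assert (A <= K * t) by nra. nra.
Qed.

Lemma order_ge_coef (f : C -> C) (z0 : C) (a : nat -> C) (N : nat) : expands f z0 a ->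
  (order_ge f z0 N <-> forall n, (n < N)%nat -> a n = 0).
Proof.
  intros Ha. destruct (Ha N) as [K [d [Hd H]]]. split.
  - intros [K' [d' [Hd' H']]].
    apply (tpoly_small a N (K + K') (Rmin d d')); [apply Rmin_pos; assumption|].
    intros h Hh. pose proof (Rmin_l d d'). pose proof (Rmin_r d d').
    specialize (H h ltac:(lra)). specialize (H' h ltac:(lra)).
    replace (tpoly a N h) with (- (f (z0 + h) - tpoly a N h) + f (z0 + h))%C by ring.
    eapply Rle_trans; [apply Cmod_triangle|]. rewrite Cmod_opp. lra.
  - intros Hz. exists K, d. split; [exact Hd|]. intros h Hh. specialize (H h Hh).
    rewrite tpoly_zero in H by exact Hz.
    replace (f (z0 + h)%C - 0)%C with (f (z0 + h)%C) in H by ring. exact H.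
Qed.

Lemma expands_unique (f : C -> C) (z0 : C) (a b : nat -> C) :
  expands f z0 a -> expands f z0 b -> forall n, a n = b n.
Proof.
  intros Ha Hb n.
  destruct (Ha (S n)) as [K [d [Hd H]]]. destruct (Hb (S n)) as [K' [d' [Hd' H']]].
  assert (X : (a n - b n)%C = 0).
  { apply (tpoly_small (fun n => a n - b n)%C (S n) (K + K') (Rmin d d'));
      [apply Rmin_pos; assumption| |lia].
    intros h Hh. pose proof (Rmin_l d d'). pose proof (Rmin_r d d').
    specialize (H h ltac:(lra)). specialize (H' h ltac:(lra)).
    rewrite tpoly_minus.
    replace (tpoly a (S n) h - tpoly b (S n) h)%C with
      (- (f (z0 + h) - tpoly a (S n) h) + (f (z0 + h) - tpoly b (S n) h))%C by ring.
    eapply Rle_trans; [apply Cmod_triangle|]. rewrite Cmod_opp. lra. }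
  replace (a n) with ((a n - b n) + b n)%C by ring. rewrite X. ring.
Qed.

(** The factor 2 bounds [rho / (rho - Cmod h)] for [Cmod h < rho / 2]. *)
Lemma taylor_bounds_half (f : C -> C) (z0 : C) (rho M : R) (a : nat -> C) : 0 < rho ->
  taylor_bounds f z0 rho M a -> forall h N, Cmod h < rho / 2 ->
  Cmod (f (z0 + h)%C - tpoly a N h) <= 2 * M * (/ rho) ^ N * Cmod h ^ N.
Proof.
  intros Hrho [H1 H2] h N Hh.
  pose proof (H1 0%nat) as HM. simpl in HM. rewrite Rmult_1_r in HM.
  pose proof (Cmod_ge_0 (a 0%nat)). pose proof (Cmod_ge_0 h).
  eapply Rle_trans; [apply H2; lra|].
  unfold Rdiv at 1. rewrite Rpow_mult_distr.
  assert (P : 0 <= M * (Cmod h ^ N * (/ rho) ^ N)).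
  { apply Rmult_le_pos; [lra|]. apply Rmult_le_pos; apply pow_le; [lra|].
    left. apply Rinv_0_lt_compat, Hrho. }
  replace (2 * M * (/ rho) ^ N * Cmod h ^ N) with (M * (Cmod h ^ N * (/ rho) ^ N) * 2) by ring.
  apply Rmult_le_compat_l; [exact P|].
  apply (Rmult_le_reg_r (rho - Cmod h)); [lra|]. unfold Rdiv.
  rewrite Rmult_assoc, Rinv_l, Rmult_1_r by lra. lra.
Qed.

Lemma taylor_bounds_expands (f : C -> C) (z0 : C) (rho M : R) (a : nat -> C) : 0 < rho ->
  taylor_bounds f z0 rho M a -> expands f z0 a.
Proof.
  intros Hrho H N. exists (2 * M * (/ rho) ^ N), (rho / 2). split; [lra|].
  intros h Hh. apply taylor_bounds_half; assumption.
Qed.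

(** Bisection of the circumscribed square: differentiability bounds [f] near a point of the open
    ball, and small squares near any other point miss the closed disc. *)
Lemma holo_ball_bounded (f : C -> C) (z0 : C) (rho r : R) :
  holo_ball f z0 r -> 0 < rho < r ->
  exists M, forall z, Cmod (z - z0) <= rho -> Cmod (f z) <= M.
Proof.
  intros Hf Hrho.
  assert (X : exists M, forall z, Cmod (z - z0) <= rho ->
    Re z0 - rho <= Re z <= Re z0 - rho + 2 * rho -> Im z0 - rho <= Im z <= Im z0 - rho + 2 * rho ->
    Cmod (f z) <= M).
  { apply (square_bisection (fun x y h => exists M, forall z, Cmod (z - z0) <= rho ->
      x <= Re z <= x + h -> y <= Im z <= y + h -> Cmod (f z) <= M)); [lra| |].
    - intros x y h Hh [M1 H1] [M2 H2] [M3 H3] [M4 H4].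
      exists (Rmax (Rmax M1 M2) (Rmax M3 M4)). intros z Hz Hx Hy.
      pose proof (Rmax_l M1 M2). pose proof (Rmax_r M1 M2).
      pose proof (Rmax_l M3 M4). pose proof (Rmax_r M3 M4).
      pose proof (Rmax_l (Rmax M1 M2) (Rmax M3 M4)). pose proof (Rmax_r (Rmax M1 M2) (Rmax M3 M4)).
      destruct (Rle_dec (Re z) (x + h / 2)); destruct (Rle_dec (Im z) (y + h / 2)).
      + specialize (H1 z Hz ltac:(lra) ltac:(lra)). lra.
      + specialize (H3 z Hz ltac:(lra) ltac:(lra)). lra.
      + specialize (H2 z Hz ltac:(lra) ltac:(lra)). lra.
      + specialize (H4 z Hz ltac:(lra) ltac:(lra)). lra.
    - intros p q _ _.
      assert (Near : forall x y h z, 0 < h -> x <= p <= x + h -> y <= q <= y + h ->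
        x <= Re z <= x + h -> y <= Im z <= y + h -> Cmod (z - (p, q)) <= 2 * h).
      { intros x y h z Hh Hp Hq Hx Hy.
        replace (z - (p, q))%C with (RtoC (Re z - p) + Ci * RtoC (Im z - q))%C
          by (destruct z; apply C_eq_Re_Im; simpl; ring).
        eapply Rle_trans; [apply Cmod_triangle|]. rewrite Cmod_mult, !Cmod_R, Cmod_Ci.
        assert (Rabs (Re z - p) <= h) by (apply Rabs_le; lra).
        assert (Rabs (Im z - q) <= h) by (apply Rabs_le; lra). lra. }
      destruct (Rlt_dec (Cmod ((p, q) - z0)) r) as [Hin|Hout].
      + destruct (Hf (p, q) Hin) as [l Hl].
        destruct (Cdiff_cont f (p, q) l Hl 1 Rlt_0_1) as [d [Hd Hw]].
        exists (d / 2). split; [lra|]. intros x y h Hh Hp Hq.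
        exists (Cmod (f (p, q)) + 1). intros z _ Hx Hy.
        specialize (Hw z). specialize (Near x y h z ltac:(lra) Hp Hq Hx Hy).
        specialize (Hw ltac:(lra)).
        revert Hw. generalize (f (p, q)) (f z). intros u v Hw.
        replace v with (u + (v - u))%C by ring.
        eapply Rle_trans; [apply Cmod_triangle|]. lra.
      (* The point is at distance at least [r] from [z0], so a square of side below [(r - rho) / 2]
         containing it has no point in the closed disc. *)
      + exists ((r - rho) / 2). split; [lra|]. intros x y h Hh Hp Hq.
        exists 0. intros z Hz Hx Hy. exfalso.
        specialize (Near x y h z ltac:(lra) Hp Hq Hx Hy).
        apply Hout.
        replace ((p, q) - z0)%C with (- (z - (p, q)) + (z - z0))%C by ring.
        eapply Rle_lt_trans; [apply Cmod_triangle|]. rewrite Cmod_opp. lra. }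
  destruct X as [M HM]. exists M. intros z Hz. apply HM; [exact Hz| |].
  - pose proof (Rmax_Cmod (z - z0)%C) as T. simpl in T.
    pose proof (Rmax_l (Rabs (fst z + - fst z0)) (Rabs (snd z + - snd z0))).
    assert (T3 : Rabs (fst z + - fst z0) <= rho) by lra.
    apply Rabs_le_between in T3. unfold Re in *. lra.
  - pose proof (Rmax_Cmod (z - z0)%C) as T. simpl in T.
    pose proof (Rmax_r (Rabs (fst z + - fst z0)) (Rabs (snd z + - snd z0))).
    assert (T3 : Rabs (snd z + - snd z0) <= rho) by lra.
    apply Rabs_le_between in T3. unfold Im in *. lra.
Qed.

(** Uniqueness of expansions makes the coefficients independent of the radius; [montel] needs the
    bounds for radii arbitrarily close to 1 with one and the same sequence of coefficients. *)
Lemma holo_ball_taylor (f : C -> C) (z0 : C) (r : R) : 0 < r -> holo_ball f z0 r ->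
  exists a, forall rho M, 0 < rho < r ->
    (forall z, Cmod (z - z0) = rho -> Cmod (f z) <= M) -> taylor_bounds f z0 rho M a.
Proof.
  intros Hr Hf.
  destruct (holo_ball_bounded f z0 (r / 2) r Hf ltac:(lra)) as [M0 HM0].
  destruct (taylor_exists f z0 (r / 2) r M0 Hf ltac:(lra)) as [a Ha].
  { intros z Hz. apply HM0. lra. }
  exists a. intros rho M Hrho HM.
  destruct (taylor_exists f z0 rho r M Hf Hrho HM) as [b [Hb1 Hb2]].
  assert (E : forall n, b n = a n).
  { apply (expands_unique f z0).
    - apply (taylor_bounds_expands f z0 rho M); [lra|split; assumption].
    - apply (taylor_bounds_expands f z0 (r / 2) M0); [lra|assumption]. }
  assert (ET : forall N h, tpoly a N h = tpoly b N h).
  { intros N h. induction N as [|N IH]; simpl; [reflexivity|]. rewrite IH, E. reflexivity. }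
  split.
  - intros n. rewrite <- E. apply Hb1.
  - intros h N Hh. rewrite ET. apply Hb2, Hh.
Qed.

Lemma holo_ball_expands (f : C -> C) (z0 : C) (r : R) : 0 < r -> holo_ball f z0 r ->
  exists a, expands f z0 a.
Proof.
  intros Hr Hf. destruct (holo_ball_taylor f z0 r Hr Hf) as [a Ha]. exists a.
  destruct (holo_ball_bounded f z0 (r / 2) r Hf ltac:(lra)) as [M HM].
  apply (taylor_bounds_expands f z0 (r / 2) M); [lra|]. apply Ha; [lra|].
  intros z Hz. apply HM. lra.
Qed.

Lemma holo_ball_subset (f : C -> C) (z0 z1 : C) (r r' : R) :
  Cmod (z1 - z0) + r' <= r -> holo_ball f z0 r -> holo_ball f z1 r'.
Proof.
  intros H Hf z Hz. apply Hf. replace (z - z0)%C with ((z - z1) + (z1 - z0))%C by ring.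
  eapply Rle_lt_trans; [apply Cmod_triangle|]. lra.
Qed.

(** An estimate of Schwarz type: the first [N] Taylor coefficients are zero and only the remainder
    is left. *)
Lemma order_ge_bound (f : C -> C) (z0 : C) (rho r M : R) (N : nat) :
  holo_ball f z0 r -> 0 < rho < r ->
  (forall z, Cmod (z - z0) = rho -> Cmod (f z) <= M) ->
  order_ge f z0 N -> forall h, Cmod h < rho ->
  Cmod (f (z0 + h)%C) <= M * (Cmod h / rho) ^ N * (rho / (rho - Cmod h)).
Proof.
  intros Hf Hrho HM Ho h Hh.
  destruct (taylor_exists f z0 rho r M Hf Hrho HM) as [a Ha].
  assert (E := taylor_bounds_expands f z0 rho M a ltac:(lra) Ha).
  destruct Ha as [_ Ha]. specialize (Ha h N Hh).
  rewrite tpoly_zero in Ha by (apply (order_ge_coef f z0 a N E), Ho).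
  replace (f (z0 + h)%C - 0)%C with (f (z0 + h)%C) in Ha by ring. exact Ha.
Qed.

(** [order_ge_bound] on a radius strictly between [Cmod h] and [r], with [N] tending to infinity. *)
Lemma infinite_order_ball (f : C -> C) (z0 : C) (r : R) : holo_ball f z0 r ->
  (forall N, order_ge f z0 N) -> forall h, Cmod h < r -> f (z0 + h)%C = 0.
Proof.
  intros Hf Ho h Hh. pose proof (Cmod_ge_0 h).
  set (rho := (Cmod h + r) / 2).
  assert (Hrho : Cmod h < rho < r) by (unfold rho; lra).
  destruct (holo_ball_bounded f z0 rho r Hf ltac:(lra)) as [M HM].
  apply Cmod_eq_0. apply Rle_antisym; [|apply Cmod_ge_0]. apply Rnot_lt_le. intros HA.
  destruct (geometric_small (Cmod h / rho) (M * (rho / (rho - Cmod h))) _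
    ltac:(split; [apply Rmult_le_pos; [lra|left; apply Rinv_0_lt_compat; lra]|
      apply (Rmult_lt_reg_r rho); [lra|]; unfold Rdiv; rewrite Rmult_assoc, Rinv_l; lra]) HA) as [N HN].
  specialize (HN N (le_n N)).
  assert (B := order_ge_bound f z0 rho r M N Hf ltac:(lra)
    (fun z Hz => HM z (Req_le _ _ Hz)) (Ho N) h ltac:(lra)). lra.
Qed.

Lemma order_ge_locally_zero (f : C -> C) (z0 : C) (d : R) : 0 < d ->
  (forall h, Cmod h < d -> f (z0 + h)%C = 0) -> forall N, order_ge f z0 N.
Proof.
  intros Hd H N. exists 0, d. split; [exact Hd|]. intros h Hh. rewrite (H h Hh), Cmod_0. lra.
Qed.

(** A zero of infinite order is propagated to the origin in finitely many steps of
    length [(1 - |z|) / 2] along the radius. *)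
Lemma infinite_order_zero (f : C -> C) (z : C) : holo_ball f 0 1 -> Cmod z < 1 ->
  (forall N, order_ge f z N) -> forall w, Cmod w < 1 -> f w = 0.
Proof.
  intros Hf Hz Ho.
  assert (Hsub : forall y, Cmod y < 1 -> holo_ball f y (1 - Cmod y)).
  { intros y Hy. apply (holo_ball_subset f 0 y 1); [|exact Hf].
    replace (y - 0)%C with y by ring. lra. }
  cut (forall N, order_ge f 0 N).
  { intros H0 w Hw. replace w with (0 + w)%C by ring.
    apply (infinite_order_ball f 0 1 Hf H0 w Hw). }
  set (s := (1 - Cmod z) / 2).
  assert (Hs : 0 < s) by (unfold s; lra).
  (* As [Cmod y <= Cmod z], [f] vanishes on a ball of radius at least [2 * s] about [y]; a centre
     moved by [s] still has a neighbourhood on which [f] is 0. *)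
  assert (Main : forall n y, Cmod y <= Cmod z -> Cmod y <= INR n * s ->
    (forall N, order_ge f y N) -> forall N, order_ge f 0 N).
  { induction n as [|n IH]; intros y Hy Hn Hoy.
    - simpl in Hn. assert (E : y = 0).
      { apply Cmod_eq_0. pose proof (Cmod_ge_0 y). lra. }
      rewrite <- E. exact Hoy.
    - rewrite S_INR in Hn. pose proof (Cmod_ge_0 y) as Py.
      assert (Hnear : forall h, Cmod h < 1 - Cmod y -> f (y + h)%C = 0).
      { apply infinite_order_ball; [apply Hsub; lra|exact Hoy]. }
      destruct (Rle_dec (Cmod y) s) as [Hle|Hgt].
      + apply (order_ge_locally_zero f 0 (1 - Cmod y - s)); [unfold s in *; lra|].
        intros h Hh. replace (0 + h)%C with (y + (h - y))%C by ring. apply Hnear.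
        unfold Cminus. eapply Rle_lt_trans; [apply Cmod_triangle|]. rewrite Cmod_opp. lra.
      (* Scaling by [c] moves [y] towards the origin by exactly [s]. *)
      + set (c := 1 - s / Cmod y).
        assert (Hsy : 0 < s / Cmod y < 1).
        { split; [apply Rdiv_lt_0_compat; lra|]. apply (Rmult_lt_reg_r (Cmod y)); [lra|].
          unfold Rdiv. rewrite Rmult_assoc, Rinv_l; lra. }
        assert (Ecy : Cmod (RtoC c * y) = Cmod y - s).
        { rewrite Cmod_mult, Cmod_R, Rabs_pos_eq by (unfold c; lra). unfold c. field. lra. }
        assert (Ed : Cmod (RtoC c * y - y) = s).
        { replace (RtoC c * y - y)%C with (RtoC (- (s / Cmod y)) * y)%C
            by (unfold c; rewrite RtoC_minus, RtoC_opp; ring).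
          rewrite Cmod_mult, Cmod_R, Rabs_Ropp, Rabs_pos_eq by lra. field. lra. }
        apply (IH (RtoC c * y)%C); [lra|lra|].
        apply (order_ge_locally_zero f _ (1 - Cmod y - s)); [unfold s in *; lra|].
        intros h Hh. replace (RtoC c * y + h)%C with (y + (h + (RtoC c * y - y)))%C by ring.
        apply Hnear. eapply Rle_lt_trans; [apply Cmod_triangle|]. lra. }
  destruct (INR_archimed s (Cmod z) Hs) as [n Hn].
  apply (Main n z); [lra|lra|exact Ho].
Qed.

(** The first nonzero Taylor term [a k * h ^ k] dominates the remainder of order [S k] near [z]. *)
Lemma isolated_zero (f : C -> C) (z : C) (r : R) (N : nat) : 0 < r -> holo_ball f z r ->
  ~ order_ge f z N ->
  exists d, 0 < d /\ forall h, 0 < Cmod h < d -> f (z + h)%C <> 0.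
Proof.
  intros Hr Hf HN.
  destruct (holo_ball_expands f z r Hr Hf) as [a Ha].
  assert (X : exists k, a k <> 0 /\ forall j, (j < k)%nat -> a j = 0).
  { assert (Y : exists k, a k <> 0).
    { apply NNPP. intros H. apply HN. apply (order_ge_coef f z a N Ha).
      intros n _. apply NNPP. intros H'. apply H. exists n. exact H'. }
    destruct Y as [k Hk]. revert Hk.
    induction k as [k IH] using (well_founded_induction Wf_nat.lt_wf). intros Hk.
    destruct (classic (exists j, (j < k)%nat /\ a j <> 0)) as [[j [Hj1 Hj2]]|H].
    - apply (IH j Hj1 Hj2).
    - exists k. split; [exact Hk|]. intros j Hj. apply NNPP. intros H'. apply H.
      exists j. split; assumption. }
  destruct X as [k [Hk1 Hk2]].
  destruct (Ha (S k)) as [K [d [Hd H]]].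
  pose proof (proj1 (Cmod_gt_0 _) Hk1) as Pk. pose proof (Rabs_pos K). pose proof (Rle_abs K).
  exists (Rmin d (Cmod (a k) / (Rabs K + 1))). split.
  { apply Rmin_pos; [exact Hd|apply Rdiv_lt_0_compat; lra]. }
  intros h [Hh0 Hh] E.
  assert (T1 : Cmod h < d) by (eapply Rlt_le_trans; [exact Hh|apply Rmin_l]).
  assert (T2 : Cmod h < Cmod (a k) / (Rabs K + 1)) by (eapply Rlt_le_trans; [exact Hh|apply Rmin_r]).
  specialize (H h T1). simpl in H. rewrite tpoly_zero in H by exact Hk2. rewrite E in H.
  replace (0 - (0 + a k * h ^ k))%C with (- (a k * h ^ k))%C in H by ring.
  rewrite Cmod_opp, Cmod_mult, Cmod_pow in H.
  pose proof (pow_lt (Cmod h) k Hh0).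
  apply (Rmult_lt_compat_r (Rabs K + 1)) in T2; [|lra].
  unfold Rdiv in T2. rewrite Rmult_assoc, Rinv_l, Rmult_1_r in T2 by lra.
  assert (Cmod (a k) <= K * Cmod h) by nra. nra.
Qed.

Lemma Cdiff_inv_pow_sub (z0 z : C) (k : nat) : z <> z0 ->
  exists l, Cdiff (fun w => (/ (w - z0)) ^ k)%C z l.
Proof.
  intros Hz. destruct (Cdiff_inv_sub z0 z Hz) as [m Hm].
  induction k as [|k [l IH]].
  - exists 0. apply (Cdiff_ext_loc (fun _ => 1) _ z 0 1); [lra|reflexivity|apply Cdiff_const].
  - eexists. apply (Cdiff_ext_loc (fun w => (/ (w - z0)) * (/ (w - z0)) ^ k)%C _ z _ 1); [lra| |].
    + intros w _. symmetry. apply Cpow_S.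
    + apply (Cdiff_mult (fun w => / (w - z0))%C); [exact Hm|exact IH].
Qed.

(** The cofactor is f(w) / (w - z0)^k, completed by the coefficient [a k] at [z0]; the Taylor
    expansion itself shows that it is differentiable there. *)
Lemma zero_factor_exists (f : C -> C) (z0 : C) (r : R) (k : nat) : 0 < r -> holo_ball f z0 r ->
  order_ge f z0 k ->
  exists g, zero_factor f z0 k g /\ (~ order_ge f z0 (S k) -> g z0 <> 0).
Proof.
  intros Hr Hf Ho.
  destruct (holo_ball_expands f z0 r Hr Hf) as [a Ha].
  assert (Hz : forall n, (n < k)%nat -> a n = 0) by (apply (order_ge_coef f z0 a k Ha), Ho).
  set (g := fun w => if excluded_middle_informative (w = z0) then a k
                     else (f w * (/ (w - z0)) ^ k)%C).
  assert (G1 : g z0 = a k).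
  { unfold g. destruct (excluded_middle_informative (z0 = z0)); congruence. }
  assert (G2 : forall w, w <> z0 -> g w = (f w * (/ (w - z0)) ^ k)%C).
  { intros w Hw. unfold g. destruct (excluded_middle_informative (w = z0)); congruence. }
  assert (Sub : forall w, w <> z0 -> (w - z0)%C <> 0).
  { intros w Hw E. apply Hw. replace w with ((w - z0) + z0)%C by ring. rewrite E. ring. }
  exists g. split.
  - apply locally_C_Cmod. exists r. split; [exact Hr|]. intros w Hw. split.
    + apply ex_derive_Cdiff. destruct (classic (w = z0)) as [->|Hne].
      * exists (a (S k)). intros eps Heps.
        (* After division by h^k the remainder of order [k + 2] is O(|h|^2), which makes the next
           coefficient the derivative. *)
        destruct (Ha (S (S k))) as [K [d [Hd H]]].
        pose proof (Rabs_pos K). pose proof (Rle_abs K).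
        exists (Rmin d (eps / (Rabs K + 1))). split.
        { apply Rmin_pos; [exact Hd|apply Rdiv_lt_0_compat; lra]. }
        intros w Hwd.
        assert (T1 : Cmod (w - z0) < d) by (eapply Rlt_le_trans; [exact Hwd|apply Rmin_l]).
        assert (T2 : Cmod (w - z0) < eps / (Rabs K + 1)) by (eapply Rlt_le_trans; [exact Hwd|apply Rmin_r]).
        destruct (classic (w = z0)) as [->|Hne].
        { replace (g z0 - g z0 - a (S k) * (z0 - z0))%C with (RtoC 0) by ring.
          rewrite Cmod_0. apply Rmult_le_pos; [lra|apply Cmod_ge_0]. }
        specialize (H (w - z0)%C T1). replace (z0 + (w - z0))%C with w in H by ring.
        simpl tpoly in H. rewrite (tpoly_zero a k) in H by exact Hz.
        pose proof (Sub w Hne) as Nw.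
        pose proof (proj1 (Cmod_gt_0 _) Nw) as Pw.
        rewrite (G2 w Hne), G1.
        set (h := (w - z0)%C) in *.
        replace (f w * (/ h) ^ k - a k - a (S k) * h)%C with
          ((f w - (0 + a k * h ^ k + a (S k) * (h * h ^ k))) * (/ h) ^ k)%C.
        2:{ assert (Q : (h ^ k * (/ h) ^ k)%C = 1).
            { rewrite <- Cpow_mult_l. rewrite Cinv_r by exact Nw. apply Cpow_1_l. }
            transitivity (f w * (/ h) ^ k - a k * (h ^ k * (/ h) ^ k) - a (S k) * h * (h ^ k * (/ h) ^ k))%C;
            [ring|rewrite Q; ring]. }
        rewrite Cmod_mult, Cmod_pow, Cmod_inv by exact Nw.
        change (Cpow h (S k)) with (h * h ^ k)%C in H.
        pose proof (pow_lt (/ Cmod h) k (Rinv_0_lt_compat _ Pw)) as Pk.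
        apply Rle_trans with (K * Cmod h ^ S (S k) * (/ Cmod h) ^ k).
        { apply Rmult_le_compat_r; [lra|exact H]. }
        replace (K * Cmod h ^ S (S k) * (/ Cmod h) ^ k) with (K * Cmod h * Cmod h).
        2:{ simpl. rewrite pow_inv. field. pose proof (pow_lt (Cmod h) k Pw). lra. }
        apply Rmult_le_compat_r; [lra|].
        apply (Rmult_lt_compat_r (Rabs K + 1)) in T2; [|lra].
        unfold Rdiv in T2. rewrite Rmult_assoc, Rinv_l, Rmult_1_r in T2 by lra. nra.
      * destruct (Hf w Hw) as [l Hl]. destruct (Cdiff_inv_pow_sub z0 w k Hne) as [m Hm].
        eexists. apply (Cdiff_ext_loc (fun w => f w * (/ (w - z0)) ^ k)%C _ w _ (Cmod (w - z0))).
        -- apply Cmod_gt_0, Sub, Hne.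
        -- intros v Hv. symmetry. apply G2. intros ->.
           rewrite <- (Cmod_opp (z0 - w)) in Hv.
           replace (- (z0 - w))%C with (w - z0)%C in Hv by ring. lra.
        -- apply Cdiff_mult; [exact Hl|exact Hm].
    + destruct (classic (w = z0)) as [->|Hne].
      * rewrite G1.
        (* At [h = 0] the expansion gives f(z0) = a_k 0^k, which covers [k = 0] and [k > 0] at
           once. *)
        destruct (Ha (S k)) as [K [d [Hd H]]]. specialize (H 0).
        rewrite Cmod_0 in H. specialize (H Hd).
        replace (K * 0 ^ S k) with 0 in H by (simpl; ring).
        simpl in H. rewrite tpoly_zero in H by exact Hz.
        rewrite Cplus_0_r in H.
        assert (E : (f z0 - (0 + a k * 0 ^ k))%C = 0).
        { apply Cmod_eq_0. apply Rle_antisym; [exact H|apply Cmod_ge_0]. }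
        replace (z0 - z0)%C with (RtoC 0) by ring.
        replace (f z0) with ((f z0 - (0 + a k * 0 ^ k)) + a k * 0 ^ k)%C by ring.
        rewrite E. ring.
      * rewrite (G2 w Hne). pose proof (Sub w Hne) as Nw.
        transitivity (f w * ((w - z0) ^ k * (/ (w - z0)) ^ k))%C; [|ring].
        rewrite <- Cpow_mult_l, Cinv_r by exact Nw. rewrite Cpow_1_l. ring.
  - intros Hn. rewrite G1. intros E. apply Hn. apply (order_ge_coef f z0 a (S k) Ha).
    intros n Hn'. destruct (Nat.eq_dec n k) as [->|]; [exact E|apply Hz; lia].
Qed.

Lemma zero_mult_ge_order (f : C -> C) (z0 : C) (r : R) (k : nat) : 0 < r -> holo_ball f z0 r ->
  (zero_mult_ge f z0 k <-> order_ge f z0 k).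
Proof.
  intros Hr Hf. split.
  - intros [g Hg]. apply locally_C_Cmod in Hg. destruct Hg as [d [Hd H]].
    destruct (H z0) as [G _].
    { replace (z0 - z0)%C with (RtoC 0) by ring. rewrite Cmod_0. exact Hd. }
    apply ex_derive_Cdiff in G. destruct G as [l Hl].
    destruct (Cdiff_cont g z0 l Hl 1 Rlt_0_1) as [d' [Hd' H']].
    exists (Cmod (g z0) + 1), (Rmin d d'). split; [apply Rmin_pos; assumption|].
    intros h Hh.
    assert (T1 : Cmod h < d) by (eapply Rlt_le_trans; [exact Hh|apply Rmin_l]).
    assert (T2 : Cmod h < d') by (eapply Rlt_le_trans; [exact Hh|apply Rmin_r]).
    assert (E : (z0 + h - z0)%C = h) by ring.
    specialize (H (z0 + h)%C). specialize (H' (z0 + h)%C). rewrite E in H, H'.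
    destruct (H T1) as [_ ->]. specialize (H' T2). rewrite Cmod_mult, Cmod_pow, Rmult_comm.
    apply Rmult_le_compat_r; [apply pow_le, Cmod_ge_0|].
    replace (g (z0 + h)%C) with (g z0 + (g (z0 + h) - g z0))%C by ring.
    eapply Rle_trans; [apply Cmod_triangle|]. lra.
  - intros Ho. destruct (zero_factor_exists f z0 r k Hr Hf Ho) as [g [Hg _]]. exists g. exact Hg.
Qed.

Lemma zero_mult_eq_order (f : C -> C) (z0 : C) (r : R) (k : nat) : 0 < r -> holo_ball f z0 r ->
  order_ge f z0 k -> ~ order_ge f z0 (S k) -> zero_mult_eq f z0 k.
Proof.
  intros Hr Hf Ho Hn. destruct (zero_factor_exists f z0 r k Hr Hf Ho) as [g [Hg Hg0]].
  exists g. split; [exact Hg|apply Hg0, Hn].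
Qed.

(** By continuity the cofactor is nonzero near [z0]; at [z0 + t] with small real [t > 0] the power
    is nonzero as well. *)
Lemma zero_mult_eq_nonzero (f : C -> C) (z0 : C) (r : R) (k : nat) : 0 < r ->
  zero_mult_eq f z0 k -> exists w, Cmod (w - z0) < r /\ f w <> 0.
Proof.
  intros Hr [g [Hg Hg0]]. apply locally_C_Cmod in Hg. destruct Hg as [d [Hd H]].
  destruct (H z0) as [G _].
  { replace (z0 - z0)%C with (RtoC 0) by ring. rewrite Cmod_0. exact Hd. }
  apply ex_derive_Cdiff in G. destruct G as [l Hl].
  destruct (Cdiff_cont g z0 l Hl (Cmod (g z0)) (proj1 (Cmod_gt_0 _) Hg0)) as [d' [Hd' H']].
  set (t := Rmin r (Rmin d d') / 2).
  assert (P : 0 < Rmin r (Rmin d d')) by (repeat apply Rmin_pos; assumption).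
  pose proof (Rmin_l r (Rmin d d')). pose proof (Rmin_r r (Rmin d d')).
  pose proof (Rmin_l d d'). pose proof (Rmin_r d d').
  exists (z0 + RtoC t)%C.
  assert (E : (z0 + RtoC t - z0)%C = RtoC t) by ring.
  assert (Et : Cmod (RtoC t) = t) by (rewrite Cmod_R; apply Rabs_pos_eq; unfold t; lra).
  specialize (H (z0 + RtoC t)%C). specialize (H' (z0 + RtoC t)%C).
  rewrite E, Et in *. split; [unfold t; lra|].
  destruct H as [_ ->]; [unfold t; lra|]. specialize (H' ltac:(unfold t; lra)).
  intros Z. apply (f_equal Cmod) in Z. rewrite Cmod_mult, Cmod_pow, Et, Cmod_0 in Z.
  apply Rmult_integral in Z. destruct Z as [Z|Z].
  - pose proof (pow_lt t k ltac:(unfold t; lra)). lra.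
  - apply Cmod_eq_0 in Z. rewrite Z in H'. replace (0 - g z0)%C with (- g z0)%C in H' by ring.
    rewrite Cmod_opp in H'. lra.
Qed.

(** * Limits of complex sequences and of orders of zeros *)

Definition Cconv (u : nat -> C) (l : C) : Prop :=
  forall eps, 0 < eps -> exists N, forall n, (N <= n)%nat -> Cmod (u n - l) < eps.

Lemma Cconv_Cmod_le (u : nat -> C) (l : C) (M : R) (N : nat) :
  Cconv u l -> (forall n, (N <= n)%nat -> Cmod (u n) <= M) -> Cmod l <= M.
Proof.
  intros H HM. apply Rnot_lt_le. intros Hlt.
  destruct (H (Cmod l - M) ltac:(lra)) as [N' HN'].
  specialize (HN' (N + N')%nat ltac:(lia)). specialize (HM (N + N')%nat ltac:(lia)).
  pose proof (Cmod_triangle (- (u (N + N')%nat - l)) (u (N + N')%nat)) as T.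
  rewrite Cmod_opp in T.
  replace (- (u (N + N')%nat - l) + u (N + N')%nat)%C with l in T by ring. lra.
Qed.

Lemma Cconv_minus (u v : nat -> C) (l m : C) :
  Cconv u l -> Cconv v m -> Cconv (fun n => u n - v n)%C (l - m)%C.
Proof.
  intros Hu Hv eps Heps.
  destruct (Hu (eps / 2) ltac:(lra)) as [N1 H1]. destruct (Hv (eps / 2) ltac:(lra)) as [N2 H2].
  exists (N1 + N2)%nat. intros n Hn. specialize (H1 n ltac:(lia)). specialize (H2 n ltac:(lia)).
  replace (u n - v n - (l - m))%C with ((u n - l) + - (v n - m))%C by ring.
  eapply Rle_lt_trans; [apply Cmod_triangle|]. rewrite Cmod_opp. lra.
Qed.

Lemma Cconv_mult_const (u : nat -> C) (l c : C) : Cconv u l -> Cconv (fun n => u n * c)%C (l * c)%C.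
Proof.
  intros Hu eps Heps. pose proof (Cmod_ge_0 c).
  destruct (Hu (eps / (Cmod c + 1)) ltac:(apply Rdiv_lt_0_compat; lra)) as [N HN].
  exists N. intros n Hn. specialize (HN n Hn).
  replace (u n * c - l * c)%C with ((u n - l) * c)%C by ring. rewrite Cmod_mult.
  apply (Rmult_lt_compat_r (Cmod c + 1)) in HN; [|lra].
  replace (eps / (Cmod c + 1) * (Cmod c + 1)) with eps in HN by (field; lra).
  pose proof (Cmod_ge_0 (u n - l)). nra.
Qed.

Lemma Cconv_subseq (u : nat -> C) (l : C) (phi : nat -> nat) :
  (forall n, (n <= phi n)%nat) -> Cconv u l -> Cconv (fun n => u (phi n)) l.
Proof.
  intros Hphi H eps Heps. destruct (H eps Heps) as [N HN]. exists N. intros n Hn.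
  apply HN. specialize (Hphi n). lia.
Qed.

Lemma Ccauchy_conv (u : nat -> C) :
  (forall eps, 0 < eps -> exists N, forall n m, (N <= n)%nat -> (N <= m)%nat -> Cmod (u n - u m) < eps) ->
  exists l, Cconv u l.
Proof.
  intros H.
  assert (X : forall p : C -> R, (forall z w, Rabs (p z - p w) <= Cmod (z - w)) ->
    exists l : R, forall eps, 0 < eps -> exists N, forall n, (N <= n)%nat -> Rabs (p (u n) - l) < eps).
  { intros p Hp.
    assert (Hc : Cauchy_crit (fun n => p (u n))).
    { intros eps Heps. destruct (H eps Heps) as [N HN]. exists N. intros n m Hn Hm.
      eapply Rle_lt_trans; [apply Hp|]. apply HN; assumption. }
    destruct (Rcomplete.R_complete _ Hc) as [l Hl]. exists l. intros eps Heps. apply (Hl eps Heps). }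
  destruct (X Re) as [a Ha].
  { intros z w. pose proof (re_le_Cmod (z - w)). exact H0. }
  destruct (X Im) as [b Hb].
  { intros z w. pose proof (Rmax_Cmod (z - w)%C) as T.
    eapply Rle_trans; [|exact T]. apply Rmax_r. }
  exists (a, b). intros eps Heps.
  destruct (Ha (eps / 2) ltac:(lra)) as [N1 H1]. destruct (Hb (eps / 2) ltac:(lra)) as [N2 H2].
  exists (N1 + N2)%nat. intros n Hn. specialize (H1 n ltac:(lia)). specialize (H2 n ltac:(lia)).
  replace (u n - (a, b))%C with (RtoC (Re (u n) - a) + Ci * RtoC (Im (u n) - b))%C
    by (destruct (u n); apply C_eq_Re_Im; simpl; ring).
  eapply Rle_lt_trans; [apply Cmod_triangle|]. rewrite Cmod_mult, !Cmod_R, Cmod_Ci. lra.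
Qed.

(** The constant [2 * M * (/ rho) ^ N] and the radius [rho / 2] are common to all members of the
    sequence, so the bound survives a pointwise limit. *)
Lemma order_ge_limit (fs : nat -> C -> C) (f : C -> C) (z0 : C) (rho r M : R) (N n0 : nat) :
  0 < rho < r ->
  (forall n, holo_ball (fs n) z0 r) ->
  (forall n z, Cmod (z - z0) = rho -> Cmod (fs n z) <= M) ->
  (forall z, Cmod (z - z0) < r -> Cconv (fun n => fs n z) (f z)) ->
  (forall n, (n0 <= n)%nat -> order_ge (fs n) z0 N) -> order_ge f z0 N.
Proof.
  intros Hrho Hf HM Hc Ho.
  assert (PM : 0 <= M).
  { eapply Rle_trans; [apply Cmod_ge_0|]. apply (HM 0%nat (z0 + RtoC rho)%C).
    replace (z0 + RtoC rho - z0)%C with (RtoC rho) by ring. rewrite Cmod_R, Rabs_pos_eq; lra. }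
  exists (2 * M * (/ rho) ^ N), (rho / 2). split; [lra|]. intros h Hh.
  apply (Cconv_Cmod_le (fun n => fs n (z0 + h)%C) _ _ n0).
  - apply Hc. replace (z0 + h - z0)%C with h by ring. lra.
  - intros n Hn. cbv beta.
    destruct (taylor_exists (fs n) z0 rho r M (Hf n) Hrho (HM n)) as [a Ha].
    pose proof (taylor_bounds_half (fs n) z0 rho M a ltac:(lra) Ha h N Hh) as B.
    rewrite tpoly_zero in B.
    2:{ apply (order_ge_coef (fs n) z0); [|apply Ho, Hn].
        apply (taylor_bounds_expands _ _ rho M); [lra|exact Ha]. }
    replace (fs n (z0 + h)%C - 0)%C with (fs n (z0 + h)%C) in B by ring. exact B.
Qed.

(** * Normal families *)

Lemma archimed_inv (eps : R) : 0 < eps -> exists n : nat, / (INR n + 1) < eps.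
Proof.
  intros H. destruct (INR_archimed eps 1 H) as [n Hn]. exists n.
  pose proof (pos_INR n). apply (Rmult_lt_reg_r (INR n + 1)); [lra|].
  rewrite Rinv_l by lra. nra.
Qed.

Lemma inv_INR_pos (n : nat) : 0 < / (INR n + 1).
Proof. apply Rinv_0_lt_compat. pose proof (pos_INR n). lra. Qed.

Lemma inv_INR_le (n m : nat) : (n <= m)%nat -> / (INR m + 1) <= / (INR n + 1).
Proof.
  intros H. apply le_INR in H. pose proof (pos_INR n). apply Rinv_le_contravar; lra.
Qed.

(** The limits of the columns are chosen one after the other, keeping infinitely many rows
    close to the finite prefix of limits chosen so far. *)
Lemma diagonal_extraction (u : nat -> nat -> R) (K : nat -> R) :
  (forall m n, Rabs (u m n) <= K n) ->
  exists (c : nat -> R) (phi : nat -> nat), (forall k, (phi k < phi (S k))%nat) /\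
    forall n eps, 0 < eps -> exists N, forall k, (N <= k)%nat -> Rabs (u (phi k) n - c n) < eps.
Proof.
  intros HK.
  (* A finite list of limits is [good] if infinitely many rows are close to it in all its columns at
     once. *)
  set (good := fun l : list R => forall eps N, 0 < eps -> exists m, (N <= m)%nat /\
    forall j, (j < length l)%nat -> Rabs (u m j - nth j l 0) < eps).
  assert (Hext : forall l, exists x, good l -> good (l ++ x :: nil)).
  { intros l. destruct (classic (good l)) as [Hl|]; [|exists 0; tauto].
    (* Rows ever closer to [l]; a cluster point of their entries in the next column is the new
       limit. *)
    destruct (choice (fun i m => (i <= m)%nat /\
      forall j, (j < length l)%nat -> Rabs (u m j - nth j l 0) < / (INR i + 1))) as [psi Hpsi].
    { intros i. apply Hl, inv_INR_pos. }
    set (v := fun i => u (psi i) (length l)).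
    destruct (Bolzano_Weierstrass v (fun x => - K (length l) <= x <= K (length l))) as [x Hx].
    - apply compact_P3.
    - intros i. apply Rabs_le_between. apply HK.
    - exists x. intros _ eps N Heps.
      destruct (archimed_inv eps Heps) as [i0 Hi0].
      destruct (Hx (fun y => Rabs (y - x) < eps) (N + i0)%nat) as [p [Hp1 Hp2]].
      { exists (mkposreal eps Heps). intros y Hy. exact Hy. }
      exists (psi p). destruct (Hpsi p) as [Q1 Q2]. split; [lia|].
      intros j Hj. rewrite length_app in Hj. simpl in Hj.
      destruct (Nat.eq_dec j (length l)) as [->|Hne].
      + rewrite nth_middle. exact Hp2.
      + rewrite app_nth1 by lia. eapply Rlt_trans; [apply Q2; lia|].
        eapply Rle_lt_trans; [apply inv_INR_le with (n := i0); lia|exact Hi0]. }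
  destruct (choice _ Hext) as [ext He].
  set (L := fix L (n : nat) : list R := match n with O => nil | S m => L m ++ ext (L m) :: nil end).
  assert (HL : forall n, good (L n) /\ length (L n) = n).
  { induction n as [|n [I1 I2]].
    - split; [|reflexivity]. intros eps N _. exists N. split; [lia|]. simpl. intros j Hj. lia.
    - simpl. split; [apply He, I1|]. rewrite length_app, I2. simpl. lia. }
  set (c := fun n => nth n (L (S n)) 0).
  assert (Hc : forall n k, (n < k)%nat -> nth n (L k) 0 = c n).
  { intros n k Hk. induction k as [|k IH]; [lia|].
    destruct (Nat.eq_dec n k) as [->|Hne]; [reflexivity|].
    simpl. rewrite app_nth1 by (destruct (HL k); lia). apply IH. lia. }
  (* The state is the last row chosen and the step number [k]; the new row lies beyond it and is
     within [1 / (k + 1)] of the first [k] limits. *)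
  assert (Hstep : forall pk : nat * nat, exists m, (fst pk < m)%nat /\
    forall j, (j < snd pk)%nat -> Rabs (u m j - c j) < / (INR (snd pk) + 1)).
  { intros [p k]. destruct (HL k) as [G Hk].
    destruct (G (/ (INR k + 1)) (S p) (inv_INR_pos k)) as [m [Hm1 Hm2]].
    exists m. split; [simpl; lia|]. intros j Hj. simpl in Hj |- *.
    rewrite <- (Hc j k Hj). apply Hm2. lia. }
  destruct (choice _ Hstep) as [st Hst].
  set (phi := fix phi (k : nat) : nat := match k with O => O | S k' => st (phi k', S k') end).
  exists c, phi. split.
  - intros k. simpl. apply (Hst (phi k, S k)).
  - intros n eps Heps. destruct (archimed_inv eps Heps) as [i Hi].
    exists (S (n + i)). intros [|k] Hk; [lia|].
    simpl. destruct (Hst (phi k, S k)) as [_ Q]. cbn [fst snd] in Q.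
    eapply Rlt_trans; [apply Q; lia|].
    eapply Rle_lt_trans; [apply inv_INR_le with (n := i); lia|exact Hi].
Qed.

(** Real and imaginary parts of column [n] are stored as the real columns [2 * n] and
    [2 * n + 1]. *)
Lemma Cdiagonal_extraction (u : nat -> nat -> C) (K : nat -> R) :
  (forall m n, Cmod (u m n) <= K n) ->
  exists (c : nat -> C) (phi : nat -> nat), (forall k, (phi k < phi (S k))%nat) /\
    forall n, Cconv (fun k => u (phi k) n) (c n).
Proof.
  intros HK.
  destruct (diagonal_extraction
    (fun m n => if Nat.even n then Re (u m (Nat.div2 n)) else Im (u m (Nat.div2 n)))
    (fun n => K (Nat.div2 n))) as [c [phi [Hphi Hc]]].
  { intros m n. pose proof (HK m (Nat.div2 n)) as HKn.
    pose proof (re_le_Cmod (u m (Nat.div2 n))). pose proof (Rmax_Cmod (u m (Nat.div2 n))) as T.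
    pose proof (Rmax_r (Rabs (fst (u m (Nat.div2 n)))) (Rabs (snd (u m (Nat.div2 n))))).
    destruct (Nat.even n); [lra|]. unfold Im. lra. }
  exists (fun n => (c (2 * n)%nat, c (S (2 * n)))), phi. split; [exact Hphi|].
  intros n eps Heps.
  destruct (Hc (2 * n)%nat (eps / 2) ltac:(lra)) as [N1 H1].
  destruct (Hc (S (2 * n)) (eps / 2) ltac:(lra)) as [N2 H2].
  exists (N1 + N2)%nat. intros k Hk.
  specialize (H1 k ltac:(lia)). specialize (H2 k ltac:(lia)).
  rewrite Nat.even_mul, Nat.div2_double in H1. simpl orb in H1.
  rewrite Nat.even_succ, <- Nat.negb_even, Nat.even_mul, Nat.div2_succ_double in H2. simpl orb in H2.
  cbv beta iota in H1, H2. simpl negb in H2. cbv iota in H2.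
  set (z := u (phi k) n) in *.
  replace (z - (c (2 * n)%nat, c (S (2 * n))))%C with
    (RtoC (Re z - c (2 * n)%nat) + Ci * RtoC (Im z - c (S (2 * n))))%C
    by (destruct z; apply C_eq_Re_Im; simpl; ring).
  eapply Rle_lt_trans; [apply Cmod_triangle|]. rewrite Cmod_mult, !Cmod_R, Cmod_Ci. lra.
Qed.

Lemma increasing_ge_id (phi : nat -> nat) : (forall k, (phi k < phi (S k))%nat) ->
  forall k, (k <= phi k)%nat.
Proof. intros H k. induction k as [|k IH]; [lia|]. specialize (H k). lia. Qed.

(** The second-order remainder is at most [K * Cmod (w - z0) ^ 2] with [K] common to the sequence;
    the derivative is a limit of the bounded first coefficients along a subsequence. *)
Lemma Cdiff_limit (fs : nat -> C -> C) (f : C -> C) (z0 : C) (rho r M : R) :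
  0 < rho < r ->
  (forall n, holo_ball (fs n) z0 r) ->
  (forall n z, Cmod (z - z0) = rho -> Cmod (fs n z) <= M) ->
  (forall z, Cmod (z - z0) < r -> Cconv (fun n => fs n z) (f z)) ->
  exists l, Cdiff f z0 l.
Proof.
  intros Hrho Hf HM Hc.
  destruct (choice (fun n a => taylor_bounds (fs n) z0 rho M a)) as [a Ha].
  { intros n. apply (taylor_exists (fs n) z0 rho r M (Hf n) Hrho (HM n)). }
  assert (PM : 0 <= M).
  { pose proof (proj1 (Ha 0%nat) 0%nat) as B. simpl in B. pose proof (Cmod_ge_0 (a 0%nat 0%nat)). lra. }
  (* With all columns equal, the extraction is the Bolzano-Weierstrass theorem for the first
     coefficients. *)
  destruct (Cdiagonal_extraction (fun m _ => a m 1%nat) (fun _ => M / rho)) as [c [phi [Hphi Hl]]].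
  { intros m _. pose proof (proj1 (Ha m) 1%nat) as B. simpl in B.
    apply (Rmult_le_reg_r rho); [lra|]. unfold Rdiv. rewrite Rmult_assoc, Rinv_l; lra. }
  specialize (Hl 0%nat). set (l := c 0%nat) in *.
  pose proof (increasing_ge_id phi Hphi) as Hid.
  assert (A0 : forall n, a n 0%nat = fs n z0).
  { intros n. pose proof (proj2 (Ha n) 0 1%nat) as B. rewrite Cmod_0 in B.
    specialize (B ltac:(lra)). unfold Rdiv in B. rewrite Rmult_0_l in B. simpl in B.
    replace (M * (0 * 1) * (rho * / (rho - 0))) with 0 in B by ring.
    rewrite Cplus_0_r in B.
    assert (E : (fs n z0 - (0 + a n 0%nat * 1))%C = 0).
    { apply Cmod_eq_0. apply Rle_antisym; [exact B|apply Cmod_ge_0]. }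
    replace (fs n z0) with ((fs n z0 - (0 + a n 0%nat * 1)) + a n 0%nat)%C by ring.
    rewrite E. ring. }
  set (K := 2 * M * (/ rho) ^ 2).
  assert (PK : 0 <= K).
  { unfold K. apply Rmult_le_pos; [lra|]. apply pow_le. left. apply Rinv_0_lt_compat. lra. }
  exists l. intros eps Heps.
  exists (Rmin (rho / 2) (eps / (K + 1))). split.
  { apply Rmin_pos; [lra|apply Rdiv_lt_0_compat; lra]. }
  intros w Hw.
  assert (T1 : Cmod (w - z0) < rho / 2) by (eapply Rlt_le_trans; [exact Hw|apply Rmin_l]).
  assert (T2 : Cmod (w - z0) < eps / (K + 1)) by (eapply Rlt_le_trans; [exact Hw|apply Rmin_r]).
  pose proof (Cmod_ge_0 (w - z0)) as Pw.
  apply Rle_trans with (K * Cmod (w - z0) ^ 2).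
  - apply (Cconv_Cmod_le (fun n => fs (phi n) w - fs (phi n) z0 - a (phi n) 1%nat * (w - z0))%C _ _ 0).
    + apply Cconv_minus; [apply Cconv_minus|apply Cconv_mult_const, Hl].
      * apply (Cconv_subseq (fun n => fs n w)); [exact Hid|]. apply Hc. lra.
      * apply (Cconv_subseq (fun n => fs n z0)); [exact Hid|]. apply Hc.
        replace (z0 - z0)%C with (RtoC 0) by ring. rewrite Cmod_0. lra.
    + intros n _. cbv beta.
      pose proof (taylor_bounds_half _ _ _ _ _ (proj1 Hrho) (Ha (phi n)) (w - z0)%C 2%nat T1) as B.
      replace (z0 + (w - z0))%C with w in B by ring. fold K in B.
      unfold tpoly in B. rewrite A0 in B.
      replace (fs (phi n) w - (0 + fs (phi n) z0 * (w - z0) ^ 0 + a (phi n) 1%nat * (w - z0) ^ 1))%C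
        with (fs (phi n) w - fs (phi n) z0 - a (phi n) 1%nat * (w - z0))%C in B
        by (simpl; ring).
      exact B.
  - simpl. rewrite Rmult_1_r, <- Rmult_assoc. apply Rmult_le_compat_r; [exact Pw|].
    apply (Rmult_lt_compat_r (K + 1)) in T2; [|lra].
    replace (eps / (K + 1) * (K + 1)) with eps in T2 by (field; lra). nra.
Qed.

Lemma tpoly_cauchy (a : nat -> nat -> C) (c : nat -> C) (N : nat) :
  (forall n, Cconv (fun k => a k n) (c n)) ->
  forall eps, 0 < eps -> exists k0, forall k z, (k0 <= k)%nat -> Cmod z <= 1 ->
    Cmod (tpoly (a k) N z - tpoly c N z) < eps.
Proof.
  intros H. induction N as [|N IH]; intros eps Heps.
  - exists 0%nat. intros k z _ _. simpl. replace (0 - 0)%C with (RtoC 0) by ring. rewrite Cmod_0. lra.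
  - destruct (IH (eps / 2) ltac:(lra)) as [k1 H1].
    destruct (H N (eps / 2) ltac:(lra)) as [k2 H2].
    exists (k1 + k2)%nat. intros k z Hk Hz.
    specialize (H1 k z ltac:(lia) Hz). specialize (H2 k ltac:(lia)). cbv beta in H2. simpl.
    replace (tpoly (a k) N z + a k N * z ^ N - (tpoly c N z + c N * z ^ N))%C
      with ((tpoly (a k) N z - tpoly c N z) + (a k N - c N) * z ^ N)%C by ring.
    eapply Rle_lt_trans; [apply Cmod_triangle|]. rewrite Cmod_mult, Cmod_pow.
    pose proof (Cmod_ge_0 z). pose proof (Cmod_ge_0 (a k N - c N)).
    assert (Cmod z ^ N <= 1) by (rewrite <- (pow1 N); apply pow_incr; lra).
    pose proof (pow_le (Cmod z) N ltac:(lra)). nra.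
Qed.

(** Convergence of every Taylor coefficient at 0 along a subsequence suffices: for [Cmod z <= rho]
    the tails are uniformly small by the bound on a larger circle, and the remaining polynomials
    converge uniformly. *)
Lemma montel (fs : nat -> C -> C) (M : R -> R) :
  (forall n, holo_ball (fs n) 0 1) ->
  (forall rho n z, rho < 1 -> Cmod z <= rho -> Cmod (fs n z) <= M rho) ->
  exists (f : C -> C) (phi : nat -> nat), (forall k, (phi k < phi (S k))%nat) /\
    holo_ball f 0 1 /\
    forall rho, rho < 1 -> forall eps, 0 < eps -> exists N, forall n z, (N <= n)%nat ->
      Cmod z <= rho -> Cmod (fs (phi n) z - f z) < eps.
Proof.
  intros Hf HM.
  destruct (choice (fun n a => forall rho M, 0 < rho < 1 ->
    (forall z, Cmod (z - 0) = rho -> Cmod (fs n z) <= M) -> taylor_bounds (fs n) 0 rho M a)) as [a Ha].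
  { intros n. apply holo_ball_taylor; [lra|apply Hf]. }
  assert (Hb : forall n rho, 0 < rho < 1 -> taylor_bounds (fs n) 0 rho (M rho) (a n)).
  { intros n rho Hrho. apply Ha; [exact Hrho|]. intros z Hz.
    replace (z - 0)%C with z in Hz by ring. apply HM; lra. }
  (* Cauchy's estimates on the circle of radius 1/2 bound each coefficient independently of the
     function. *)
  destruct (Cdiagonal_extraction a (fun n => M (1 / 2) / (1 / 2) ^ n)) as [c [phi [Hphi Hc]]].
  { intros m n. pose proof (proj1 (Hb m (1 / 2) ltac:(lra)) n) as B.
    assert (P : 0 < (1 / 2) ^ n) by (apply pow_lt; lra).
    apply (Rmult_le_reg_r ((1 / 2) ^ n)); [exact P|].
    replace (M (1 / 2) / (1 / 2) ^ n * (1 / 2) ^ n) with (M (1 / 2)) by (field; lra). exact B. }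
  assert (Hcauchy : forall rho, rho < 1 -> forall eps, 0 < eps -> exists N, forall n m z,
     (N <= n)%nat -> (N <= m)%nat -> Cmod z <= rho -> Cmod (fs (phi n) z - fs (phi m) z) < eps).
  { intros rho Hrho eps Heps.
    destruct (Rlt_dec rho 0) as [Hneg|Hnn].
    { exists 0%nat. intros n m z _ _ Hz. pose proof (Cmod_ge_0 z). lra. }
    (* Halfway between [rho] and 1, so that the tails are geometric with ratio at most [rho / s]. *)
    set (s := (1 + rho) / 2).
    assert (Hs : 0 < s < 1) by (unfold s; lra).
    assert (Hrs : rho < s) by (unfold s; lra).
    destruct (geometric_small (rho / s) (M s * (s / (s - rho))) (eps / 4)) as [N HN].
    - split; [apply Rmult_le_pos; [lra|left; apply Rinv_0_lt_compat; lra]|].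
      apply (Rmult_lt_reg_r s); [lra|]. unfold Rdiv. rewrite Rmult_assoc, Rinv_l; lra.
    - lra.
    - specialize (HN N (le_n N)).
      destruct (tpoly_cauchy (fun k => a (phi k)) c N Hc (eps / 4) ltac:(lra)) as [k0 Hk0].
      exists k0.
      assert (Rem : forall n z, Cmod z <= rho -> Cmod (fs (phi n) z - tpoly (a (phi n)) N z) < eps / 4).
      { intros n z Hz. pose proof (Cmod_ge_0 z) as Pz.
        destruct (Hb (phi n) s Hs) as [B0 B]. specialize (B z N ltac:(lra)).
        specialize (B0 0%nat). simpl in B0. pose proof (Cmod_ge_0 (a (phi n) 0%nat)).
        replace (0 + z)%C with z in B by ring.
        eapply Rle_lt_trans; [exact B|]. eapply Rle_lt_trans; [|exact HN].
        replace (M s * (s / (s - rho)) * (rho / s) ^ N) with (M s * (rho / s) ^ N * (s / (s - rho))) by ring.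
        apply Rmult_le_compat.
        - apply Rmult_le_pos; [lra|]. apply pow_le. apply Rmult_le_pos; [lra|].
          left. apply Rinv_0_lt_compat. lra.
        - apply Rmult_le_pos; [lra|]. left. apply Rinv_0_lt_compat. lra.
        - apply Rmult_le_compat_l; [lra|]. apply pow_incr.
          split; [apply Rmult_le_pos; [lra|left; apply Rinv_0_lt_compat; lra]|].
          apply Rmult_le_compat_r; [left; apply Rinv_0_lt_compat; lra|exact Hz].
        - apply Rmult_le_compat_l; [lra|]. apply Rinv_le_contravar; lra. }
      intros n m z Hn Hm Hz.
      pose proof (Rem n z Hz) as R1. pose proof (Rem m z Hz) as R2.
      pose proof (Hk0 n z Hn ltac:(lra)) as R3. pose proof (Hk0 m z Hm ltac:(lra)) as R4.
      cbv beta in R3, R4.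
      set (p := tpoly (a (phi n)) N z) in *. set (q := tpoly (a (phi m)) N z) in *.
      set (t := tpoly c N z) in *.
      replace (fs (phi n) z - fs (phi m) z)%C with
        ((fs (phi n) z - p) + (p - t) - (fs (phi m) z - q) - (q - t))%C by ring.
      eapply Rle_lt_trans; [apply Cmod_triangle4|]. lra. }
  destruct (choice (fun z l => Cmod z < 1 -> Cconv (fun n => fs (phi n) z) l)) as [f Hfl].
  { intros z. destruct (Rlt_dec (Cmod z) 1) as [Hz|Hz]; [|exists 0; lra].
    destruct (Ccauchy_conv (fun n => fs (phi n) z)) as [l Hl].
    - intros eps Heps. destruct (Hcauchy (Cmod z) Hz eps Heps) as [N HN]. exists N.
      intros n m Hn Hm. apply HN; [exact Hn|exact Hm|lra].
    - exists l. intros _. exact Hl. }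
  exists f, phi. split; [exact Hphi|]. split.
  - intros z Hz. replace (z - 0)%C with z in Hz by ring.
    set (r := 1 - Cmod z).
    assert (Hsub : forall w s, Cmod (w - z) <= s -> Cmod w <= Cmod z + s).
    { intros w s Hw. replace w with ((w - z) + z)%C by ring.
      eapply Rle_trans; [apply Cmod_triangle|]. lra. }
    apply (Cdiff_limit (fun n => fs (phi n)) f z (r / 2) r (M (Cmod z + r / 2))).
    + unfold r. lra.
    + intros n. apply (holo_ball_subset _ 0 z 1); [|apply Hf].
      replace (z - 0)%C with z by ring. unfold r. lra.
    + intros n w Hw. apply HM; [unfold r; lra|]. apply Hsub. lra.
    + intros w Hw. apply Hfl. specialize (Hsub w (Cmod (w - z)) ltac:(lra)). unfold r in Hw. lra.
  - intros rho Hrho eps Heps.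
    destruct (Hcauchy rho Hrho (eps / 2) ltac:(lra)) as [N HN]. exists N.
    intros n z Hn Hz.
    apply Rle_lt_trans with (eps / 2); [|lra].
    (* The Cauchy estimate is kept as [m] tends to infinity. *)
    apply (Cconv_Cmod_le (fun m => fs (phi n) z - fs (phi m) z)%C _ _ N).
    + apply Cconv_minus.
      * intros e He. exists 0%nat. intros k _. unfold Cminus. rewrite Cplus_opp_r, Cmod_0. exact He.
      * apply Hfl. lra.
    + intros m Hm. cbv beta. left. apply HN; assumption.
Qed.

(** * Uniform boundedness *)

Lemma complete_seq_limit {K : AbsRing} (B : CompleteNormedModule K) (x : nat -> B) :
  (forall eps, 0 < eps -> exists N, forall n, (N <= n)%nat -> norm (minus (x n) (x N)) < eps) ->
  exists y : B, forall eps, 0 < eps -> exists N, forall n, (N <= n)%nat -> norm (minus (x n) y) < eps.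
Proof.
  intros H.
  assert (HP : ProperFilter (filtermap x eventually)) by (apply filtermap_proper_filter, eventually_filter).
  assert (HC : cauchy (filtermap x eventually)).
  { intros eps. destruct (H eps (cond_pos eps)) as [N HN]. exists (x N). exists N.
    intros n Hn. apply (norm_compat1 (V := B)). apply HN, Hn. }
  pose proof (complete_cauchy _ HP HC) as L.
  exists (lim (filtermap x eventually)). intros eps Heps.
  (* Closeness in the uniform structure controls the norm only up to [norm_factor]. *)
  assert (P : 0 < eps / @norm_factor K B) by (apply Rdiv_lt_0_compat; [exact Heps|apply norm_factor_gt_0]).
  destruct (L (mkposreal _ P)) as [N HN]. exists N. intros n Hn. specialize (HN n Hn).
  apply (norm_compat2 (V := B)) in HN. simpl in HN.
  replace (norm_factor * (eps / norm_factor)) with eps in HN; [exact HN|].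
  field. pose proof (@norm_factor_gt_0 K B). lra.
Qed.

Lemma norm_minus_sym {K : AbsRing} {V : NormedModule K} (x y : V) :
  norm (minus x y) = norm (minus y x).
Proof. rewrite <- norm_opp, opp_minus. reflexivity. Qed.

Lemma norm_minus_triangle {K : AbsRing} {V : NormedModule K} (x y z : V) :
  norm (minus x z) <= norm (minus x y) + norm (minus y z).
Proof. rewrite (minus_trans y). apply norm_triangle. Qed.

Lemma minus_plus_cancel {G : AbelianGroup} (x y : G) : minus (plus x y) y = x.
Proof.
  unfold minus. rewrite <- plus_assoc.
  transitivity (plus x zero); [apply f_equal; exact (plus_opp_r y)|apply plus_zero_r].
Qed.

(** Gliding hump. The balls [B(x n, r n)] are nested, the [n]-th functional exceeds
    [n + 1] at [x (n + 1)], and [r (n + 1)] is so small that it still exceeds [n - 1] on the next ball. *)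
Lemma uniform_boundedness {I : Type} (B : CompleteNormedModule C_AbsRing) (T : I -> B -> C) :
  (forall i, @is_linear C_AbsRing B C_NormedModule (T i)) ->
  (forall x, exists K, forall i, Cmod (T i x) <= K) ->
  exists M, 0 <= M /\ forall i x, Cmod (T i x) <= M * norm x.
Proof.
  intros HT Hpt. apply NNPP. intros HNbd.
  assert (Hbig : forall M, 0 <= M -> exists i v, M * norm v < Cmod (T i v)).
  { intros M HM. apply NNPP. intros H. apply HNbd. exists M. split; [exact HM|].
    intros i x. apply Rnot_lt_le. intros Hlt. apply H. exists i, x. exact Hlt. }
  set (ds := fun x y : B => norm (minus x y)).
  assert (dtri : forall x y z, ds x z <= ds x y + ds y z).
  { intros x y z. exact (norm_minus_triangle (V := B) x y z). }
  assert (dsym : forall x y, ds x y = ds y x).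
  { intros x y. exact (norm_minus_sym (V := B) x y). }
  assert (dself : forall x, ds x x = 0).
  { intros x. exact (eq_trans (f_equal norm (plus_opp_r x)) norm_zero). }
  assert (Hplus : forall i x y, T i (plus x y) = (T i x + T i y)%C) by (intros; apply (linear_plus _ (HT i))).
  assert (Hminus : forall i x y, T i (minus x y) = (T i x - T i y)%C).
  { intros. rewrite (linear_minus _ _ _ (HT i)). reflexivity. }
  assert (Hscal : forall i k x, T i (scal k x) = (k * T i x)%C) by (intros; apply (linear_scal _ (HT i))).
  assert (Hbd : forall i, exists M, 0 < M /\ forall x, Cmod (T i x) <= M * norm x) by (intros i; apply (linear_norm _ (HT i))).
  (* A vector on which some functional is large is scaled to length at most [r]; since T(x + u) -
     T(x - u) = 2 T(u), that functional is large at [x + u] or at [x - u]. *)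
  assert (Hhump : forall (x : B) (r t : R), 0 < r -> 0 <= t ->
    exists i y, ds y x <= r /\ t < Cmod (T i y)).
  { intros x r t Hr Ht.
    destruct (Hbig (t / r)) as [i [v Hv]]; [apply Rmult_le_pos; [lra|left; apply Rinv_0_lt_compat, Hr]|].
    assert (Pv : 0 < norm v).
    { destruct (norm_ge_0 v) as [H|H]; [exact H|exfalso].
      rewrite <- H, Rmult_0_r in Hv. symmetry in H. apply norm_eq_zero in H.
      rewrite H, (linear_zero _ (HT i)) in Hv. change (zero : C_NormedModule) with (RtoC 0) in Hv.
      rewrite Cmod_0 in Hv. lra. }
    set (u := scal (RtoC (r / norm v) : C_AbsRing) v).
    assert (Q : 0 < r / norm v) by (apply Rdiv_lt_0_compat; assumption).
    assert (Nu : norm u <= r).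
    { eapply Rle_trans; [apply norm_scal|].
      change (Cmod (RtoC (r / norm v)) * norm v <= r).
      rewrite Cmod_R, Rabs_pos_eq by lra. right. field. lra. }
    assert (Tu : t < Cmod (T i u)).
    { unfold u. rewrite Hscal, Cmod_mult, Cmod_R, Rabs_pos_eq by lra.
      apply (Rmult_lt_compat_l (r / norm v)) in Hv; [|exact Q].
      replace (r / norm v * (t / r * norm v)) with t in Hv by (field; split; lra). exact Hv. }
    destruct (Rlt_dec t (Cmod (T i (plus x u)))) as [Hl|Hl].
    - exists i, (plus x u). split; [|exact Hl].
      assert (E : minus (plus x u) x = u) by (rewrite (plus_comm x u); exact (minus_plus_cancel u x)).
      unfold ds. rewrite E. exact Nu.
    - exists i, (minus x u). split.
      + assert (E : minus (minus x u) x = opp u).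
        { transitivity (minus (plus (opp u) x) x); [|exact (minus_plus_cancel (opp u) x)].
          apply (f_equal (fun v => minus v x)). exact (plus_comm x (opp u)). }
        unfold ds. rewrite E. eapply Rle_trans; [right; exact (norm_opp u)|exact Nu].
      + rewrite Hplus in Hl. rewrite Hminus.
        pose proof (Cmod_triangle (T i x + T i u) (- (T i x - T i u))) as Tr.
        rewrite Cmod_opp in Tr.
        replace (T i x + T i u + - (T i x - T i u))%C with (2 * T i u)%C in Tr by ring.
        rewrite Cmod_mult, Cmod_R, Rabs_pos_eq in Tr by lra. lra. }
  (* The last clause records that the chosen functional changes by at most 1 within twice the new
     radius. *)
  assert (Hstep : forall s : nat * (B * R), exists t : I * (B * R), 0 < snd (snd s) ->
    ds (fst (snd t)) (fst (snd s)) <= snd (snd s) /\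
    0 < snd (snd t) <= snd (snd s) / 2 /\
    INR (fst s) + 1 < Cmod (T (fst t) (fst (snd t))) /\
    forall v, norm v <= 2 * snd (snd t) -> Cmod (T (fst t) v) <= 1).
  { intros [n [x r]]. simpl. destruct (Rlt_dec 0 r) as [Hr|Hr].
    - destruct (Hhump x r (INR n + 1) Hr) as [i [y [Hy1 Hy2]]]; [pose proof (pos_INR n); lra|].
      destruct (Hbd i) as [M [HM1 HM2]].
      exists (i, (y, Rmin (r / 2) (/ (2 * M)))). simpl. intros _.
      assert (0 < / (2 * M)) by (apply Rinv_0_lt_compat; lra).
      split; [exact Hy1|]. split; [split; [apply Rmin_pos; lra|apply Rmin_l]|].
      split; [exact Hy2|]. intros v Hv. eapply Rle_trans; [apply HM2|].
      pose proof (Rmin_r (r / 2) (/ (2 * M))).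
      apply Rle_trans with (M * (2 * / (2 * M))); [apply Rmult_le_compat_l; lra|right; field; lra].
    (* Placeholder for a nonpositive radius; [Hbig] supplies an index. *)
    - destruct (Hbig 0 (Rle_refl 0)) as [i _]. exists (i, (x, r)). intros; lra. }
  destruct (choice _ Hstep) as [st Hst].
  set (z := fix z (n : nat) : B * R := match n with O => (zero, 1) | S k => snd (st (k, z k)) end).
  set (x := fun n => fst (z n)). set (r := fun n => snd (z n)).
  assert (Hr : forall n, 0 < r n).
  { induction n as [|n IH]; [unfold r; simpl; lra|]. unfold r. simpl. apply (Hst (n, z n)). exact IH. }
  assert (Hs : forall n, ds (x (S n)) (x n) <= r n /\ r (S n) <= r n / 2).
  { intros n. destruct (Hst (n, z n) (Hr n)) as [P1 [P2 _]]. split; [exact P1|apply P2]. }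
  (* Each move is at most the current radius and the radii at least halve, so the moves telescope
     against [2 * r]. *)
  assert (Hfar : forall n k, ds (x (n + k)%nat) (x n) <= 2 * r n - 2 * r (n + k)%nat).
  { intros n k. induction k as [|k IH].
    - rewrite Nat.add_0_r, dself. lra.
    - rewrite Nat.add_succ_r. destruct (Hs (n + k)%nat) as [P1 P2].
      specialize (dtri (x (S (n + k))) (x (n + k)%nat) (x n)). lra. }
  assert (Hr2 : forall n, r n <= (/ 2) ^ n).
  { induction n as [|n IH]; [unfold r; simpl; lra|]. destruct (Hs n). simpl. lra. }
  destruct (complete_seq_limit B x) as [y Hy].
  { intros eps Heps. destruct (geometric_small (/ 2) 2 eps ltac:(lra) Heps) as [N HN].
    exists N. intros n Hn. specialize (HN N (le_n N)).
    replace n with (N + (n - N))%nat by lia. eapply Rle_lt_trans; [apply Hfar|].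
    specialize (Hr2 N). specialize (Hr (N + (n - N))%nat). lra. }
  assert (Hclose : forall n, ds y (x n) <= 2 * r n).
  { intros n. apply Rnot_lt_le. intros Hlt.
    destruct (Hy (ds y (x n) - 2 * r n) ltac:(lra)) as [N HN].
    specialize (HN (n + N)%nat ltac:(lia)). specialize (Hfar n N).
    change (ds (x (n + N)%nat) y < ds y (x n) - 2 * r n) in HN.
    specialize (dtri y (x (n + N)%nat) (x n)). rewrite (dsym y (x (n + N)%nat)) in dtri.
    specialize (Hr (n + N)%nat). lra. }
  destruct (Hpt y) as [K HK].
  (* With [K < n]: the functional exceeds [n + 1] at [x (S n)], is at most [K] at the limit [y], and
     changes by at most 1 between them. *)
  destruct (INR_archimed 1 K Rlt_0_1) as [n Hn].
  destruct (Hst (n, z n) (Hr n)) as [_ [_ [P3 P4]]].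
  set (i := fst (st (n, z n))) in *.
  change (fst (snd (st (n, z n)))) with (x (S n)) in P3.
  change (snd (snd (st (n, z n)))) with (r (S n)) in P4.
  specialize (P4 (minus y (x (S n))) (Hclose (S n))). rewrite Hminus in P4.
  specialize (HK i). simpl in P3.
  pose proof (Cmod_triangle (T i y) (- (T i y - T i (x (S n))))) as Tr. rewrite Cmod_opp in Tr.
  replace (T i y + - (T i y - T i (x (S n))))%C with (T i (x (S n))) in Tr by ring. lra.
Qed.

(** * Sequences enumerated by index sets *)

(** For an index in [P] this is its position in the increasing enumeration of [P]. *)
Fixpoint count_below (P : nat -> Prop) (n : nat) : nat :=
  match n with
  | O => O
  | S m => if excluded_middle_informative (P m) then S (count_below P m) else count_below P m
  end.

Lemma count_below_le (P : nat -> Prop) (n m : nat) :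
  (n <= m)%nat -> (count_below P n <= count_below P m)%nat.
Proof.
  induction 1 as [|m _ IH]; [lia|]. simpl. destruct (excluded_middle_informative (P m)); lia.
Qed.

Lemma count_below_lt (P : nat -> Prop) (n m : nat) :
  P n -> (n < m)%nat -> (count_below P n < count_below P m)%nat.
Proof.
  intros HP H. pose proof (count_below_le P (S n) m H) as L. simpl in L.
  destruct (excluded_middle_informative (P n)); [lia|contradiction].
Qed.

Lemma count_below_onto (P : nat -> Prop) (n k : nat) : (k < count_below P n)%nat ->
  exists i, (i < n)%nat /\ P i /\ count_below P i = k.
Proof.
  induction n as [|n IH]; simpl; [lia|].
  destruct (excluded_middle_informative (P n)) as [H|H]; intros Hk.
  - destruct (Nat.eq_dec k (count_below P n)) as [->|Hne].
    + exists n. repeat split; [lia|exact H].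
    + destruct IH as [i [H1 H2]]; [lia|]. exists i. split; [lia|exact H2].
  - destruct (IH Hk) as [i [H1 H2]]. exists i. split; [lia|exact H2].
Qed.

(** The index [i] is put at position [count_below P i]; the positions taken form an initial segment,
    finite exactly when [P] is bounded. *)
Lemma increasing_enumeration (P : nat -> Prop) : exists (len : option nat) (e : nat -> nat),
  (forall k, in_dom len k -> P (e k)) /\
  (forall k k', in_dom len k -> in_dom len k' -> (k < k')%nat -> (e k < e k')%nat) /\
  (forall i, P i -> exists k, in_dom len k /\ e k = i) /\
  ((exists N, forall i, P i -> (i < N)%nat) <-> exists n, len = Some n).
Proof.
  assert (X : forall len, (forall k, in_dom len k <-> exists i, P i /\ count_below P i = k) ->
    exists e : nat -> nat,
    (forall k, in_dom len k -> P (e k)) /\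
    (forall k k', in_dom len k -> in_dom len k' -> (k < k')%nat -> (e k < e k')%nat) /\
    (forall i, P i -> exists k, in_dom len k /\ e k = i)).
  { intros len Hlen.
    destruct (choice (fun k i => in_dom len k -> P i /\ count_below P i = k)) as [e He].
    { intros k. destruct (classic (in_dom len k)) as [H|H]; [|exists 0%nat; tauto].
      destruct (proj1 (Hlen k) H) as [i Hi]. exists i. intros _. exact Hi. }
    exists e. split; [intros k Hk; apply He, Hk|]. split.
    - intros k k' Hk Hk' Hlt. destruct (He k Hk) as [P1 E1]. destruct (He k' Hk') as [P2 E2].
      destruct (Nat.lt_ge_cases (e k) (e k')) as [L|L]; [exact L|].
      pose proof (count_below_le P _ _ L). lia.
    - intros i Hi. assert (Hd : in_dom len (count_below P i)) by (apply Hlen; exists i; auto).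
      exists (count_below P i). split; [exact Hd|].
      destruct (He _ Hd) as [P1 E1].
      destruct (Nat.lt_trichotomy (e (count_below P i)) i) as [L|[L|L]]; [|exact L|].
      + pose proof (count_below_lt P _ _ P1 L). lia.
      + pose proof (count_below_lt P _ _ Hi L). lia. }
  destruct (classic (exists N, forall i, P i -> (i < N)%nat)) as [[N HN]|Hinf].
  - destruct (X (Some (count_below P N))) as [e [E1 [E2 E3]]].
    { intros k. simpl. split.
      - intros Hk. destruct (count_below_onto P N k Hk) as [i [_ Hi]]. exists i. exact Hi.
      - intros [i [Hi <-]]. apply count_below_lt; [exact Hi|apply HN, Hi]. }
    exists (Some (count_below P N)), e. repeat split; try assumption.
    + intros _. eexists. reflexivity.
    + intros _. exists N. exact HN.
  - destruct (X None) as [e [E1 [E2 E3]]].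
    { intros k. simpl. split; [intros _|trivial].
      assert (Y : forall m, exists n, (m <= count_below P n)%nat).
      { induction m as [|m [n Hn]]; [exists 0%nat; lia|].
        assert (Z : exists i, P i /\ (n <= i)%nat).
        { apply NNPP. intros H. apply Hinf. exists n. intros i Hi.
          destruct (Nat.lt_ge_cases i n); [assumption|]. exfalso. apply H. exists i. split; assumption. }
        destruct Z as [i [Hi Hni]]. exists (S i).
        pose proof (count_below_lt P i (S i) Hi ltac:(lia)). pose proof (count_below_le P n i Hni). lia. }
      destruct (Y (S k)) as [n Hn]. destruct (count_below_onto P n k ltac:(lia)) as [i [_ Hi]].
      exists i. exact Hi. }
    exists None, e. repeat split; try assumption.
    + intros H. contradiction.
    + intros [n Hn]. discriminate.
Qed.

(** Subsequences are described by index sets, so that inclusion, union and difference become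
    statements about [P]; [e] translates positions into indices. *)
Definition enumerates (T : disc_seq) (P : nat -> Prop) (p : nat -> C) (e : nat -> nat) : Prop :=
  (forall k, in_dom (len T) k -> P (e k) /\ pt T k = p (e k)) /\
  (forall k k', in_dom (len T) k -> in_dom (len T) k' -> (k < k')%nat -> (e k < e k')%nat) /\
  (forall i, P i -> exists k, in_dom (len T) k /\ e k = i).

Definition admissible (P : nat -> Prop) (p : nat -> C) : Prop :=
  (forall i, P i -> in_disc (p i)) /\
  (forall z, exists l, forall i, P i -> p i = z -> In i l).

Lemma enumerates_inj (T : disc_seq) (P : nat -> Prop) (p : nat -> C) (e : nat -> nat) (k k' : nat) :
  enumerates T P p e -> in_dom (len T) k -> in_dom (len T) k' -> e k = e k' -> k = k'.
Proof.
  intros [_ [H _]] Hk Hk' E.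
  destruct (Nat.lt_trichotomy k k') as [L|[L|L]]; [|exact L|].
  - specialize (H k k' Hk Hk' L). lia.
  - specialize (H k' k Hk' Hk L). lia.
Qed.

Lemma enumerates_exists (P : nat -> Prop) (p : nat -> C) : admissible P p ->
  exists T e, enumerates T P p e /\
    ((exists N, forall i, P i -> (i < N)%nat) <-> exists n, len T = Some n).
Proof.
  intros [Hd Hf].
  destruct (increasing_enumeration P) as [ln [e [E1 [E2 [E3 E4]]]]].
  assert (D1 : forall i, in_dom ln i -> in_disc (p (e i))) by (intros i Hi; apply Hd, E1, Hi).
  assert (D2 : forall z, exists l, forall i, in_dom ln i -> p (e i) = z -> In i l).
  { intros z. destruct (Hf z) as [l Hl].
    destruct (choice (fun i k => P i -> in_dom ln k /\ e k = i)) as [g Hg].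
    { intros i. destruct (classic (P i)) as [H|H]; [|exists 0%nat; tauto].
      destruct (E3 i H) as [k Hk]. exists k. intros _. exact Hk. }
    exists (map g l). intros i Hi Hz. apply in_map_iff. exists (e i).
    split; [|apply Hl; [apply E1, Hi|exact Hz]].
    destruct (Hg (e i) (E1 i Hi)) as [G1 G2].
    destruct (Nat.lt_trichotomy (g (e i)) i) as [L|[L|L]]; [|exact L|].
    - specialize (E2 _ _ G1 Hi L). lia.
    - specialize (E2 _ _ Hi G1 L). lia. }
  exists (Build_disc_seq ln (fun k => p (e k)) D1 D2), e. split; [|exact E4].
  split; [|split].
  - intros k Hk. split; [apply E1, Hk|reflexivity].
  - exact E2.
  - exact E3.
Qed.

Definition has_mult (P : nat -> Prop) (p : nat -> C) (z : C) (k : nat) : Prop :=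
  exists l : list nat, NoDup l /\ length l = k /\ forall i, In i l <-> P i /\ p i = z.

Lemma has_mult_unique (P : nat -> Prop) (p : nat -> C) (z : C) (k k' : nat) :
  has_mult P p z k -> has_mult P p z k' -> k = k'.
Proof.
  intros [l [N1 [<- H1]]] [l' [N2 [<- H2]]].
  apply Nat.le_antisymm; apply NoDup_incl_length; try assumption; intros i Hi.
  - apply H2, H1, Hi.
  - apply H1, H2, Hi.
Qed.

Lemma finite_set_list (Q : nat -> Prop) : (exists l, forall i, Q i -> In i l) ->
  exists l, NoDup l /\ forall i, In i l <-> Q i.
Proof.
  intros [l Hl].
  exists (nodup Nat.eq_dec (filter (fun i => if excluded_middle_informative (Q i) then true else false) l)).
  split; [apply NoDup_nodup|]. intros i. rewrite nodup_In, filter_In.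
  destruct (excluded_middle_informative (Q i)); split.
  - intros _; assumption.
  - intros H. split; [apply Hl, H|reflexivity].
  - intros [_ H]; discriminate.
  - intros H; contradiction.
Qed.

Lemma has_mult_exists (P : nat -> Prop) (p : nat -> C) (z : C) : admissible P p ->
  exists k, has_mult P p z k.
Proof.
  intros [_ H]. destruct (H z) as [l Hl].
  destruct (finite_set_list (fun i => P i /\ p i = z)) as [l' [N1 N2]].
  { exists l. intros i [H1 H2]. apply Hl; assumption. }
  exists (length l'), l'. repeat split; try assumption; apply N2; assumption.
Qed.

Lemma repeated_enumerates (T : disc_seq) (P : nat -> Prop) (p : nat -> C) (e : nat -> nat)
  (z : C) (k : nat) : enumerates T P p e -> (repeated T z k <-> has_mult P p z k).
Proof.
  intros HT. pose proof HT as [E1 [E2 E3]].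
  destruct (choice (fun i j => P i -> in_dom (len T) j /\ e j = i)) as [g Hg].
  { intros i. destruct (classic (P i)) as [H|H]; [|exists 0%nat; tauto].
    destruct (E3 i H) as [j Hj]. exists j. intros _. exact Hj. }
  split; intros [l [N1 [N2 N3]]].
  - exists (map e l). split; [|split; [rewrite length_map; exact N2|]].
    + apply NoDup_map_NoDup_ForallPairs; [|exact N1].
      intros i j Hi Hj. apply (enumerates_inj T P p e i j HT); [apply N3, Hi|apply N3, Hj].
    + intros i. rewrite in_map_iff. split.
      * intros [j [<- Hj]]. apply N3 in Hj. destruct Hj as [Hj1 Hj2].
        destruct (E1 j Hj1) as [Q1 Q2]. split; [exact Q1|congruence].
      * intros [Hi Hz]. destruct (E3 i Hi) as [j [Hj1 <-]]. exists j. split; [reflexivity|].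
        apply N3. split; [exact Hj1|]. rewrite <- Hz. apply E1, Hj1.
  - exists (map g l). split; [|split; [rewrite length_map; exact N2|]].
    + apply NoDup_map_NoDup_ForallPairs; [|exact N1].
      intros i j Hi Hj E. apply N3 in Hi. apply N3 in Hj.
      destruct (Hg i (proj1 Hi)) as [_ <-]. destruct (Hg j (proj1 Hj)) as [_ <-]. rewrite E. reflexivity.
    + intros j. rewrite in_map_iff. split.
      * intros [i [<- Hi]]. apply N3 in Hi. destruct Hi as [Hi1 Hi2].
        destruct (Hg i Hi1) as [G1 G2]. split; [exact G1|]. transitivity (p (e (g i))); [apply E1, G1|rewrite G2; exact Hi2].
      * intros [Hj Hz]. destruct (E1 j Hj) as [Q1 Q2]. exists (e j). split.
        -- destruct (Hg (e j) Q1) as [G1 G2]. apply (enumerates_inj T P p e _ _ HT); assumption.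
        -- apply N3. split; [exact Q1|congruence].
Qed.

Lemma occurs_enumerates (T : disc_seq) (P : nat -> Prop) (p : nat -> C) (e : nat -> nat) (z : C) :
  enumerates T P p e -> (occurs z T <-> exists i, P i /\ p i = z).
Proof.
  intros [E1 [_ E3]]. split.
  - intros [k [Hk <-]]. exists (e k). destruct (E1 k Hk) as [Q1 Q2]. split; [exact Q1|congruence].
  - intros [i [Hi <-]]. destruct (E3 i Hi) as [k [Hk <-]]. exists k. split; [exact Hk|apply E1, Hk].
Qed.

Lemma occurs_has_mult (P : nat -> Prop) (p : nat -> C) (z : C) (k : nat) :
  has_mult P p z k -> ((exists i, P i /\ p i = z) <-> (0 < k)%nat).
Proof.
  intros [l [_ [<- H]]]. split.
  - intros [i Hi]. apply H in Hi. destruct l; [destruct Hi|simpl; lia].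
  - destruct l as [|i l]; simpl; [lia|]. intros _. exists i. apply H. left. reflexivity.
Qed.

(** Both sequences list values of the same [p] by increasing index, so positions correspond
    monotonically. *)
Lemma subseq_enumerates (T U : disc_seq) (P Q : nat -> Prop) (p : nat -> C) (e e' : nat -> nat) :
  enumerates T P p e -> enumerates U Q p e' -> (forall i, P i -> Q i) -> subseq T U.
Proof.
  intros [E1 [E2 _]] [F1 [F2 F3]] HPQ.
  destruct (choice (fun k j => in_dom (len T) k -> in_dom (len U) j /\ e' j = e k)) as [g Hg].
  { intros k. destruct (classic (in_dom (len T) k)) as [H|H]; [|exists 0%nat; tauto].
    destruct (F3 (e k)) as [j Hj]; [apply HPQ, E1, H|]. exists j. intros _. exact Hj. }
  exists g. split.
  - intros i j Hi Hj Hij. destruct (Hg i Hi) as [G1 G2]. destruct (Hg j Hj) as [G3 G4].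
    specialize (E2 i j Hi Hj Hij).
    destruct (Nat.lt_trichotomy (g i) (g j)) as [L|[L|L]]; [exact L| |].
    + rewrite L in G2. lia.
    + specialize (F2 _ _ G3 G1 L). lia.
  - intros i Hi. destruct (Hg i Hi) as [G1 G2]. split; [exact G1|].
    destruct (E1 i Hi) as [_ ->]. destruct (F1 _ G1) as [_ ->]. rewrite G2. reflexivity.
Qed.

(** * Vanishing along an index set *)

Lemma order_ge_mono (f : C -> C) (z : C) (N M : nat) :
  (M <= N)%nat -> order_ge f z N -> order_ge f z M.
Proof.
  intros HMN [K [d [Hd H]]]. exists (Rabs K), (Rmin d 1). split; [apply Rmin_pos; lra|].
  intros h Hh. pose proof (Rmin_l d 1). pose proof (Rmin_r d 1).
  eapply Rle_trans; [apply H; lra|].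
  pose proof (Cmod_ge_0 h) as Ph.
  replace N with (M + (N - M))%nat by lia. rewrite pow_add.
  pose proof (pow_le _ M Ph). pose proof (pow_le _ (N - M) Ph).
  assert (Cmod h ^ (N - M) <= 1) by (rewrite <- (pow1 (N - M)); apply pow_incr; lra).
  pose proof (Rle_abs K). pose proof (Rabs_pos K).
  apply Rle_trans with (Rabs K * (Cmod h ^ M * Cmod h ^ (N - M))).
  - apply Rmult_le_compat_r; [apply Rmult_le_pos; assumption|assumption].
  - apply Rmult_le_compat_l; [assumption|]. nra.
Qed.

Lemma holo_disc_ball (f : C -> C) : holo_disc f <-> holo_ball f 0 1.
Proof.
  assert (E : forall z : C, (z - 0)%C = z) by (intros; ring). split.
  - intros H z Hz. rewrite E in Hz. apply ex_derive_Cdiff, H, Hz.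
  - intros H z Hz. apply ex_derive_Cdiff, H. rewrite E. exact Hz.
Qed.

Lemma holo_ball_inner (f : C -> C) (z : C) : holo_ball f 0 1 -> holo_ball f z (1 - Cmod z).
Proof.
  apply holo_ball_subset. replace (z - 0)%C with z by ring. lra.
Qed.

Lemma order_ge_0 (f : C -> C) (z : C) : holo_ball f 0 1 -> in_disc z -> order_ge f z 0.
Proof.
  intros Hf Hz. unfold in_disc in Hz.
  destruct (holo_ball_expands f z (1 - Cmod z) ltac:(lra) (holo_ball_inner f z Hf)) as [a Ha].
  apply (order_ge_coef f z a 0 Ha). lia.
Qed.

Lemma order_ge_1 (f : C -> C) (z : C) : holo_ball f 0 1 -> in_disc z -> f z = 0 -> order_ge f z 1.
Proof.
  intros Hf Hz E. destruct (Hf z) as [l Hl]; [replace (z - 0)%C with z by ring; exact Hz|].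
  destruct (Hl 1 Rlt_0_1) as [d [Hd H]]. exists (1 + Cmod l), d. split; [exact Hd|].
  intros h Hh. specialize (H (z + h)%C). replace (z + h - z)%C with h in H by ring.
  specialize (H Hh). rewrite E in H.
  replace (f (z + h)%C) with ((f (z + h) - 0 - l * h) + l * h)%C by ring.
  eapply Rle_trans; [apply Cmod_triangle|]. rewrite Cmod_mult. simpl. lra.
Qed.

(** Lists of indices replace exact multiplicities: the condition is inherited by smaller [P], and
    each instance involves finitely many indices, which is what passing to finite parts requires. *)
Definition vanishes_at_indices (f : C -> C) (P : nat -> Prop) (p : nat -> C) : Prop :=
  forall (z : C) (l : list nat), in_disc z -> NoDup l ->
    (forall i, In i l -> P i /\ p i = z) -> order_ge f z (length l).

Lemma vanishes_on_enumerates (f : C -> C) (T : disc_seq) (P : nat -> Prop) (p : nat -> C)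
  (e : nat -> nat) : holo_ball f 0 1 -> admissible P p -> enumerates T P p e ->
  (vanishes_on f T <-> vanishes_at_indices f P p).
Proof.
  intros Hf Had HT.
  assert (Hiff : forall z k, in_disc z -> (zero_mult_ge f z k <-> order_ge f z k)).
  { intros z k Hz. unfold in_disc in Hz. apply (zero_mult_ge_order f z (1 - Cmod z)); [lra|].
    apply holo_ball_inner, Hf. }
  split.
  - intros H z l Hz Nl Hl. destruct l as [|i l']; [apply order_ge_0; assumption|].
    destruct (has_mult_exists P p z Had) as [k Hk].
    apply order_ge_mono with k.
    + destruct Hk as [m [_ [<- Hm]]]. apply NoDup_incl_length; [exact Nl|].
      intros j Hj. apply Hm, Hl, Hj.
    + apply (Hiff z k Hz). apply H.
      * apply (occurs_enumerates T P p e z HT). exists i. apply Hl. left. reflexivity.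
      * apply (repeated_enumerates T P p e z k HT), Hk.
  - intros H z k Ho Hr. apply (occurs_enumerates T P p e z HT) in Ho.
    assert (Hz : in_disc z) by (destruct Ho as [i [Hi <-]]; apply Had, Hi).
    apply (repeated_enumerates T P p e z k HT) in Hr. destruct Hr as [l [N1 [<- N3]]].
    apply (Hiff _ _ Hz). apply H; [exact Hz|exact N1|]. intros i Hi. apply N3, Hi.
Qed.

(** * Zero sets *)

Lemma rational_approx (x : R) (m : nat) : exists a b : nat,
  Rabs ((INR a - INR b) / (INR m + 1) - x) <= / (INR m + 1).
Proof.
  pose proof (pos_INR m) as Pm.
  destruct (archimed (x * (INR m + 1))) as [A1 A2].
  set (k := up (x * (INR m + 1))) in *.
  exists (Z.to_nat k), (Z.to_nat (- k)).
  assert (E : INR (Z.to_nat k) - INR (Z.to_nat (- k)) = IZR k).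
  { rewrite !INR_IZR_INZ, <- minus_IZR. f_equal. lia. }
  rewrite E.
  replace (IZR k / (INR m + 1) - x) with ((IZR k - x * (INR m + 1)) * / (INR m + 1)) by (field; lra).
  pose proof (inv_INR_pos m).
  rewrite Rabs_pos_eq by (apply Rmult_le_pos; lra).
  rewrite <- (Rmult_1_l (/ (INR m + 1))) at 2. apply Rmult_le_compat_r; lra.
Qed.

(** Cantor codes of a denominator and two integers, each integer being written as a difference of
    natural numbers. *)
Lemma countable_dense : exists q : nat -> C, forall (z : C) (eps : R), 0 < eps ->
  exists n, Cmod (q n - z) < eps.
Proof.
  exists (fun n => let (m, n1) := Cantor.of_nat n in
    let (n2, n3) := Cantor.of_nat n1 in
    let (a, b) := Cantor.of_nat n2 in let (c, d) := Cantor.of_nat n3 in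
    ((INR a - INR b) / (INR m + 1), (INR c - INR d) / (INR m + 1))).
  intros z eps Heps.
  destruct (archimed_inv (eps / 2) ltac:(lra)) as [m Hm].
  destruct (rational_approx (Re z) m) as [a [b H1]].
  destruct (rational_approx (Im z) m) as [c [d H2]].
  exists (Cantor.to_nat (m, Cantor.to_nat (Cantor.to_nat (a, b), Cantor.to_nat (c, d)))).
  rewrite !Cantor.cancel_of_to.
  set (u := (INR a - INR b) / (INR m + 1)) in *. set (v := (INR c - INR d) / (INR m + 1)) in *.
  replace ((u, v) - z)%C with (RtoC (u - Re z) + Ci * RtoC (v - Im z))%C
    by (destruct z; apply C_eq_Re_Im; simpl; ring).
  eapply Rle_lt_trans; [apply Cmod_triangle|]. rewrite Cmod_mult, !Cmod_R, Cmod_Ci. lra.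
Qed.

(** An isolated zero is named by the least code of a rational ball in which it is the only
    zero. *)
Lemma zeros_countable (f : C -> C) : holo_ball f 0 1 ->
  (forall z, in_disc z -> exists N, ~ order_ge f z N) ->
  exists (A : nat -> Prop) (q : nat -> C),
    (forall c, A c -> in_disc (q c)) /\
    (forall c c', A c -> A c' -> q c = q c' -> c = c') /\
    (forall z, in_disc z -> f z = 0 -> exists c, A c /\ q c = z).
Proof.
  intros Hf Hfin.
  destruct countable_dense as [d Hd].
  (* [c] codes a centre from the dense sequence and a radius [1 / (m + 1)]. *)
  set (ball_of := fun (c : nat) (w : C) =>
    Cmod (w - d (fst (Cantor.of_nat c))) < / (INR (snd (Cantor.of_nat c)) + 1)).
  set (isolates := fun (c : nat) (z : C) => in_disc z /\ f z = 0 /\ ball_of c z /\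
    forall w, in_disc w -> f w = 0 -> ball_of c w -> w = z).
  assert (Hcode : forall z, in_disc z -> f z = 0 -> exists c, isolates c z).
  { intros z Hz Ez. destruct (Hfin z Hz) as [N HN]. unfold in_disc in Hz.
    destruct (isolated_zero f z (1 - Cmod z) N ltac:(lra) (holo_ball_inner f z Hf) HN) as [r [Hr Hiso]].
    destruct (archimed_inv (r / 2) ltac:(lra)) as [m Hm].
    (* The ball about [d n] has radius below [r / 2] and contains [z], so its points are within [r]
       of [z]. *)
    destruct (Hd z (/ (INR m + 1)) (inv_INR_pos m)) as [n Hn].
    exists (Cantor.to_nat (n, m)). unfold isolates, ball_of. rewrite Cantor.cancel_of_to. simpl.
    split; [exact Hz|]. split; [exact Ez|]. split.
    { replace (z - d n)%C with (- (d n - z))%C by ring. rewrite Cmod_opp. exact Hn. }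
    intros w Hw Ew Hball. apply NNPP. intros Hne.
    apply (Hiso (w - z)%C).
    - split.
      + apply Cmod_gt_0. intros E. apply Hne. replace w with ((w - z) + z)%C by ring. rewrite E. ring.
      + replace (w - z)%C with ((w - d n) + (d n - z))%C by ring.
        eapply Rle_lt_trans; [apply Cmod_triangle|]. lra.
    - replace (z + (w - z))%C with w by ring. exact Ew. }
  (* Minimality makes the code of a zero unique, so no zero is listed twice. *)
  set (least := fun c z => isolates c z /\ forall c', isolates c' z -> (c <= c')%nat).
  assert (Hleast : forall z, in_disc z -> f z = 0 -> exists c, least c z).
  { intros z Hz Ez. destruct (Hcode z Hz Ez) as [c Hc]. revert Hc.
    induction c as [c IH] using (well_founded_induction Wf_nat.lt_wf). intros Hc.
    destruct (classic (exists c', (c' < c)%nat /\ isolates c' z)) as [[c' [L Hc']]|H].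
    - apply (IH c' L Hc').
    - exists c. split; [exact Hc|]. intros c' Hc'. apply Nat.nlt_ge. intros L. apply H.
      exists c'. split; assumption. }
  assert (Huniq : forall c z w, isolates c z -> isolates c w -> z = w).
  { intros c z w [Hz [Ez [Bz _]]] [_ [_ [_ H]]]. apply H; assumption. }
  destruct (choice (fun c z => (exists z', least c z') -> least c z)) as [q Hq].
  { intros c. destruct (classic (exists z', least c z')) as [[z' Hz']|H].
    - exists z'. intros _. exact Hz'.
    - exists 0. tauto. }
  exists (fun c => exists z, least c z), q. split; [|split].
  - intros c Hc. apply (Hq c Hc).
  - intros c c' Hc Hc' E. apply Hq in Hc. apply Hq in Hc'. rewrite E in Hc.
    apply Nat.le_antisymm; [apply Hc, Hc'|apply Hc', Hc].
  - intros z Hz Ez. destruct (Hleast z Hz Ez) as [c Hc].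
    assert (Ac : exists z, least c z) by (exists z; exact Hc).
    exists c. split; [exact Ac|]. apply (Huniq c); [apply (Hq c Ac)|apply Hc].
Qed.

(** The index [i] codes a pair [(c, r)] and stands for the [r]-th copy of the point [q c]. *)
Definition block_index (A : nat -> Prop) (q : nat -> C) (mu : C -> nat) (i : nat) : Prop :=
  A (fst (Cantor.of_nat i)) /\ (snd (Cantor.of_nat i) < mu (q (fst (Cantor.of_nat i))))%nat.

Definition block_point (q : nat -> C) (i : nat) : C := q (fst (Cantor.of_nat i)).

(** The indices at [z] are the pairs of its unique code and a copy number below [mu z]. *)
Lemma block_has_mult (A : nat -> Prop) (q : nat -> C) (mu : C -> nat) :
  (forall c c', A c -> A c' -> q c = q c' -> c = c') ->
  (forall z, (0 < mu z)%nat -> exists c, A c /\ q c = z) ->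
  forall z, has_mult (block_index A q mu) (block_point q) z (mu z).
Proof.
  intros Hinj Hcov z. destruct (Nat.eq_dec (mu z) 0) as [E|E].
  - exists nil. rewrite E. repeat split; try constructor; simpl; try tauto.
    intros [[_ H] Hz]. unfold block_point in Hz. rewrite Hz, E in H. lia.
  - destruct (Hcov z ltac:(lia)) as [c [Hc <-]].
    exists (map (fun r => Cantor.to_nat (c, r)) (seq 0 (mu (q c)))). split; [|split].
    + apply NoDup_map_NoDup_ForallPairs; [|apply seq_NoDup].
      intros i j _ _ H. apply (f_equal Cantor.of_nat) in H.
      rewrite !Cantor.cancel_of_to in H. congruence.
    + rewrite length_map, length_seq. reflexivity.
    + intros i. rewrite in_map_iff. unfold block_index, block_point. split.
      * intros [r [<- Hr]]. rewrite Cantor.cancel_of_to. simpl.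
        apply in_seq in Hr. repeat split; [exact Hc|lia].
      * intros [[H1 H2] H3]. exists (snd (Cantor.of_nat i)).
        rewrite <- (Hinj _ _ H1 Hc H3). rewrite <- surjective_pairing, Cantor.cancel_to_of.
        split; [reflexivity|]. apply in_seq. lia.
Qed.

(** [T] need not follow the order in which the zero sequence [Z] of [ev b] is listed. The
    subsequence [U] of [Z] with the multiplicities of [T] is a zero set by [hsub], and vanishing
    exactly depends only on multiplicities, so the element found for [U] serves for [T]. *)
Lemma zero_set_of_vanishing (B : CompleteNormedModule C_AbsRing) (ev : B -> C -> C)
  (hsub : forall S T : disc_seq, zero_set B ev S -> subseq T S -> zero_set B ev T)
  (b : B) (T : disc_seq) (P : nat -> Prop) (p : nat -> C) (e : nat -> nat) :
  holo_ball (ev b) 0 1 -> (exists w, in_disc w /\ ev b w <> 0) ->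
  admissible P p -> enumerates T P p e -> vanishes_at_indices (ev b) P p ->
  zero_set B ev T.
Proof.
  intros Hf [w0 [Hw0 Ew0]] Had HT Hv. set (f := ev b) in *.
  assert (Hfin : forall z, in_disc z -> exists N, ~ order_ge f z N).
  { intros z Hz. apply NNPP. intros H. apply Ew0. apply (infinite_order_zero f z Hf Hz); [|exact Hw0].
    intros N. apply NNPP. intros HN. apply H. exists N. exact HN. }
  destruct (zeros_countable f Hf Hfin) as [A [q [A1 [A2 A3]]]].
  (* The order of the zero at [z], set to 0 outside the disc so that [0 < mu z] places [z] in the
     disc. *)
  destruct (choice (fun z m => (in_disc z -> order_ge f z m /\ ~ order_ge f z (S m)) /\
     (~ in_disc z -> m = 0%nat))) as [mu Hmu].
  { intros z. destruct (classic (in_disc z)) as [Hz|Hz]; [|exists 0%nat; tauto].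
    destruct (Hfin z Hz) as [N HN].
    assert (X : exists m, order_ge f z m /\ ~ order_ge f z (S m)).
    { induction N as [|N IH].
      - exfalso. apply HN. apply order_ge_0; assumption.
      - destruct (classic (order_ge f z N)) as [HN'|HN']; [|apply IH, HN'].
        exists N. split; assumption. }
    destruct X as [m Hm]. exists m. split; [intros _; exact Hm|tauto]. }
  destruct (choice (fun z k => has_mult P p z k)) as [tau Htau].
  { intros z. apply has_mult_exists, Had. }
  assert (Hcov : forall z, (0 < mu z)%nat -> exists c, A c /\ q c = z).
  { intros z Hz. destruct (Hmu z) as [M1 M2].
    assert (Dz : in_disc z) by (apply NNPP; intros H; specialize (M2 H); lia).
    apply A3; [exact Dz|]. destruct (M1 Dz) as [[K [d [Hd H]]] _].
    specialize (H 0). rewrite Cmod_0 in H. specialize (H Hd).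
    rewrite Cplus_0_r, pow_ne_zero, Rmult_0_r in H by lia.
    apply Cmod_eq_0. apply Rle_antisym; [exact H|apply Cmod_ge_0]. }
  assert (Hle : forall z, (tau z <= mu z)%nat).
  { intros z. destruct (Nat.eq_dec (tau z) 0) as [E|E]; [lia|].
    destruct (proj2 (occurs_has_mult P p z (tau z) (Htau z)) ltac:(lia)) as [i [Hi <-]].
    pose proof (proj1 Had i Hi) as Dz. destruct (Hmu (p i)) as [M1 _].
    apply Nat.nlt_ge. intros L. apply (proj2 (M1 Dz)).
    apply order_ge_mono with (tau (p i)); [lia|].
    destruct (Htau (p i)) as [l [N1 [<- N3]]]. apply Hv; [exact Dz|exact N1|].
    intros j Hj. apply N3, Hj. }
  (* Stated for any multiplicity function below [mu], as it yields both [Z] and [U]. *)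
  assert (Hadm : forall nu : C -> nat, (forall z, (nu z <= mu z)%nat) ->
    admissible (block_index A q nu) (block_point q) /\
    forall z, has_mult (block_index A q nu) (block_point q) z (nu z)).
  { intros nu Hnu.
    assert (H : forall z, has_mult (block_index A q nu) (block_point q) z (nu z)).
    { apply block_has_mult; [exact A2|]. intros z Hz. apply Hcov. specialize (Hnu z). lia. }
    split; [|exact H]. split.
    - intros i [Hi _]. apply A1, Hi.
    - intros z. destruct (H z) as [l [_ [_ Hl]]]. exists l. intros i Hi Hz. apply Hl. split; assumption. }
  destruct (Hadm mu (fun z => le_n _)) as [Mu1 Mu2].
  destruct (Hadm tau Hle) as [Tau1 Tau2].
  destruct (enumerates_exists _ _ Mu1) as [Z [eZ [HZ _]]].
  destruct (enumerates_exists _ _ Tau1) as [U [eU [HU _]]].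
  assert (ZS : zero_set B ev Z).
  { exists b. fold f. split.
    - intros z k Ho Hr.
      apply (repeated_enumerates _ _ _ _ z k HZ) in Hr.
      rewrite (has_mult_unique _ _ _ _ _ Hr (Mu2 z)).
      apply (occurs_enumerates _ _ _ _ z HZ) in Ho. destruct Ho as [i [Hi <-]].
      pose proof (proj1 Mu1 i Hi) as Dz. destruct (Hmu (block_point q i)) as [M1 _].
      pose proof Dz as Dz'. unfold in_disc in Dz'.
      apply (zero_mult_eq_order f _ (1 - Cmod (block_point q i))); [lra|apply holo_ball_inner, Hf| |];
        apply M1, Dz.
    - intros z Hz Hno E. apply Hno. apply (occurs_enumerates _ _ _ _ z HZ).
      apply (occurs_has_mult _ _ _ _ (Mu2 z)).
      destruct (Nat.eq_dec (mu z) 0) as [E0|E0]; [|lia]. exfalso.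
      destruct (Hmu z) as [M1 _]. apply (proj2 (M1 Hz)). rewrite E0. apply order_ge_1; assumption. }
  assert (US : zero_set B ev U).
  { apply (hsub Z U ZS). eapply subseq_enumerates; [exact HU|exact HZ|].
    intros i [H1 H2]. split; [exact H1|]. specialize (Hle (q (fst (Cantor.of_nat i)))). lia. }
  destruct US as [b' [V1 V2]]. exists b'.
  assert (Hocc : forall z, occurs z T <-> occurs z U).
  { intros z. rewrite (occurs_enumerates _ _ _ _ z HT), (occurs_enumerates _ _ _ _ z HU).
    rewrite (occurs_has_mult _ _ _ _ (Htau z)), (occurs_has_mult _ _ _ _ (Tau2 z)). reflexivity. }
  split.
  - intros z k Ho Hr. apply V1; [apply Hocc, Ho|].
    apply (repeated_enumerates _ _ _ _ z k HT) in Hr.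
    rewrite (has_mult_unique _ _ _ _ _ Hr (Htau z)).
    apply (repeated_enumerates _ _ _ _ z _ HU), Tau2.
  - intros z Hz Hno. apply V2; [exact Hz|]. intros H. apply Hno, Hocc, H.
Qed.

(** * Concentration at a boundary point *)

Lemma enumerates_self (S : disc_seq) : enumerates S (in_dom (len S)) (pt S) (fun k => k).
Proof.
  split; [|split].
  - intros k Hk. split; [exact Hk|reflexivity].
  - intros k k' _ _ H. exact H.
  - intros i Hi. exists i. split; [exact Hi|reflexivity].
Qed.

Lemma admissible_subset (S : disc_seq) (P : nat -> Prop) :
  (forall i, P i -> in_dom (len S) i) -> admissible P (pt S).
Proof.
  intros H. split.
  - intros i Hi. apply pt_disc, H, Hi.
  - intros z. destruct (pt_finite_rep S z) as [l Hl]. exists l. intros i Hi. apply Hl, H, Hi.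
Qed.

(** The origin is tested: if it does not occur in [T] the value there is nonzero, and if it does,
    its exact multiplicity yields a nonzero value nearby. *)
Lemma vanishes_exactly_nonzero (f : C -> C) (T : disc_seq) :
  vanishes_exactly_on f T -> exists w, in_disc w /\ f w <> 0.
Proof.
  intros [H1 H2]. assert (D0 : in_disc 0) by (unfold in_disc; rewrite Cmod_0; lra).
  destruct (classic (occurs 0 T)) as [Ho|Hno]; [|exists 0; split; [exact D0|apply H2; assumption]].
  destruct (has_mult_exists _ _ 0 (admissible_subset T _ (fun i Hi => Hi))) as [k Hk].
  apply (repeated_enumerates T _ _ _ 0 k (enumerates_self T)) in Hk.
  destruct (zero_mult_eq_nonzero f 0 1 k Rlt_0_1 (H1 0 k Ho Hk)) as [w [Hw Ew]].
  exists w. split; [|exact Ew]. unfold in_disc. replace w with (w - 0)%C by ring. exact Hw.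
Qed.

Lemma embedding_zero (B : CompleteNormedModule C_AbsRing) (ev : B -> C -> C) (z : C) :
  analytic_embedding B ev -> in_disc z -> ev zero z = 0.
Proof.
  intros hB Hz. exact (linear_zero _ (ev_cont B ev hB z Hz)).
Qed.

Lemma zero_set_vanishing (B : CompleteNormedModule C_AbsRing) (ev : B -> C -> C)
  (T : disc_seq) (P : nat -> Prop) (p : nat -> C) (e : nat -> nat) :
  analytic_embedding B ev -> admissible P p -> enumerates T P p e -> zero_set B ev T ->
  exists b, b <> zero /\ vanishes_at_indices (ev b) P p.
Proof.
  intros hB Had HT [b Hb]. exists b. split.
  - intros ->. destruct (vanishes_exactly_nonzero _ _ Hb) as [w [Hw Ew]].
    apply Ew, embedding_zero; assumption.
  - apply (vanishes_on_enumerates (ev b) T P p e); try assumption.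
    + apply holo_disc_ball, hB.
    + intros z k Ho Hr. destruct (proj1 Hb z k Ho Hr) as [g [Hg _]]. exists g. exact Hg.
Qed.

Lemma embedding_nonzero (B : CompleteNormedModule C_AbsRing) (ev : B -> C -> C) (b : B) :
  analytic_embedding B ev -> b <> zero -> exists w, in_disc w /\ ev b w <> 0.
Proof.
  intros hB Hb. apply NNPP. intros H. apply Hb. apply (ev_inj B ev hB). intros z Hz.
  rewrite (embedding_zero B ev z hB Hz). apply NNPP. intros E. apply H. exists z. split; assumption.
Qed.

Lemma vanishes_at_indices_subset (f : C -> C) (P Q : nat -> Prop) (p : nat -> C) :
  (forall i, Q i -> P i) -> vanishes_at_indices f P p -> vanishes_at_indices f Q p.
Proof.
  intros HQ H z l Hz Nl Hl. apply H; [exact Hz|exact Nl|]. intros i Hi.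
  destruct (Hl i Hi). split; [apply HQ; assumption|assumption].
Qed.

Lemma union_vanishing (B : CompleteNormedModule C_AbsRing) (ev : B -> C -> C)
  (hB : analytic_embedding B ev)
  (hsub : forall S T : disc_seq, zero_set B ev S -> subseq T S -> zero_set B ev T)
  (hunion : forall (Ts : list disc_seq) (U : disc_seq),
     List.Forall (zero_set B ev) Ts -> is_union Ts U -> zero_set B ev U)
  (P Q R : nat -> Prop) (p : nat -> C) :
  admissible R p -> (forall i, R i <-> P i \/ Q i) ->
  (exists b, b <> zero /\ vanishes_at_indices (ev b) P p) ->
  (exists b, b <> zero /\ vanishes_at_indices (ev b) Q p) ->
  exists b, b <> zero /\ vanishes_at_indices (ev b) R p.
Proof.
  intros Had HR [b1 [N1 V1]] [b2 [N2 V2]].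
  (* [is_union] adds multiplicities, so indices common to [P] and [Q] must be counted only once. *)
  set (Q' := fun i => Q i /\ ~ P i).
  assert (Sub : forall P', (forall i, P' i -> R i) -> admissible P' p).
  { intros P' H. split; [intros i Hi; apply Had, H, Hi|].
    intros z. destruct (proj2 Had z) as [l Hl]. exists l. intros i Hi. apply Hl, H, Hi. }
  assert (AP : admissible P p) by (apply Sub; intros i Hi; apply HR; left; exact Hi).
  assert (AQ : admissible Q' p) by (apply Sub; intros i Hi; apply HR; right; apply Hi).
  destruct (enumerates_exists P p AP) as [T1 [e1 [E1 _]]].
  destruct (enumerates_exists Q' p AQ) as [T2 [e2 [E2 _]]].
  destruct (enumerates_exists R p Had) as [U [e [E _]]].
  apply (zero_set_vanishing B ev U R p e hB Had E).
  apply (hunion (T1 :: T2 :: nil)).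
  - constructor; [|constructor; [|constructor]].
    + apply (zero_set_of_vanishing B ev hsub b1 T1 P p e1); try assumption.
      * apply holo_disc_ball, hB.
      * apply embedding_nonzero; assumption.
    + apply (zero_set_of_vanishing B ev hsub b2 T2 Q' p e2); try assumption.
      * apply holo_disc_ball, hB.
      * apply embedding_nonzero; assumption.
      * apply (vanishes_at_indices_subset _ Q); [intros i Hi; apply Hi|exact V2].
  - intros z ks Hks.
    inversion Hks as [|? k1 ? ? R1 Hks1]; subst. inversion Hks1 as [|? k2 ? ? R2 Hks2]; subst.
    inversion Hks2; subst. simpl. rewrite Nat.add_0_r.
    apply (repeated_enumerates _ _ _ _ z k1 E1) in R1.
    apply (repeated_enumerates _ _ _ _ z k2 E2) in R2.
    apply (repeated_enumerates _ _ _ _ z _ E).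
    destruct R1 as [l1 [M1 [<- L1]]]. destruct R2 as [l2 [M2 [<- L2]]].
    exists (l1 ++ l2). split; [|split].
    + apply NoDup_app; [exact M1|exact M2|]. intros i H1 H2.
      apply L1 in H1. apply L2 in H2. apply H2, H1.
    + apply length_app.
    + intros i. rewrite in_app_iff, L1, L2, HR. unfold Q'. split; [tauto|].
      destruct (classic (P i)); tauto.
Qed.

Lemma finite_vanishing (B : CompleteNormedModule C_AbsRing) (ev : B -> C -> C)
  (hB : analytic_embedding B ev)
  (hfin : forall S : disc_seq, finite_seq S -> zero_set B ev S)
  (P : nat -> Prop) (p : nat -> C) (N : nat) :
  admissible P p -> (forall i, P i -> (i < N)%nat) ->
  exists b, b <> zero /\ vanishes_at_indices (ev b) P p.
Proof.
  intros Had HN. destruct (enumerates_exists P p Had) as [T [e [E F]]].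
  apply (zero_set_vanishing B ev T P p e hB Had E). apply hfin. apply F. exists N. exact HN.
Qed.

(** Uniform boundedness of the evaluations at the points of the closed disc; each [ev b] is bounded
    there, which is the pointwise hypothesis. *)
Lemma embedding_locally_bounded (B : CompleteNormedModule C_AbsRing) (ev : B -> C -> C) :
  analytic_embedding B ev -> forall rho, rho < 1 -> exists M, 0 <= M /\
  forall (b : B) z, Cmod z <= rho -> Cmod (ev b z) <= M * norm b.
Proof.
  intros hB rho Hrho.
  destruct (uniform_boundedness (I := {z : C | Cmod z <= rho}) B (fun i b => ev b (proj1_sig i)))
    as [M [PM HM]].
  - intros [z Hz]. apply (ev_cont B ev hB). unfold in_disc. simpl. lra.
  (* [rho] may be nonpositive, whereas [holo_ball_bounded] asks for a positive radius. *)
  - intros b. pose proof (Rmax_l rho (1 / 2)). pose proof (Rmax_r rho (1 / 2)).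
    destruct (holo_ball_bounded (ev b) 0 (Rmax rho (1 / 2)) 1) as [K HK].
    + apply holo_disc_ball, hB.
    + split; [lra|apply Rmax_lub_lt; lra].
    + exists K. intros [z Hz]. apply HK. simpl. replace (z - 0)%C with z by ring. lra.
  - exists M. split; [exact PM|]. intros b z Hz. apply (HM (exist _ z Hz) b).
Qed.

(** Normal families and the Fatou property: if no finite part of [P] worked, extremal
    elements for longer and longer parts would converge to a nonzero element vanishing on [P]. *)
Lemma finite_part_bound (B : CompleteNormedModule C_AbsRing) (ev : B -> C -> C)
  (hB : analytic_embedding B ev) (hfatou : fatou_property B ev)
  (P : nat -> Prop) (p : nat -> C) (K eps : R) (a : C) :
  (forall b, vanishes_at_indices (ev b) P p -> b = zero) ->
  in_disc a -> 0 < eps ->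
  exists m, forall b, norm b <= K -> vanishes_at_indices (ev b) (fun i => P i /\ (i < m)%nat) p ->
    Cmod (ev b a) <= eps.
Proof.
  intros Huniq Ha Heps. apply NNPP. intros HN.
  destruct (choice (fun m b => norm b <= K /\
    vanishes_at_indices (ev b) (fun i => P i /\ (i < m)%nat) p /\ eps < Cmod (ev b a))) as [b Hb].
  { intros m. apply NNPP. intros H. apply HN. exists m. intros b H1 H2.
    apply Rnot_lt_le. intros H3. apply H. exists b. auto. }
  destruct (choice (fun rho M => rho < 1 -> 0 <= M /\
    forall (b : B) z, Cmod z <= rho -> Cmod (ev b z) <= M * norm b)) as [M HM].
  { intros rho. destruct (Rlt_dec rho 1) as [H|H]; [|exists 0; lra].
    destruct (embedding_locally_bounded B ev hB rho H) as [M HM]. exists M. intros _. exact HM. }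
  assert (Hholo : forall n, holo_ball (ev (b n)) 0 1) by (intros n; apply holo_disc_ball, hB).
  assert (Hbound : forall rho n z, rho < 1 -> Cmod z <= rho -> Cmod (ev (b n) z) <= M rho * K).
  { intros rho n z Hrho Hz. destruct (HM rho Hrho) as [H1 H2].
    eapply Rle_trans; [apply H2, Hz|]. apply Rmult_le_compat_l; [exact H1|apply Hb]. }
  destruct (montel (fun n => ev (b n)) (fun rho => M rho * K) Hholo Hbound) as [f [phi [Hphi [Hf Hcv]]]].
  pose proof (increasing_ge_id phi Hphi) as Hid.
  destruct (hfatou (fun n => b (phi n)) f) as [c [Hc _]].
  { exists K. intros n. apply Hb. }
  { apply holo_disc_ball, Hf. }
  { intros z Hz. unfold in_disc in Hz.
    assert (Hd : 0 < (1 - Cmod z) / 2) by lra.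
    exists (mkposreal _ Hd). intros e. simpl.
    destruct (Hcv (Cmod z + (1 - Cmod z) / 2) ltac:(lra) e (cond_pos e)) as [N HNe].
    exists N. intros n Hn w _ Hw. apply HNe; [exact Hn|].
    replace w with ((w - z) + z)%C by ring. eapply Rle_trans; [apply Cmod_triangle|]. lra. }
  assert (Hconv : forall z, in_disc z -> Cconv (fun n => ev (b (phi n)) z) (ev c z)).
  { intros z Hz e He. unfold in_disc in Hz. rewrite (Hc z Hz).
    destruct (Hcv (Cmod z) Hz e He) as [N HNe]. exists N. intros n Hn. apply HNe; [exact Hn|lra]. }
  assert (Zc : c = zero).
  { apply Huniq. intros z l Hz Nl Hl. unfold in_disc in Hz.
    set (r := 1 - Cmod z).
    assert (Hsub : forall w s, Cmod (w - z) <= s -> Cmod w <= Cmod z + s).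
    { intros w s Hw. replace w with ((w - z) + z)%C by ring.
      eapply Rle_trans; [apply Cmod_triangle|]. lra. }
    (* The indices of a list lie below some [n0]; from [n0] on the elements vanish on it, because
       [n <= phi n]. *)
    assert (Hmax : exists n0, forall i, In i l -> (i < n0)%nat).
    { exists (S (list_max l)). intros i Hi.
      pose proof (proj1 (list_max_le l (list_max l)) (le_n _)) as H.
      rewrite Forall_forall in H. specialize (H i Hi). lia. }
    destruct Hmax as [n0 Hn0].
    apply (order_ge_limit (fun n => ev (b (phi n))) (ev c) z (r / 2) r (M (Cmod z + r / 2) * K) (length l) n0).
    - unfold r. lra.
    - intros n. apply holo_ball_inner, Hholo.
    - intros n w Hw. apply Hbound; [unfold r; lra|]. apply Hsub. lra.
    - intros w Hw. apply Hconv. unfold in_disc, r in *. specialize (Hsub w (Cmod (w - z)) ltac:(lra)). lra.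
    - intros n Hn. destruct (Hb (phi n)) as [_ [Hv _]]. apply Hv; [exact Hz|exact Nl|].
      intros i Hi. destruct (Hl i Hi) as [Q1 Q2]. specialize (Hn0 i Hi). specialize (Hid n).
      repeat split; [exact Q1|lia|exact Q2]. }
  (* At [a] the values tend to 0 although they all exceed [eps] in modulus. *)
  destruct (Hconv a Ha eps Heps) as [N HNa]. specialize (HNa N (le_n N)). cbv beta in HNa.
  rewrite Zc, (embedding_zero B ev a hB Ha) in HNa.
  replace (ev (b (phi N)) a - 0)%C with (ev (b (phi N)) a) in HNa by ring.
  destruct (Hb (phi N)) as [_ [_ H]]. lra.
Qed.

Lemma nat_bound (m : nat -> nat) (n : nat) : exists K, forall k, (k < n)%nat -> (m k <= K)%nat.
Proof.
  induction n as [|n [K HK]]; [exists 0%nat; lia|].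
  exists (K + m n)%nat. intros k Hk. destruct (Nat.eq_dec k n) as [->|Hne]; [lia|].
  specialize (HK k ltac:(lia)). lia.
Qed.

Lemma vanishing_concentration (B : CompleteNormedModule C_AbsRing) (ev : B -> C -> C)
  (hB : analytic_embedding B ev)
  (hsub : forall S T : disc_seq, zero_set B ev S -> subseq T S -> zero_set B ev T)
  (hunion : forall (Ts : list disc_seq) (U : disc_seq),
     List.Forall (zero_set B ev) Ts -> is_union Ts U -> zero_set B ev U)
  (S : disc_seq) (huniq : uniqueness_set B ev S) :
  exists w, forall d b, 0 < d ->
    vanishes_at_indices (ev b) (fun i => in_dom (len S) i /\ Cmod (pt S i - w) < d) (pt S) ->
    b = zero.
Proof.
  (* [bad A] says that the restriction of [S] to [A] is not a set of uniqueness; it passes to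
     smaller regions and to unions of two, and fails for the whole plane. *)
  set (bad := fun A : C -> Prop => exists b, b <> zero /\
    vanishes_at_indices (ev b) (fun i => in_dom (len S) i /\ A (pt S i)) (pt S)).
  assert (Hadm : forall A : C -> Prop, admissible (fun i => in_dom (len S) i /\ A (pt S i)) (pt S)).
  { intros A. apply admissible_subset. tauto. }
  assert (bad_sub : forall A A' : C -> Prop, (forall z, in_disc z -> A' z -> A z) -> bad A -> bad A').
  { intros A A' H [b [Nb Vb]]. exists b. split; [exact Nb|].
    apply (vanishes_at_indices_subset _ (fun i => in_dom (len S) i /\ A (pt S i))); [|exact Vb].
    intros i [H1 H2]. split; [exact H1|]. apply H; [apply pt_disc, H1|exact H2]. }
  assert (bad_union : forall A A', bad A -> bad A' -> bad (fun z => A z \/ A' z)).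
  { intros A A' H H'.
    apply (union_vanishing B ev hB hsub hunion
      (fun i => in_dom (len S) i /\ A (pt S i)) (fun i => in_dom (len S) i /\ A' (pt S i)));
      [apply (Hadm (fun z => A z \/ A' z))| |exact H|exact H'].
    intros i. tauto. }
  assert (Hfull : ~ bad (fun _ => True)).
  { intros [b [Nb Vb]]. apply Nb. apply huniq.
    apply (vanishes_on_enumerates (ev b) S (in_dom (len S)) (pt S) (fun k => k)).
    - apply holo_disc_ball, hB.
    - apply admissible_subset. trivial.
    - apply enumerates_self.
    - refine (vanishes_at_indices_subset _ _ _ _ _ Vb). tauto. }
  apply NNPP. intros HN.
  assert (Hloc : forall w, exists d, 0 < d /\ bad (fun z => Cmod (z - w) < d)).
  { intros w. apply NNPP. intros H. apply HN. exists w. intros d b Hd Hb.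
    apply NNPP. intros Nb. apply H. exists d. split; [exact Hd|]. exists b. split; [exact Nb|exact Hb]. }
  apply Hfull.
  apply (bad_sub (fun z => (-1 <= Re z <= -1 + 2) /\ (-1 <= Im z <= -1 + 2))).
  { intros z Hz _. unfold in_disc in Hz. pose proof (Rmax_Cmod z) as T.
    pose proof (Rmax_l (Rabs (fst z)) (Rabs (snd z))). pose proof (Rmax_r (Rabs (fst z)) (Rabs (snd z))).
    assert (T1 : Rabs (fst z) <= 1) by lra. assert (T2 : Rabs (snd z) <= 1) by lra.
    apply Rabs_le_between in T1. apply Rabs_le_between in T2. unfold Re, Im. lra. }
  apply (square_bisection (fun x y h => bad (fun z => (x <= Re z <= x + h) /\ (y <= Im z <= y + h)))); [lra| |].
  - intros x y h Hh B1 B2 B3 B4.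
    pose proof (bad_union _ _ (bad_union _ _ B1 B2) (bad_union _ _ B3 B4)) as BU.
    eapply bad_sub; [|exact BU]. cbv beta. intros z _ [Hx Hy].
    destruct (Rle_dec (Re z) (x + h / 2)); destruct (Rle_dec (Im z) (y + h / 2)).
    + left. left. lra.
    + right. left. lra.
    + left. right. lra.
    + right. right. lra.
  - intros u v _ _. destruct (Hloc (u, v)) as [d [Hd Hbad]].
    (* A square of side [h < d / 2] containing [(u, v)] lies within [2 * h] of it. *)
    exists (d / 2). split; [lra|]. intros x y h Hh Hu Hv.
    eapply bad_sub; [|exact Hbad]. cbv beta. intros z _ [Hx Hy].
    replace (z - (u, v))%C with (RtoC (Re z - u) + Ci * RtoC (Im z - v))%C
      by (destruct z; apply C_eq_Re_Im; simpl; ring).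
    eapply Rle_lt_trans; [apply Cmod_triangle|]. rewrite Cmod_mult, !Cmod_R, Cmod_Ci.
    assert (Rabs (Re z - u) <= h) by (apply Rabs_le; lra).
    assert (Rabs (Im z - v) <= h) by (apply Rabs_le; lra). lra.
Qed.

Theorem theorem2p5 (B : CompleteNormedModule C_AbsRing) (ev : B -> C -> C)
  (hB : analytic_embedding B ev)
  (hfatou : fatou_property B ev)
  (hsub : forall S T : disc_seq,
     zero_set B ev S -> subseq T S -> zero_set B ev T)
  (hunion : forall (Ts : list disc_seq) (U : disc_seq),
     List.Forall (zero_set B ev) Ts -> is_union Ts U -> zero_set B ev U)
  (hfin : forall S : disc_seq, finite_seq S -> zero_set B ev S)
  (S : disc_seq)
  (hacc : forall z : C, in_disc z -> ~ accumulation_point S z)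
  (huniq : uniqueness_set B ev S) :
  exists (w : C) (T : disc_seq),
    unit_circle w /\
    len T = None /\ subseq T S /\
    filterlim (pt T) eventually (locally w) /\
    uniqueness_set B ev T.
Proof.
  destruct (vanishing_concentration B ev hB hsub hunion S huniq) as [w Hw].
  assert (Hadm : forall d, admissible (fun i => in_dom (len S) i /\ Cmod (pt S i - w) < d) (pt S)).
  { intros d. apply admissible_subset. tauto. }
  assert (Hcirc : unit_circle w).
  { unfold unit_circle. destruct (Rtotal_order (Cmod w) 1) as [L|[E|L]]; [exfalso|exact E|exfalso].
    - assert (X : exists (eps : posreal) N, forall i, (N <= i)%nat -> in_dom (len S) i -> ~ Cmod (pt S i - w) < eps).
      { apply NNPP. intros H. apply (hacc w L). intros eps N. apply NNPP. intros H'. apply H.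
        exists eps, N. intros i Hi Hd Hc. apply H'. exists i. auto. }
      destruct X as [eps [N HX]].
      destruct (finite_vanishing B ev hB hfin _ _ N (Hadm eps)) as [b [Nb Vb]].
      { intros i [Hi1 Hi2]. apply Nat.nle_gt. intros Hle. apply (HX i Hle Hi1 Hi2). }
      apply Nb. apply (Hw eps b (cond_pos eps) Vb).
    (* If [w] is outside the closed disc, no term lies within [Cmod w - 1] of it, and
       [finite_vanishing] for the empty index set gives a nonzero element. *)
    - destruct (finite_vanishing B ev hB hfin _ _ 0 (Hadm (Cmod w - 1))) as [b [Nb Vb]].
      { intros i [Hi1 Hi2]. exfalso. pose proof (pt_disc S i Hi1) as Hd. unfold in_disc in Hd.
        pose proof (Cmod_triangle (pt S i) (- (pt S i - w))) as T. rewrite Cmod_opp in T.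
        replace (pt S i + - (pt S i - w))%C with w in T by ring. lra. }
      apply Nb. apply (Hw (Cmod w - 1) b ltac:(lra) Vb). }
  destruct countable_dense as [q Hq].
  (* The code [n] of a pair (j, N) fixes at once the point [q j], the norm bound [N] and the radius
     [1 / (n + 1)]; the finite part is cut off at [m n]. *)
  destruct (choice (fun n m => in_disc (q (fst (Cantor.of_nat n))) ->
    forall b, norm b <= INR (snd (Cantor.of_nat n)) ->
    vanishes_at_indices (ev b) (fun i => (in_dom (len S) i /\ Cmod (pt S i - w) < / (INR n + 1)) /\
      (i < m)%nat) (pt S) ->
    Cmod (ev b (q (fst (Cantor.of_nat n)))) <= / (INR (snd (Cantor.of_nat n)) + 1))) as [m Hm].
  { intros n. destruct (classic (in_disc (q (fst (Cantor.of_nat n))))) as [Hd|Hd]; [|exists 0%nat; tauto].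
    destruct (finite_part_bound B ev hB hfatou
      (fun i => in_dom (len S) i /\ Cmod (pt S i - w) < / (INR n + 1)) (pt S)
      (INR (snd (Cantor.of_nat n))) (/ (INR (snd (Cantor.of_nat n)) + 1)) (q (fst (Cantor.of_nat n))))
      as [m Hm].
    - intros b Hb. apply (Hw (/ (INR n + 1)) b (inv_INR_pos n) Hb).
    - exact Hd.
    - apply inv_INR_pos.
    - exists m. intros _. exact Hm. }
  set (P := fun i => exists n, (i < m n)%nat /\ in_dom (len S) i /\ Cmod (pt S i - w) < / (INR n + 1)).
  assert (PD : forall i, P i -> in_dom (len S) i) by (intros i [n [_ [H _]]]; exact H).
  pose proof (admissible_subset S P PD) as PA.
  destruct (enumerates_exists P (pt S) PA) as [T [e [ET FT]]].
  assert (Huniq : forall b, vanishes_at_indices (ev b) P (pt S) -> b = zero).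
  { intros b Hb.
    assert (Hz : forall j, in_disc (q j) -> ev b (q j) = 0).
    { intros j Hj. apply Cmod_eq_0. apply Rle_antisym; [|apply Cmod_ge_0].
      apply Rnot_lt_le. intros Hpos.
      destruct (archimed_inv _ Hpos) as [N1 HN1].
      destruct (INR_archimed 1 (norm b) Rlt_0_1) as [N2 HN2].
      (* Among the codes (j, N), one takes N above [norm b] and so large that 1 / (N + 1) is below
         the supposed modulus at [q j]. *)
      pose proof (Hm (Cantor.to_nat (j, (N1 + N2)%nat))) as H.
      rewrite Cantor.cancel_of_to in H. simpl fst in H. simpl snd in H.
      specialize (H Hj b).
      assert (L1 : norm b <= INR (N1 + N2)) by (rewrite plus_INR; pose proof (pos_INR N1); lra).
      specialize (H L1).
      pose proof (inv_INR_le N1 (N1 + N2) ltac:(lia)).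
      assert (V : Cmod (ev b (q j)) <= / (INR (N1 + N2) + 1)); [|lra].
      apply H. apply (vanishes_at_indices_subset _ P); [|exact Hb].
      intros i [[Q1 Q2] Q3]. eexists. split; [exact Q3|]. split; [exact Q1|exact Q2]. }
    apply (ev_inj B ev hB). intros z Dz. rewrite (embedding_zero B ev z hB Dz).
    apply NNPP. intros Nz. apply Cmod_gt_0 in Nz.
    assert (Hh : holo_ball (ev b) 0 1) by (apply holo_disc_ball, hB).
    unfold in_disc in Dz.
    destruct (Hh z) as [l Hl]; [replace (z - 0)%C with z by ring; exact Dz|].
    (* Were [ev b z] nonzero, it would stay nonzero at any [q j] where the value differs by less
       than [Cmod (ev b z)]. *)
    destruct (Cdiff_cont _ _ _ Hl _ Nz) as [d [Hd Hc]].
    destruct (Hq z (Rmin d (1 - Cmod z))) as [j Hj]; [apply Rmin_pos; lra|].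
    pose proof (Rmin_l d (1 - Cmod z)). pose proof (Rmin_r d (1 - Cmod z)).
    specialize (Hc (q j) ltac:(lra)).
    rewrite Hz in Hc.
    - replace (0 - ev b z)%C with (- ev b z)%C in Hc by ring. rewrite Cmod_opp in Hc. lra.
    - unfold in_disc. replace (q j) with ((q j - z) + z)%C by ring.
      eapply Rle_lt_trans; [apply Cmod_triangle|]. lra. }
  (* A finite [T] would be a zero set by [hfin], so a nonzero element would vanish on it. *)
  assert (LT : len T = None).
  { destruct (len T) as [n|] eqn:En; [exfalso|reflexivity].
    destruct (zero_set_vanishing B ev T P (pt S) e hB PA ET) as [b [Nb Vb]].
    - apply hfin. exists n. exact En.
    - apply Nb, Huniq, Vb. }
  exists w, T. split; [exact Hcirc|]. split; [exact LT|]. split; [|split].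
  - apply (subseq_enumerates T S P (in_dom (len S)) (pt S) e (fun k => k) ET (enumerates_self S) PD).
  - destruct ET as [E1 [E2 _]]. rewrite LT in E1, E2. simpl in E1, E2.
    intros Q HQ. apply locally_C_Cmod in HQ. destruct HQ as [d [Hd HQ]].
    destruct (archimed_inv d Hd) as [n0 Hn0].
    (* Codes below [n0] contribute only indices below [K]. As [k <= e k], the terms from position
       [K] on come from codes at least [n0] and lie within [1 / (n0 + 1)] of [w]. *)
    destruct (nat_bound m n0) as [K HK].
    exists K. intros k Hk. apply HQ.
    destruct (E1 k I) as [[n [Hn1 [_ Hn2]]] ->].
    assert (Hek : (k <= e k)%nat).
    { apply increasing_ge_id. intros j. apply E2; [trivial|trivial|lia]. }
    assert (Hn : (n0 <= n)%nat).
    { apply Nat.nlt_ge. intros L. specialize (HK n L). lia. }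
    pose proof (inv_INR_le n0 n Hn). lra.
  - intros b Hb. apply Huniq.
    apply (vanishes_on_enumerates (ev b) T P (pt S) e); try assumption.
    apply holo_disc_ball, hB.
Qed.
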